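(* Let $\mu\ge -\tfrac12$ and let $a_m,b_m,c_m,d_m,e_m\in\mathbb{R}$ ($m=1,2$) with $b_1,b_2\neq 0$. Let $f\in L^1_\mu(\mathbb{R}^2,\mathbb{H})$ be such that $\mathbb{D}^{a,b,c}_{d,e,\mu}[f]\in L^1_\mu(\mathbb{R}^2,\mathbb{H})$. Then for almost every $v=(v_1,v_2)\in\mathbb{R}^2$, $$\mathbb{D}^{-c,-b,-a}_{-e,-d,\mu}\left(\mathbb{D}^{a,b,c}_{d,e,\mu}[f]\right)(v_1,v_2)=f(v_1,v_2),$$ equivalently, $$c_\mu^2\int_{\mathbb{R}^2}\overline{\Psi^{a_1,b_1,c_1}_{d_1,e_1,\mu}(w_1,v_1)}\;\mathbb{D}^{a,b,c}_{d,e,\mu}[f](w_1,w_2)\;\overline{\Psi^{a_2,b_2,c_2}_{d_2,e_2,\mu}(w_2,v_2)}\;d\lambda_\mu(w)=f(v_1,v_2).$$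
   Context: $\mathbb{H}$ denotes Hamilton's quaternions with units $\mathbf{i},\mathbf{j},\mathbf{k}$, conjugation $\overline{q}$ and norm $|q|=\sqrt{q\overline{q}}$. Write $v=(v_1,v_2)$, $w=(w_1,w_2)\in\mathbb{R}^2$, $a=(a_1,a_2)$, and similarly for $b,c,d,e$. Measure and constant: $d\lambda_\mu(v)=|v_1|^{2\mu+1}|v_2|^{2\mu+1}\,dv_1\,dv_2$ on $\mathbb{R}^2$, and $c_\mu=\left(\int_{\mathbb{R}}e^{-x^2/2}|x|^{2\mu+1}dx\right)^{-1}$. $L^1_\mu(\mathbb{R}^2,\mathbb{H})$ is the space of measurable $f:\mathbb{R}^2\to\mathbb{H}$ with $\int_{\mathbb{R}^2}|f|\,d\lambda_\mu<\infty$. Dunkl kernel: $j_\mu(x)=\Gamma(\mu+1)\sum_{n\ge0}\frac{(-1)^n}{n!\,\Gamma(n+\mu+1)}\left(\frac{x}{2}\right)^{2n}$ and, for $\mathbf{q}\in\{\mathbf{i},\mathbf{j}\}$ and $x,y\in\mathbb{R}$, $E_\mu(\mathbf{q}x,y)=j_\mu(xy)+\frac{\mathbf{q}xy}{2(\mu+1)}j_{\mu+1}(xy)$. Two-sided quaternion quadratic-phase Dunkl transform (QQPDT), for $f\in L^1_\mu(\mathbb{R}^2,\mathbb{H})$: $$\mathbb{D}^{a,b,c}_{d,e,\mu}[f](w)=c_\mu^2\int_{\mathbb{R}^2}\Psi^{a_1,b_1,c_1}_{d_1,e_1,\mu}(w_1,v_1)\,f(v)\,\Psi^{a_2,b_2,c_2}_{d_2,e_2,\mu}(w_2,v_2)\,d\lambda_\mu(v),$$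 with $\Psi^{a_1,b_1,c_1}_{d_1,e_1,\mu}(w_1,v_1)=\frac{E_\mu(-\mathbf{i}w_1/b_1,v_1)}{(\mathbf{i}b_1)^{\mu+1}}e^{-\mathbf{i}(a_1v_1^2+c_1w_1^2+d_1v_1+e_1w_1)}$ and $\Psi^{a_2,b_2,c_2}_{d_2,e_2,\mu}(w_2,v_2)=\frac{E_\mu(-\mathbf{j}w_2/b_2,v_2)}{(\mathbf{j}b_2)^{\mu+1}}e^{-\mathbf{j}(a_2v_2^2+c_2w_2^2+d_2v_2+e_2w_2)}$. For $\mathbf{q}\in\{\mathbf{i},\mathbf{j}\}$ and real $t\ne0$, $(\mathbf{q}t)^{\mu+1}=|t|^{\mu+1}e^{\mathbf{q}\,\mathrm{sgn}(t)(\mu+1)\pi/2}$ (principal value in $\mathbb{R}+\mathbf{q}\mathbb{R}\cong\mathbb{C}$). $\mathbb{D}^{-c,-b,-a}_{-e,-d,\mu}$ is the same transform with the parameters $(a,b,c,d,e)$ replaced by $(-c,-b,-a,-e,-d)$; that is, for $F\in L^1_\mu(\mathbb{R}^2,\mathbb{H})$, $\mathbb{D}^{-c,-b,-a}_{-e,-d,\mu}(F)(v)=c_\mu^2\int_{\mathbb{R}^2}\Psi^{-c_1,-b_1,-a_1}_{-e_1,-d_1,\mu}(v_1,w_1)\,F(w)\,\Psi^{-c_2,-b_2,-a_2}_{-e_2,-d_2,\mu}(v_2,w_2)\,d\lambda_\mu(w)$, where the first kernel is built with $\mathbf{i}$ and the second with $\mathbf{j}$. *)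

(* Defs.v *)
From HB Require Import structures.
From mathcomp Require Import all_boot all_order all_algebra.
From mathcomp Require Import ring.
From mathcomp Require Import all_classical all_reals all_analysis.

Set Implicit Arguments.
Unset Strict Implicit.
Unset Printing Implicit Defensive.

Import Order.TTheory GRing.Theory Num.Theory.
Import numFieldNormedType.Exports.

Local Open Scope classical_set_scope.
Local Open Scope ring_scope.

(* [Quat x0 x1 x2 x3] is x0 + x1 i + x2 j + x3 k. *)
Record quat (R : Type) := Quat { q0 : R; q1 : R; q2 : R; q3 : R }.

Section quat_choice.
Variable R : Type.

Definition quat_tuple (q : quat R) : R * R * R * R := (q0 q, q1 q, q2 q, q3 q).
Definition tuple_quat (t : R * R * R * R) : quat R :=
  Quat t.1.1.1 t.1.1.2 t.1.2 t.2.

Lemma quat_tupleK : cancel quat_tuple tuple_quat.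
Proof. by case. Qed.

End quat_choice.

HB.instance Definition _ (R : choiceType) :=
  Choice.copy (quat R) (can_type (@quat_tupleK R)).

Section quat_ring.
Variable R : realType.
Implicit Types (p q r : quat R) (a b : R).

Definition qzero : quat R := Quat 0 0 0 0.
Definition qone : quat R := Quat 1 0 0 0.
Definition qadd p q :=
  Quat (q0 p + q0 q) (q1 p + q1 q) (q2 p + q2 q) (q3 p + q3 q).
Definition qopp q := Quat (- q0 q) (- q1 q) (- q2 q) (- q3 q).
Definition qscale a q := Quat (a * q0 q) (a * q1 q) (a * q2 q) (a * q3 q).
Definition qmul p q := Quat
  (q0 p * q0 q - q1 p * q1 q - q2 p * q2 q - q3 p * q3 q)
  (q0 p * q1 q + q1 p * q0 q + q2 p * q3 q - q3 p * q2 q)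
  (q0 p * q2 q - q1 p * q3 q + q2 p * q0 q + q3 p * q1 q)
  (q0 p * q3 q + q1 p * q2 q - q2 p * q1 q + q3 p * q0 q).

Definition qconj q := Quat (q0 q) (- q1 q) (- q2 q) (- q3 q).

Lemma qaddA : associative qadd.
Proof. by move=> p q r; congr Quat => /=; ring. Qed.
Lemma qaddC : commutative qadd.
Proof. by move=> p q; congr Quat => /=; ring. Qed.
Lemma qadd0 : left_id qzero qadd.
Proof. by case=> *; congr Quat => /=; ring. Qed.
Lemma qaddN : left_inverse qzero qopp qadd.
Proof. by move=> q; congr Quat => /=; ring. Qed.

HB.instance Definition _ :=
  GRing.isZmodule.Build (quat R) qaddA qaddC qadd0 qaddN.

Lemma qmulA : associative qmul.
Proof. by move=> p q r; congr Quat => /=; ring. Qed.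
Lemma qmul1q : left_id qone qmul.
Proof. by case=> *; congr Quat => /=; ring. Qed.
Lemma qmulq1 : right_id qone qmul.
Proof. by case=> *; congr Quat => /=; ring. Qed.
Lemma qmulDl : left_distributive qmul +%R.
Proof. by move=> p q r; congr Quat => /=; ring. Qed.
Lemma qmulDr : right_distributive qmul +%R.
Proof. by move=> p q r; congr Quat => /=; ring. Qed.
Lemma qone_neq0 : qone != 0.
Proof. by apply/eqP => -[] /eqP; rewrite oner_eq0. Qed.

HB.instance Definition _ := GRing.Zmodule_isNzRing.Build (quat R)
  qmulA qmul1q qmulq1 qmulDl qmulDr qone_neq0.

Lemma qscaleA a b q : qscale a (qscale b q) = qscale (a * b) q.
Proof. by congr Quat => /=; ring. Qed.
Lemma qscale1 : left_id 1 qscale.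
Proof. by case=> *; congr Quat => /=; ring. Qed.
Lemma qscaleDr : right_distributive qscale +%R.
Proof. by move=> a p q; congr Quat => /=; ring. Qed.
Lemma qscaleDl q : {morph qscale^~ q : a b / a + b}.
Proof. by move=> a b; congr Quat => /=; ring. Qed.

HB.instance Definition _ := GRing.Zmodule_isLmodule.Build R (quat R)
  qscaleA qscale1 qscaleDr qscaleDl.

Lemma qscaleAl a p q : a *: (p * q) = (a *: p) * q.
Proof. by congr Quat => /=; ring. Qed.
Lemma qscaleAr a p q : a *: (p * q) = p * (a *: q).
Proof. by congr Quat => /=; ring. Qed.

HB.instance Definition _ := GRing.Lmodule_isLalgebra.Build R (quat R) qscaleAl.
HB.instance Definition _ := GRing.Lalgebra_isAlgebra.Build R (quat R) qscaleAr.

(* q * qconj q is real; q0 only reads off its value. *)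
Definition qnorm q : R := Num.sqrt (q0 (q * qconj q)).

Definition qinv q : quat R := (q0 (q * qconj q))^-1 *: qconj q.

Lemma q0_mul_conj q :
  q0 (q * qconj q) = q0 q ^+ 2 + q1 q ^+ 2 + q2 q ^+ 2 + q3 q ^+ 2.
Proof. by rewrite /=; ring. Qed.

Lemma q0_mul_conj_eq0 q : (q0 (q * qconj q) == 0) = (q == 0).
Proof.
rewrite q0_mul_conj !paddr_eq0 ?addr_ge0 ?sqr_ge0// !sqrf_eq0.
by case: q => a b c d /=; apply/idP/eqP => [|[-> -> -> ->]];
  [case/andP=> /andP[/andP[/eqP-> /eqP->] /eqP->] /eqP->|rewrite eqxx].
Qed.

Lemma qmul_conj q : q * qconj q = (q0 (q * qconj q))%:A.
Proof. by congr Quat => /=; ring. Qed.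

Lemma qconj_mul q : qconj q * q = (q0 (q * qconj q))%:A.
Proof. by congr Quat => /=; ring. Qed.

Lemma qmulVq_neq0 q : q != 0 -> qinv q * q = 1.
Proof.
rewrite -q0_mul_conj_eq0 => q_neq0.
rewrite /qinv -scalerAl qconj_mul scalerA.
by rewrite (mulVf q_neq0) scale1r.
Qed.

Lemma qmulqV_neq0 q : q != 0 -> q * qinv q = 1.
Proof.
rewrite -q0_mul_conj_eq0 => q_neq0.
rewrite /qinv -scalerAr [X in _ *: X]qmul_conj scalerA.
by rewrite (mulVf q_neq0) scale1r.
Qed.

Lemma qmulVq : {in [pred q : quat R | q != 0], left_inverse 1 qinv *%R}.
Proof. exact: qmulVq_neq0. Qed.

Lemma qmulqV : {in [pred q : quat R | q != 0], right_inverse 1 qinv *%R}.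
Proof. exact: qmulqV_neq0. Qed.

Lemma qunitP p q : q * p = 1 /\ p * q = 1 -> [pred q | q != 0] p.
Proof.
case=> qp1 _ /=; apply/eqP => p0; move: qp1; rewrite p0 mulr0.
by move/esym/eqP; rewrite oner_eq0.
Qed.

Lemma qinv_out : {in [predC [pred q | q != 0]], qinv =1 id}.
Proof.
move=> q; rewrite !inE negbK => /eqP ->.
by congr Quat => /=; rewrite ?oppr0 mulr0.
Qed.

HB.instance Definition _ := GRing.NzRing_hasMulInverse.Build (quat R)
  qmulVq qmulqV qunitP qinv_out.

Definition qi : quat R := Quat 0 1 0 0.
Definition qj : quat R := Quat 0 0 1 0.
Definition qk : quat R := Quat 0 0 0 1.

(* In the next two definitions u is a unit with u * u = -1 (it is qi or qj),
   so that R + u R is a copy of the complex numbers.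
   [qcis u t] is e^(u t). *)
Definition qcis (u : quat R) (t : R) : quat R := (cos t)%:A + sin t *: u.

(* [qpow u t s] is (u t)^s for t != 0, with the principal value. *)
Definition qpow (u : quat R) (t s : R) : quat R :=
  (`|t| `^ s) *: qcis u (Num.sg t * s * pi / 2).

End quat_ring.

Arguments qi : clear implicits.
Arguments qj : clear implicits.
Arguments qk : clear implicits.

Notation leb2 R := (@lebesgue_measure R \x @lebesgue_measure R)%E.

Section dunkl.
Variable R : realType.
Implicit Types (mu : R) (f : R * R -> quat R).

Local Notation leb := (@lebesgue_measure R).
Local Notation leb2 := (leb2 R).

(* Euler's integral, used only for s > 0. *)
Definition Gamma (s : R) : R :=
  \int[leb]_(t in `]0, +oo[) (t `^ (s - 1) * expR (- t)).

Definition bessel_j mu (x : R) : R :=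
  Gamma (mu + 1) *
  limn (series (fun n =>
    (-1) ^+ n / (n`!%:R * Gamma (n%:R + mu + 1)) * (x / 2) ^+ (2 * n))).

(* [dunklE mu u x y] is E_mu(u x, y), for u = qi or qj. *)
Definition dunklE mu (u : quat R) (x y : R) : quat R :=
  (bessel_j mu (x * y))%:A
  + (x * y / (2 * (mu + 1)) * bessel_j (mu + 1) (x * y)) *: u.

Definition dunkl_c mu : R :=
  (\int[leb]_x (expR (- x ^+ 2 / 2) * `|x| `^ (2 * mu + 1)))^-1.

(* The density of lambda_mu with respect to Lebesgue measure. *)
Definition dunkl_weight mu (v : R * R) : R :=
  `|v.1| `^ (2 * mu + 1) * `|v.2| `^ (2 * mu + 1).

(* The integral of a quaternion-valued function against lambda_mu. *)
Definition qint mu f : quat R := Quat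
  (\int[leb2]_v (dunkl_weight mu v * q0 (f v)))
  (\int[leb2]_v (dunkl_weight mu v * q1 (f v)))
  (\int[leb2]_v (dunkl_weight mu v * q2 (f v)))
  (\int[leb2]_v (dunkl_weight mu v * q3 (f v))).

Definition qborel f : Prop :=
  [/\ measurable_fun setT (fun v => q0 (f v)),
      measurable_fun setT (fun v => q1 (f v)),
      measurable_fun setT (fun v => q2 (f v)) &
      measurable_fun setT (fun v => q3 (f v))].

(* The measurable sets of R * R are the Borel sets, whereas functions in L^1
   are Lebesgue measurable, that is, equal to a Borel function almost
   everywhere. The library integral, a supremum over Borel simple functions,
   is insensitive to such modifications. *)
Definition qmeasurable f : Prop :=
  exists2 g, qborel g & {ae leb2, forall v, f v = g v}.

Definition L1 mu f : Prop :=
  qmeasurable f /\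
  (\int[leb2]_v (dunkl_weight mu v * qnorm (f v))%:E < +oo)%E.

Definition Psi mu (u : quat R) (a b c d e w v : R) : quat R :=
  dunklE mu u (- w / b) v / qpow u b (mu + 1)
  * qcis u (- (a * v ^+ 2 + c * w ^+ 2 + d * v + e * w)).

Definition QQPDT mu (a b c d e : R * R) f (w : R * R) : quat R :=
  dunkl_c mu ^+ 2 *: qint mu (fun v =>
    Psi mu (qi R) a.1 b.1 c.1 d.1 e.1 w.1 v.1 * f v
    * Psi mu (qj R) a.2 b.2 c.2 d.2 e.2 w.2 v.2).

End dunkl.

(* Main.v *)
From HB Require Import structures.
From mathcomp Require Import all_boot all_order all_algebra.
From mathcomp Require Import ring lra.
From mathcomp Require Import all_classical all_reals all_analysis.
From mathcomp Require Import measurable_realfun.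
Require Import Defs.

Set Implicit Arguments.
Unset Strict Implicit.
Unset Printing Implicit Defensive.

Import Order.TTheory GRing.Theory Num.Theory.
Import numFieldNormedType.Exports.

Local Open Scope classical_set_scope.
Local Open Scope ring_scope.

(** Each kernel [Psi] takes its values in the commutative field R + R u, with
    u = i or j. There it is a positive constant times a unit phase depending on
    w only, times E_mu(-u w/b, v), times a unit phase depending on v only
    ([PsiE]). Since the first kernel multiplies f on the left and the second on
    the right, the phases in v can be moved onto f and the phases in w leave the
    integral; the conjugate kernels carry the opposite phases. So the theorem
    amounts to: the transform with kernels E_mu(-u w/b, v), followed by the one
    with kernels E_mu(u v/b, w), multiplies an integrable function h by a
    constant [kappa] as soon as its first transform is integrable
    ([kernel_transform_inversion]).

    Writing E_mu(u x) = [kern false] x + u [kern true] x, with an even and an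
    odd real function, decomposes such a transform into four scalar transforms,
    one for each pair of parities, applied to the components of h and then
    multiplied by powers of i on the left and of j on the right.

    The inversion is proved weakly, against products of one-variable test
    functions v^e exp(- s v^2 / 2), with e = 0 or 1 and s > 0. Three facts carry
    it.
    - Integrating the Bessel series term by term shows that the scalar
      transform of parity e sends v^e exp(- s v^2 / 2) to an explicit multiple
      of the same function with s replaced by 1 / (s b^2), and that it kills the
      test functions of the other parity ([mgauss_transform_div]). The product
      of the two factors met when this is done twice depends neither on e nor on
      s ([gcoef_dual]).
    - The scalar kernels are symmetric in w and v, so by Fubini's theorem a
      transform paired with a test function is the original function paired
      with the transformed test function ([real_transform_mgauss2]). Doing this
      twice, the square of i or j produced by an odd parity cancels the sign
      between the two kernels, and the double transform of h has the same
      pairings as [kappa] h ([pairing_kernel_transform2]).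
    - These pairings determine an integrable function almost everywhere
      ([mgauss_separates]): combinations of test functions converge boundedly
      to weighted indicators of half-lines, and half-lines generate the Borel
      sets.

    Fubini's theorem, and the existence of all the integrals above, rest on the
    bound |[kern]| <= 1, which comes from a decreasing energy
    ([bessel_series_energy]). *)

(** * Integrals of real functions *)

Section integral_utilities.
Context d (T : measurableType d) (R : realType).
Variable m : {measure set T -> \bar R}.
Implicit Types f g : T -> R.

Definition Rintegrable f := m.-integrable setT (EFin \o f).

Lemma Rintegrable_measurable f : Rintegrable f -> measurable_fun setT f.
Proof. by move=> /measurable_int /measurable_EFinP. Qed.

Lemma le_Rintegrable f g : measurable_fun setT f -> (forall x, `|f x| <= g x) ->
  Rintegrable g -> Rintegrable f.
Proof.
move=> mf fg; apply: le_integrable => //; first exact/measurable_EFinP.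
by move=> x _ /=; rewrite lee_fin (le_trans (fg x))// ler_norm.
Qed.

Lemma RintegrableD f g : Rintegrable f -> Rintegrable g ->
  Rintegrable (fun x => f x + g x).
Proof. by move=> rf rg; exact: (integrableD measurableT rf rg). Qed.

Lemma RintegrableZ (c : R) f : Rintegrable f -> Rintegrable (fun x => c * f x).
Proof. by move=> rf; exact: (integrableZl measurableT c rf). Qed.

Lemma Rintegrable_norm f : Rintegrable f -> Rintegrable (fun x => `|f x|).
Proof. exact: integrable_norm. Qed.

Lemma Rintegrable0 : Rintegrable (cst 0).
Proof. exact: integrable0. Qed.

(** This is how every integrability claim about a kernel is obtained: the
    kernels and the test functions are bounded. *)
Lemma Rintegrable_bounded (C : R) f g : Rintegrable f -> measurable_fun setT g ->
  (forall x, `|g x| <= C) -> Rintegrable (fun x => f x * g x).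
Proof.
move=> rf mg gC; apply: (@le_Rintegrable _ (fun x => C * `|f x|)).
- by apply: measurable_funM => //; exact: Rintegrable_measurable.
- by move=> x; rewrite normrM mulrC ler_wpM2r.
- exact/RintegrableZ/Rintegrable_norm.
Qed.

Lemma Rintegrable_sum (I : Type) (s : seq I) (f_ : I -> T -> R) :
  (forall i, Rintegrable (f_ i)) -> Rintegrable (fun x => \sum_(i <- s) f_ i x).
Proof.
move=> rf; elim: s => [|i s IH].
  by under eq_fun do rewrite big_nil; exact: Rintegrable0.
by under eq_fun do rewrite big_cons; exact: RintegrableD.
Qed.

Lemma Rintegral_sum (I : Type) (s : seq I) (f_ : I -> T -> R) :
  (forall i, Rintegrable (f_ i)) ->
  \int[m]_x (\sum_(i <- s) f_ i x) = \sum_(i <- s) \int[m]_x f_ i x.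
Proof.
move=> rf; elim: s => [|i s IH].
  under eq_Rintegral do rewrite big_nil; rewrite big_nil.
  by rewrite /Rintegral integral0.
under eq_Rintegral do rewrite big_cons; rewrite big_cons -IH.
by rewrite RintegralD//; [exact: rf|exact: Rintegrable_sum].
Qed.

Lemma Rdominated_convergence (f_ : nat -> T -> R) f g :
  (forall n, measurable_fun setT (f_ n)) -> measurable_fun setT f ->
  (forall x, f_ n x @[n --> \oo] --> f x) ->
  (forall n x, `|f_ n x| <= g x) -> Rintegrable g ->
  Rintegrable f /\ \int[m]_x f_ n x @[n --> \oo] --> \int[m]_x f x.
Proof.
move=> mf_ mf f_f fg rg.
have [||||rf _ cf] := @dominated_convergence _ _ _ m setT measurableT
   (fun n x => (f_ n x)%:E) (fun x => (f x)%:E) (fun x => (g x)%:E) _ _ _ rg.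
- by move=> n; exact/measurable_EFinP.
- exact/measurable_EFinP.
- by apply: aeW => x _; apply/cvg_EFin; [exact: nearW|exact: f_f].
- by apply: aeW => x n _ /=; rewrite lee_fin.
split => //; apply/fine_cvg.
rewrite /Rintegral fineK//.
exact: (integrable_fin_num _ rf).
Qed.

Import HBNNSimple.

Lemma ge0_integral_le_ae (f g : T -> \bar R) : (forall x, 0 <= f x)%E ->
  (forall x, 0 <= g x)%E -> {ae m, forall x, f x = g x} ->
  (\int[m]_x f x <= \int[m]_x g x)%E.
Proof.
move=> f0 g0 [N [mN N0 fgN]].
rewrite (ge0_integralTE m f0); apply: ge_ereal_sup => _ /= [h hf <-].
pose h' := mul_nnsfun h (indic_nnsfun R (measurableC mN)).
have le1 : (sintegral m h <= \int[m]_x (h' x)%:E)%E.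
  have := @integral_nnsfun _ _ _ m setT measurableT h.
  rewrite patch_setT => <-; rewrite le_eqVlt; apply/orP; left; apply/eqP.
  apply: ge0_ae_eq_integral => //.
  - exact/measurable_EFinP.
  - exact/measurable_EFinP.
  - by move=> x _; rewrite lee_fin.
  - by move=> x _; rewrite lee_fin.
  - exists N; split => // x /= /not_implyP[_]; apply: contra_notP => Nx.
    by rewrite /h' /= mindicE mem_set// mulr1.
apply: (le_trans le1).
have := @integral_nnsfun _ _ _ m setT measurableT h'.
rewrite patch_setT => ->; rewrite (ge0_integralTE m g0).
apply: ereal_sup_ubound => /=; exists h' => // x.
rewrite /h' /= mindicE; have [Nx|Nx] := boolP (x \in ~` N).
  rewrite mulr1 (le_trans (hf x))// (_ : f x = g x)//.
  by apply: contrapT => fgx; move: Nx; rewrite inE; apply; exact: fgN.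
by rewrite mulr0.
Qed.

(** The integral of a nonnegative function is a supremum over simple functions,
    and these can be set to 0 on a null set. So no measurability is required of
    f and g, which matters because an L^1 function here is only almost
    everywhere equal to a Borel one. *)
Lemma integral_ae (f g : T -> \bar R) : {ae m, forall x, f x = g x} ->
  (\int[m]_x f x = \int[m]_x g x)%E.
Proof.
move=> fg; rewrite integralE [RHS]integralE.
have fgp : {ae m, forall x, (f^\+ x = g^\+ x)%E}.
  by apply: filterS fg => x /= fgx; rewrite !funeposE fgx.
have fgn : {ae m, forall x, (f^\- x = g^\- x)%E}.
  by apply: filterS fg => x /= fgx; rewrite !funenegE fgx.
have sym (u v : T -> \bar R) : {ae m, forall x, u x = v x} ->
  {ae m, forall x, v x = u x}.
  by apply: filterS.
congr (_ - _)%E; apply/eqP; rewrite eq_le; apply/andP; split;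
  apply: ge0_integral_le_ae => //; exact: sym.
Qed.

Lemma Rintegral_ae f g : {ae m, forall x, f x = g x} ->
  \int[m]_x f x = \int[m]_x g x.
Proof.
by move=> fg; congr fine; apply: integral_ae; apply: filterS fg => x /= ->.
Qed.

End integral_utilities.

(** * Products of sigma-finite measures *)

Section product_measure.
Context d1 d2 (T1 : measurableType d1) (T2 : measurableType d2) (R : realType).
Variable m1 : {sigma_finite_measure set T1 -> \bar R}.
Variable m2 : {sigma_finite_measure set T2 -> \bar R}.

(** The product measure under a name of its own, to which the sigma-finite
    structure is attached: products of two such measures are then measures to
    which Fubini applies. *)
Definition prodm : set (T1 * T2) -> \bar R := (m1 \x m2)%E.

HB.instance Definition _ := Measure.on prodm.

Lemma prodm_sigma_finite : sigma_finite setT prodm.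
Proof.
have /sigma_finiteP[F [TF ndF Foo]] := sigma_finiteT m1.
have /sigma_finiteP[G [TG ndG Goo]] := sigma_finiteT m2.
exists (fun n => F n `*` G n).
  rewrite -setXTT TF TG; apply/seteqP; split=> -[x y].
    move=> [/= [n _ Fnx] [k _ Gky]]; exists (maxn n k) => //; split => /=.
    - by move: x Fnx; exact/subsetPset/ndF/leq_maxl.
    - by move: y Gky; exact/subsetPset/ndG/leq_maxr.
  by move=> [n _ []/= ? ?]; split; exists n.
move=> k; have [mF Fk] := Foo k; have [mG Gk] := Goo k.
split; first exact: measurableX.
by rewrite /prodm product_measure1E// lte_mul_pinfty// ge0_fin_numE.
Qed.

HB.instance Definition _ := Measure_isSigmaFinite.Build _ _ _ prodm
  prodm_sigma_finite.

End product_measure.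

Section fubini_utilities.
Context d1 d2 (T1 : measurableType d1) (T2 : measurableType d2) (R : realType).
Variable m1 : {sigma_finite_measure set T1 -> \bar R}.
Variable m2 : {sigma_finite_measure set T2 -> \bar R}.

Lemma Rintegrable_prod (f : T1 -> R) (g : T2 -> R) : Rintegrable m1 f ->
  Rintegrable m2 g ->
  Rintegrable (m1 \x m2)%E (fun z => f z.1 * g z.2).
Proof.
move=> rf rg; have mf := Rintegrable_measurable rf;
  have mg := Rintegrable_measurable rg.
have mfg : measurable_fun setT (fun z : T1 * T2 => f z.1 * g z.2).
  apply: measurable_funM.
    by apply: (measurableT_comp mf); exact: measurable_fst.
  by apply: (measurableT_comp mg); exact: measurable_snd.
apply/integrable12ltyP; first exact/measurable_EFinP.
have /integrableP[_ gfin] := rg; have /integrableP[_ ffin] := rf.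
have mEg : measurable_fun setT (fun y => `|g y|%:E).
  by apply/measurable_EFinP; exact: measurableT_comp.
have mEf : measurable_fun setT (fun y => `|f y|%:E).
  by apply/measurable_EFinP; exact: measurableT_comp.
rewrite (_ : \int[m1]_x _ = \int[m1]_x (`|f x|%:E * \int[m2]_y `|g y|%:E))%E;
  last first.
  apply: eq_integral => x _; rewrite -ge0_integralZl//.
  by apply: eq_integral => y _; rewrite /= normrM EFinM.
have gf : (\int[m2]_y `|g y|%:E)%E \is a fin_num by rewrite ge0_fin_numE// integral_ge0.
rewrite -(fineK gf) ge0_integralZr//.
- by rewrite (fineK gf) lte_mul_pinfty// ?integral_ge0// ge0_fin_numE// integral_ge0.
- by rewrite lee_fin fine_ge0// integral_ge0.
Qed.

(** The hypothesis on all sections replaces the usual almost everywhere one; it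
    holds for the kernels below and makes the inner integral finite at every
    point. *)
Lemma Rfubini12 (f : T1 * T2 -> R) : Rintegrable (m1 \x m2)%E f ->
  (forall x, Rintegrable m2 (fun y => f (x, y))) ->
  \int[m1]_x \int[m2]_y f (x, y) = \int[(m1 \x m2)%E]_z f z.
Proof.
move=> rf r2; rewrite /Rintegral -integral12_prod_meas1//.
congr fine; apply: eq_integral => x _; rewrite fineK//.
exact: (integrable_fin_num _ (r2 x)).
Qed.

Lemma Rfubini21 (f : T1 * T2 -> R) : Rintegrable (m1 \x m2)%E f ->
  (forall y, Rintegrable m1 (fun x => f (x, y))) ->
  \int[m2]_y \int[m1]_x f (x, y) = \int[(m1 \x m2)%E]_z f z.
Proof.
move=> rf r2; rewrite /Rintegral -integral21_prod_meas1//.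
congr fine; apply: eq_integral => x _; rewrite fineK//.
exact: (integrable_fin_num _ (r2 x)).
Qed.

Lemma Rfubini (f : T1 * T2 -> R) : Rintegrable (m1 \x m2)%E f ->
  (forall x, Rintegrable m2 (fun y => f (x, y))) ->
  (forall y, Rintegrable m1 (fun x => f (x, y))) ->
  \int[m1]_x \int[m2]_y f (x, y) = \int[m2]_y \int[m1]_x f (x, y).
Proof. by move=> rf r1 r2; rewrite Rfubini12// Rfubini21. Qed.

Lemma Rintegral_prod (f : T1 -> R) (g : T2 -> R) : Rintegrable m1 f ->
  Rintegrable m2 g ->
  \int[(m1 \x m2)%E]_z (f z.1 * g z.2) = (\int[m1]_x f x) * (\int[m2]_y g y).
Proof.
move=> rf rg; rewrite -(@Rfubini12 (fun z => f z.1 * g z.2))/=.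
- rewrite -RintegralZr//; apply: eq_Rintegral => x _.
  by rewrite RintegralZl.
- exact: Rintegrable_prod.
- by move=> x; exact: RintegrableZ.
Qed.

Lemma measurable_Rfubini (f : T1 * T2 -> R) : Rintegrable (m1 \x m2)%E f ->
  (forall x, Rintegrable m2 (fun y => f (x, y))) ->
  measurable_fun setT (fun x => \int[m2]_y f (x, y)).
Proof.
move=> rf r2; apply/measurable_EFinP.
have := @measurable_fubini_F _ _ _ _ _ m1 m2 _ rf.
apply: eq_measurable_fun => x _ /=; rewrite /fubini_F /Rintegral fineK//.
exact: (integrable_fin_num _ (r2 x)).
Qed.

End fubini_utilities.

(** * The functional equation of Euler's integral *)

Section power_moments.
Variable R : realType.
Local Notation leb := (@lebesgue_measure R).
Local Open Scope ereal_scope.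

Lemma powR_continuous_at (p x : R) : (0 < x)%R -> {for x, continuous (@powR R ^~ p)}.
Proof.
move=> x0; apply/differentiable_continuous/derivable1_diffP.
exact: (ex_derive (is_derive := is_derive1_powR p x0)).
Qed.

Lemma integral_powR_itv (p a y : R) : (0 < a)%R -> (a < y)%R ->
  \int[leb]_(x in `[a, y]) (p * x `^ (p - 1))%:E = (y `^ p - a `^ p)%:E.
Proof.
move=> a0 ay; rewrite (@continuous_FTC2 R _ (@powR R ^~ p)) ?EFinB//.
- apply/continuous_in_subspaceT => x /[!inE]/= /[!in_itv]/= /andP[ax _].
  by apply: cvgMr; apply: powR_continuous_at; exact: lt_le_trans ax.
- split.
  + move=> x /[!in_itv]/= /andP[ax _]; apply: derivable_powR.
    by rewrite in_itv/= andbT (lt_trans a0).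
  + exact/cvg_at_right_filter/powR_continuous_at.
  + exact/cvg_at_left_filter/powR_continuous_at/(lt_trans a0).
- move=> x /[!in_itv]/= /andP[ax _].
  by rewrite powR_derive1// in_itv/= andbT (lt_trans a0).
Qed.

Lemma integral_powR0 (p y : R) : (0 < p)%R -> (0 < y)%R ->
  \int[leb]_(x in `]0%R, y]) (p * x `^ (p - 1))%:E = (y `^ p)%:E.
Proof.
move=> p0 y0; pose a n : R := (y / n.+2%:R)%R.
have a0 n : (0 < a n)%R by rewrite divr_gt0.
have ay n : (a n < y)%R by rewrite ltr_pdivrMr// ltr_pMr// ltr1n.
have -> : `]0%R, y]%classic = \bigcup_n `[a n, y]%classic.
  apply/seteqP; split=> [x /= /[!in_itv]/= /andP[x0 xy]|x [n _]/= /[!in_itv]/=].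
    have [n yn] : exists n, (y / x < n%:R)%R.
      by exists (Num.truncn (y / x)).+1; exact: truncnS_gt.
    exists n => //=; rewrite in_itv/= xy andbT ler_pdivrMr// -ler_pdivrMl//.
    by rewrite mulrC (le_trans (ltW yn))// ler_nat; apply/leqW.
  by case/andP=> ax ->; rewrite (lt_le_trans _ ax).
apply/esym/(@cvg_unique _ _ (\int[leb]_(x in `[a i, y]) (p * x `^ (p - 1))%:E
  @[i --> \oo])) => //; last first.
  apply: ge0_nondecreasing_set_cvg_integral.
  - move=> m n mn; apply/subsetPset => x /=; rewrite !in_itv/= => /andP[ax ->].
    by rewrite (le_trans _ ax)// ler_pM2l// lef_pV2 ?posrE// ler_nat.
  - by move=> i; exact: measurable_itv.
  - move=> i; apply/measurable_EFinP; apply: measurable_funM => //.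
    exact: measurable_funTS.
  - by move=> *; rewrite lee_fin mulr_ge0 ?powR_ge0// ltW.
rewrite /=.
rewrite (_ : (fun i => _) = (fun i => (y `^ p - a i `^ p)%:E)); last first.
  by apply/funext => i; rewrite integral_powR_itv.
apply/cvg_EFin; first exact: nearW.
rewrite -[X in _ --> X]subr0.
apply: cvgB; first exact: cvg_cst.
move/cvg_at_rightP : (powR_cvg0 p0); apply; split=> //.
rewrite -[X in _ --> X](mulr0 y); apply: cvgMr.
by have := @cvg_harmonic R; rewrite -cvg_shiftS.
Qed.

(** Tonelli on 0 < u <= y, since p u^(p-1) integrates to y^p on ]0, y]. Taking
    for g the functions exp(- y) and y exp(- y^2/2), which are minus the
    derivatives of their tails, it gives the functional equations of Gamma and
    of the Gaussian moments without integrating by parts on an unbounded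
    interval. *)
Lemma integral_powR_tail (g G : R -> R) (p : R) : (0 < p)%R ->
  measurable_fun setT g -> (forall x, 0 <= x -> 0 <= g x)%R ->
  (forall u, (0 < u)%R -> \int[leb]_(y in `]u, +oo[) (g y)%:E = (G u)%:E) ->
  \int[leb]_(u in `]0%R, +oo[) (p * u `^ (p - 1) * G u)%:E =
  \int[leb]_(y in `]0%R, +oo[) (y `^ p * g y)%:E.
Proof.
move=> p0 mg g0 gG.
pose A := [set z : R * R | 0 < z.1 /\ z.1 <= z.2]%R.
have mA : measurable A.
  rewrite /A; apply: measurableI.
    rewrite -[X in measurable X]setTI.
    by apply: measurable_fun_ltr => //; exact: measurable_fst.
  rewrite -[X in measurable X]setTI.
  exact: (measurable_fun_ler measurable_fst measurable_snd).
pose f := fun z : R * R => (p * z.1 `^ (p - 1) * g z.2 * \1_A z)%:E.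
have f0 z : 0 <= f z.
  rewrite /f lee_fin indicE; have [|_] := boolP (z \in A); last by rewrite mulr0.
  rewrite inE /A /= => -[z1 z2]; rewrite mulr1; apply: mulr_ge0.
    by rewrite mulr_ge0 ?powR_ge0// ltW.
  by apply: g0; rewrite (le_trans _ z2)// ltW.
have mf : measurable_fun setT f.
  apply/measurable_EFinP; apply: measurable_funM => //.
  apply: measurable_funM.
    apply: measurable_funM => //.
    by apply: (measurableT_comp (measurable_powR _)) => //; exact: measurable_fst.
  by apply: measurableT_comp => //; exact: measurable_snd.
rewrite [RHS]integral_mkcond [LHS]integral_mkcond.
transitivity (\int[leb]_x \int[leb]_y f (x, y));
  [|rewrite (@fubini_tonelli _ _ _ _ R leb leb f mf f0)];
    apply: eq_integral => x _; rewrite patchE.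
  case: ifPn => [|/negP]; rewrite inE/= in_itv/= andbT => x0.
    transitivity (\int[leb]_(y in `[x, +oo[) ((p * x `^ (p - 1))%:E * (g y)%:E)).
      rewrite ge0_integralZl//.
      - by rewrite -integral_itv_obnd_cbnd ?gG//;
        exact/measurable_EFinP/measurable_funTS.
      - by apply/measurable_EFinP/measurable_funTS.
      - by move=> y/=; rewrite in_itv/= andbT => xy;
        rewrite lee_fin g0// (le_trans _ xy)// ltW.
      - by rewrite lee_fin mulr_ge0 ?powR_ge0// ltW.
    rewrite integral_mkcond; apply: eq_integral => y _.
    rewrite patchE /f indicE /A/=; case: ifPn => [|/negP];
      rewrite inE/= in_itv/= andbT => xy.
      by rewrite mem_set//= mulr1 EFinM.
    by rewrite memNset/= ?mulr0// => -[].
  apply/esym/integral0_eq => y _; rewrite /f indicE memNset/= ?mulr0// /A/= => -[].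
  by move=> /x0.
case: ifPn => [|/negP]; rewrite inE/= in_itv/= andbT => x0.
  transitivity (\int[leb]_(y in `]0%R, x]) ((g x)%:E * (p * y `^ (p - 1))%:E)).
    rewrite [RHS]integral_mkcond; apply: eq_integral => y _.
    rewrite patchE /f indicE /A/=; case: ifPn => [|/negP]; rewrite inE/= in_itv/=.
      by move=> /andP[y0 yx]; rewrite mem_set//= mulr1 -EFinM mulrC.
    by move=> yx; rewrite memNset/= ?mulr0// => -[? ?]; apply: yx; apply/andP.
  rewrite ge0_integralZl//.
  - by rewrite integral_powR0// -EFinM mulrC.
  - apply/measurable_EFinP; apply: measurable_funM => //; exact: measurable_funTS.
  - by move=> y _; rewrite lee_fin mulr_ge0 ?powR_ge0// ltW.
  - by rewrite lee_fin g0// ltW.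
apply: integral0_eq => y _; rewrite /f indicE memNset/= ?mulr0// /A/= => -[y0 yx].
by apply: x0; exact: lt_le_trans yx.
Qed.

Lemma integral_expRN_tail (u : R) :
  \int[leb]_(y in `]u, +oo[) (expR (- y))%:E = (expR (- u))%:E.
Proof.
have cE : continuous (fun y : R => expR (- y)).
  by move=> y; apply: continuous_comp; [exact: continuousN|exact: continuous_expR].
rewrite integral_itv_obnd_cbnd; last first.
  by apply/measurable_EFinP/measurable_funTS; exact: continuous_measurable_fun.
rewrite (@ge0_continuous_FTC2y _ _ (fun y => - expR (- y))%R _ 0%R).
- by rewrite EFinN oppeK add0e.
- by move=> *; exact: expR_ge0.
- exact: continuous_subspaceT.
- by rewrite -oppr0; apply: cvgN; exact: cvgr_expR.
- by move=> x _; apply: derivableN; apply: diff_derivable;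
  apply: differentiable_comp; [|exact/derivable1_diffP].
- by apply: cvgN; apply/cvg_at_right_filter; exact: cE.
- move=> x _; rewrite derive1E deriveN; last first.
    by apply: diff_derivable; apply: differentiable_comp; [|exact/derivable1_diffP].
  by rewrite -derive1E derive1_comp//= derive1E derive_val derive1E deriveN//
    derive_id mulrN1 opprK.
Qed.

Lemma integral_gauss_tail (u : R) : (0 <= u)%R ->
  \int[leb]_(y in `]u, +oo[) (y * expR (- (y ^+ 2 / 2)))%:E =
    (expR (- (u ^+ 2 / 2)))%:E.
Proof.
move=> u0.
have cE : continuous (fun y : R => expR (- (y ^+ 2 / 2))%R).
  move=> y; apply: continuous_comp; last exact: continuous_expR.
  by apply: continuousN; apply: cvgMl; exact: exprn_continuous.
have cyE : continuous (fun y : R => y * expR (- (y ^+ 2 / 2))%R)%R.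
  by move=> y; apply: cvgM; [exact: cvg_id|exact: cE].
rewrite integral_itv_obnd_cbnd; last first.
  by apply/measurable_EFinP/measurable_funTS; exact: continuous_measurable_fun.
have dE (x : R) : is_derive x (1%R:R) (fun y => - expR (- (y ^+ 2 / 2)))%R
  (x * expR (- (x ^+ 2 / 2)))%R.
  apply: is_derive_eq.
  by rewrite /GRing.scale /=; field.
rewrite (@ge0_continuous_FTC2y _ _ (fun y => - expR (- (y ^+ 2 / 2)))%R _ 0%R).
- by rewrite EFinN oppeK add0e.
- by move=> x ux; rewrite mulr_ge0 ?expR_ge0// (le_trans u0).
- exact: continuous_subspaceT.
- rewrite -oppr0; apply: cvgN.
  apply: (cvg_comp (fun x : R => x ^+ 2 / 2)%R (fun x => expR (- x)));
    last exact: cvgr_expR.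
  by apply: gt0_cvgMly => //; exact: cvgr_expr2.
- by move=> x _.
- by apply: cvgN; apply/cvg_at_right_filter; exact: cE.
- by move=> x _; rewrite derive1E derive_val.
Qed.

(** Euler's integral as an extended real, so that Tonelli applies before
    finiteness is known. *)
Definition eGamma (s : R) : \bar R :=
  \int[leb]_(t in `]0%R, +oo[) (t `^ (s - 1) * expR (- t))%:E.

Lemma measurable_expRN : measurable_fun [set: R] (fun x : R => expR (- x)).
Proof. exact: measurableT_comp. Qed.

Lemma eGamma_ge0 s : 0 <= eGamma s.
Proof.
by apply: integral_ge0 => x _; rewrite lee_fin mulr_ge0 ?powR_ge0 ?expR_ge0.
Qed.

Lemma measurable_Gamma_integrand (s : R) D :
  measurable_fun D (fun t : R => (t `^ (s - 1) * expR (- t))%:E).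
Proof.
apply/measurable_EFinP/measurable_funTS; apply: measurable_funM => //.
exact: measurable_expRN.
Qed.

Lemma eGammaD1 s : (0 < s)%R -> eGamma (s + 1) = s%:E * eGamma s.
Proof.
move=> s0; rewrite /eGamma addrK.
rewrite -(@integral_powR_tail (fun y => expR (- y))%R (fun y => expR (- y))%R)//.
- rewrite -ge0_integralZl//.
  + by apply: eq_integral => x _; rewrite -EFinM mulrA.
  + exact: measurable_Gamma_integrand.
  + by move=> x _; rewrite lee_fin mulr_ge0 ?powR_ge0 ?expR_ge0.
  + by rewrite lee_fin ltW.
- exact: measurable_expRN.
- by move=> *; exact: integral_expRN_tail.
Qed.

Lemma eGamma1 : eGamma 1 = 1.
Proof.
rewrite /eGamma; under eq_integral do rewrite subrr powRr0 mul1r.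
by rewrite integral_expRN_tail oppr0 expR0.
Qed.

Lemma eGamma_nat_lty (n : nat) : eGamma n.+1%:R < +oo.
Proof.
elim: n => [|n IH]; first by rewrite eGamma1 ltry.
by rewrite -natr1 eGammaD1// lte_mul_pinfty// lee_fin.
Qed.

(** Finiteness is first known for integer exponents; this domination carries it
    to real ones. *)
Lemma powR_le_1Dnat (x r : R) (n : nat) : (0 <= x)%R -> (0 <= r)%R ->
  (r <= n%:R)%R -> (x `^ r <= 1 + x ^+ n)%R.
Proof.
move=> x0 r0 rn; have [x1|x1] := leP x 1%R.
  apply: (@le_trans _ _ 1%R); last by rewrite lerDl exprn_ge0.
  rewrite (_ : 1 = 1 `^ r)%R; last by rewrite powR1.
    by rewrite ge0_ler_powR// nnegrE.
rewrite -powR_mulrn//; apply: (@le_trans _ _ (x `^ n%:R)%R); last by rewrite lerDr.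
by rewrite ler_powR// ltW.
Qed.

Lemma eGamma_ge1_lty s : (1 <= s)%R -> eGamma s < +oo.
Proof.
move=> s1; pose n := Num.truncn s.
have sn : (s - 1 <= n%:R)%R.
  by rewrite lerBlDr natr1 ltW// truncnS_gt.
apply: (@le_lt_trans _ _ (eGamma 1 + eGamma n.+1%:R)); last first.
  by rewrite eGamma1 lte_add_pinfty ?ltry// eGamma_nat_lty.
rewrite /eGamma -ge0_integralD//; first last.
- exact: measurable_Gamma_integrand.
- by move=> x _; rewrite lee_fin mulr_ge0 ?powR_ge0 ?expR_ge0.
- exact: measurable_Gamma_integrand.
- by move=> x _; rewrite lee_fin mulr_ge0 ?powR_ge0 ?expR_ge0.
apply: ge0_le_integral => //.
- by move=> x _; rewrite lee_fin mulr_ge0 ?powR_ge0 ?expR_ge0.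
- exact: measurable_Gamma_integrand.
- by apply: emeasurable_funD; exact: measurable_Gamma_integrand.
- move=> x /=; rewrite in_itv/= andbT => x0.
  rewrite -EFinD lee_fin -mulrDl ler_wpM2r ?expR_ge0//.
  rewrite subrr powRr0 -natr1 addrK powR_mulrn ?(ltW x0)//.
  by rewrite powR_le_1Dnat ?subr_ge0// (ltW x0).
Qed.

Lemma eGamma_ge1_gt0 s : (1 <= s)%R -> 0 < eGamma s.
Proof.
move=> s1; apply: (@lt_le_trans _ _ (\int[leb]_(x in `[1%R, 2%R]) (expR (- 2))%:E)).
  rewrite integral_cst//= lebesgue_measure_itv/= lte_fin ltr1n -EFinD -EFinM lte_fin.
  by rewrite mulr_gt0 ?expR_gt0// subr_gt0 ltr1n.
apply: (@le_trans _ _ (\int[leb]_(x in `[1%R, 2%R]) (x `^ (s - 1) * expR (- x))%:E)).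
  apply: ge0_le_integral => //.
  - exact: measurable_Gamma_integrand.
  - move=> x /=; rewrite in_itv/= => /andP[x1 x2]; rewrite lee_fin.
    rewrite -[leLHS]mul1r ler_pM ?expR_ge0//; last by rewrite ler_expR lerN2.
    rewrite [leLHS](_ : 1 = 1 `^ (s - 1))%R; last by rewrite powR1.
    by rewrite ge0_ler_powR ?nnegrE ?subr_ge0// (le_trans _ x1).
apply: ge0_subset_integral => //.
- exact: measurable_Gamma_integrand.
- by move=> x _; rewrite lee_fin mulr_ge0 ?powR_ge0 ?expR_ge0.
- by move=> x /=; rewrite !in_itv/= andbT => /andP[x1 _]; exact: lt_le_trans x1.
Qed.

(** For s < 1 finiteness is read backwards from eGamma (s + 1) = s eGamma s,
    the left side being finite. *)
Lemma Gamma_eGamma s : (0 < s)%R -> eGamma s = (Gamma s)%:E.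
Proof.
move=> s0; rewrite /Gamma /Rintegral fineK// ge0_fin_numE ?eGamma_ge0//.
rewrite -/(eGamma s).
have : eGamma (s + 1) < +oo by rewrite eGamma_ge1_lty// lerDr ltW.
rewrite eGammaD1//; have := eGamma_ge0 s.
by case: (eGamma s) => // [r _ _|_]; rewrite ?ltry// gt0_muley ?lte_fin.
Qed.

Lemma GammaD1 s : (0 < s)%R -> (@Gamma R (s + 1) = s * Gamma s)%R.
Proof.
move=> s0; apply: EFin_inj; rewrite -Gamma_eGamma ?addr_gt0// eGammaD1//.
by rewrite Gamma_eGamma.
Qed.

Lemma Gamma_gt0 s : (0 < s)%R -> (0 < @Gamma R s)%R.
Proof.
move=> s0; have : 0 < eGamma (s + 1) by rewrite eGamma_ge1_gt0// lerDr ltW.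
by rewrite eGammaD1// Gamma_eGamma// -EFinM lte_fin pmulr_rgt0.
Qed.

End power_moments.

(** * Absolute moments of Gaussians *)

Section gaussian_moments.
Variable R : realType.
Local Notation leb := (@lebesgue_measure R).
Local Open Scope ereal_scope.

(** Extended-real valued for the same reason as [eGamma]. *)
Definition half_moment (q s : R) : \bar R :=
  \int[leb]_(x in `]0%R, +oo[) (x `^ q * expR (- (s * x ^+ 2 / 2)))%:E.

Lemma measurable_gauss (s : R) : measurable_fun [set: R]
  (fun x : R => expR (- (s * x ^+ 2 / 2))).
Proof.
apply: measurableT_comp => //; apply: measurableT_comp => //.
by apply: measurable_funM => //; apply: measurable_funM.
Qed.

Lemma measurable_half_moment (q s : R) D :
  measurable_fun D (fun x : R => (x `^ q * expR (- (s * x ^+ 2 / 2)))%:E).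
Proof.
apply/measurable_EFinP/measurable_funTS; apply: measurable_funM => //.
exact: measurable_gauss.
Qed.

Lemma half_moment_integrand_ge0 (q s x : R) : 0 <=
  (x `^ q * expR (- (s * x ^+ 2 / 2)))%:E.
Proof. by rewrite lee_fin mulr_ge0 ?powR_ge0 ?expR_ge0. Qed.

Lemma half_moment_ge0 q s : 0 <= half_moment q s.
Proof. by apply: integral_ge0 => x _; exact: half_moment_integrand_ge0. Qed.

Lemma half_momentD2 (q : R) : (-1 < q)%R -> half_moment (q + 2) 1 =
  (q + 1)%:E * half_moment q 1.
Proof.
move=> q1; have p0 : (0 < q + 1)%R by rewrite -ltrBlDr sub0r.
transitivity (\int[leb]_(y in `]0%R, +oo[)
  (y `^ (q + 1) * (y * expR (- (y ^+ 2 / 2))))%:E).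
  apply: eq_integral => x; rewrite inE/= in_itv/= andbT => x0.
  rewrite mul1r mulrA (_ : q + 2 = q + 1 + 1)%R; last by ring.
  by rewrite powRD ?(gt_eqF x0) ?implybT// powRr1// ltW.
rewrite -(@integral_powR_tail _ _ (fun y => expR (- (y ^+ 2 / 2)))%R)//.
- rewrite -ge0_integralZl//.
  + by apply: eq_integral => x _; rewrite -EFinM mulrA addrK mul1r.
  + exact: measurable_half_moment.
  + by move=> x _; exact: half_moment_integrand_ge0.
  + by rewrite lee_fin ltW.
- apply: measurable_funM => //; have := measurable_gauss 1.
  by under eq_fun do rewrite mul1r.
- by move=> x x0; rewrite mulr_ge0 ?expR_ge0.
- by move=> u u0; apply: integral_gauss_tail; exact: ltW.
Qed.

Lemma half_moment_odd_lty (n : nat) : half_moment (n.*2.+1%:R) 1 < +oo.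
Proof.
elim: n => [|n IH].
  rewrite /half_moment (_ : \int[leb]_(x in _) _ =
      \int[leb]_(y in `]0%R, +oo[) (y * expR (- (y ^+ 2 / 2)))%:E).
    by rewrite integral_gauss_tail// ltry.
  apply: eq_integral => x; rewrite inE/= in_itv/= andbT => x0.
  by rewrite powRr1 ?mul1r// ltW.
rewrite doubleS -[n.*2.+3]addn2 natrD half_momentD2//.
  by rewrite lte_mul_pinfty// ?lee_fin ?addr_ge0//.
by rewrite (@lt_le_trans _ _ 0%R)// ?ltrN10.
Qed.

(** Completing the square, exp(- x^2/2) <= exp(1/2) exp(- x). *)
Lemma half_moment0_lty : half_moment 0 1 < +oo.
Proof.
apply: (@le_lt_trans _ _ (\int[leb]_(x in `]0%R, +oo[)
  ((expR (2^-1))%:E * (expR (- x))%:E))).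
  apply: ge0_le_integral => //.
  - by move=> x _; exact: half_moment_integrand_ge0.
  - exact: measurable_half_moment.
  - apply: measurable_funeM; apply/measurable_EFinP/measurable_funTS.
    exact: measurable_expRN.
  - move=> x _; rewrite powRr0 mul1r -EFinM lee_fin -expRD ler_expR.
    by have := sqr_ge0 (x - 1)%R; rewrite expr2; lra.
rewrite ge0_integralZl//.
- by rewrite integral_expRN_tail -EFinM ltry.
- apply/measurable_EFinP/measurable_funTS; exact: measurable_expRN.
Qed.

Lemma half_moment_lty (q : R) : (0 <= q)%R -> half_moment q 1 < +oo.
Proof.
move=> q0; pose n := Num.truncn q.
have sn : (q <= n.*2.+1%:R)%R.
  rewrite ltW// (lt_le_trans (truncnS_gt _))// ler_nat ltnS -addnn leq_addr//.
apply: (@le_lt_trans _ _ (half_moment 0 1 + half_moment n.*2.+1%:R 1)); last first.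
  by rewrite lte_add_pinfty ?half_moment0_lty// half_moment_odd_lty.
rewrite /half_moment -ge0_integralD//; first last.
- exact: measurable_half_moment.
- by move=> x _; exact: half_moment_integrand_ge0.
- exact: measurable_half_moment.
- by move=> x _; exact: half_moment_integrand_ge0.
apply: ge0_le_integral => //.
- by move=> x _; exact: half_moment_integrand_ge0.
- exact: measurable_half_moment.
- by apply: emeasurable_funD; exact: measurable_half_moment.
- move=> x /=; rewrite in_itv/= andbT => x0.
  rewrite -EFinD lee_fin -mulrDl ler_wpM2r ?expR_ge0//.
  by rewrite powRr0 powR_mulrn ?(ltW x0)// powR_le_1Dnat// ltW.
Qed.

Lemma half_moment_gt0 (q : R) : (0 <= q)%R -> 0 < half_moment q 1.
Proof.
move=> q0; apply: (@lt_le_trans _ _ (\int[leb]_(x in `[1%R, 2%R]) (expR (- 2))%:E)).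
  rewrite integral_cst//= lebesgue_measure_itv/= lte_fin ltr1n -EFinD -EFinM lte_fin.
  by rewrite mulr_gt0 ?expR_gt0// subr_gt0 ltr1n.
apply: (@le_trans _ _ (\int[leb]_(x in `[1%R, 2%R])
  (x `^ q * expR (- (1 * x ^+ 2 / 2)))%:E)).
  apply: ge0_le_integral => //.
  - exact: measurable_half_moment.
  - move=> x /=; rewrite in_itv/= => /andP[x1 x2]; rewrite lee_fin.
    rewrite -[leLHS]mul1r ler_pM ?expR_ge0//; last first.
      by rewrite ler_expR lerN2; nra.
    rewrite [leLHS](_ : 1 = 1 `^ q)%R; last by rewrite powR1.
    by rewrite ge0_ler_powR ?nnegrE// (le_trans _ x1).
apply: ge0_subset_integral => //.
- exact: measurable_half_moment.
- by move=> x _; exact: half_moment_integrand_ge0.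
- by move=> x /=; rewrite !in_itv/= andbT => /andP[x1 _]; exact: lt_le_trans x1.
Qed.

Lemma half_moment_scale (q s : R) : (0 <= q)%R -> (0 < s)%R ->
  half_moment q s = (s `^ (- ((q + 1) / 2)))%:E * half_moment q 1.
Proof.
move=> q0 s0; pose k := Num.sqrt s; have k0 : (0 < k)%R by rewrite sqrtr_gt0.
have k2 : (k ^+ 2 = s)%R by rewrite sqr_sqrtr// ltW.
pose G (x : R) := (x `^ q * expR (- (1 * x ^+ 2 / 2)))%R.
pose F (x : R) := (k * x)%R.
have dF : (F^`() = cst k)%classic.
  by apply/funext => x; rewrite derive1E derive_val /GRing.scale/= mulr1.
have gE : continuous (fun y : R => expR (- (1 * y ^+ 2 / 2))%R).
  move=> y; apply: continuous_comp; last exact: continuous_expR.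
  by apply: continuousN; apply: cvgMl; apply: cvgMr; exact: exprn_continuous.
have := @increasing_ge0_integration_by_substitutiony R F G 0%R.
have F0 : F 0%R = 0%R by rewrite /F mulr0.
rewrite F0 dF => H.
have {}H : \int[leb]_(x in `[0%R, +oo[) (G x)%:E =
  \int[leb]_(x in `[0%R, +oo[) ((G (k * x) * k)%:E).
  apply: H.
  - by move=> x y _ _; rewrite ltr_pM2l.
  - by move=> x _; exact: cst_continuous.
  - exact: is_cvg_cst.
  - exact: is_cvg_cst.
  - split; first by move=> x _; exact: derivableM.
    by rewrite F0 -[X in _ --> X](mulr0 k); apply: cvgMr; exact: cvg_at_right_filter.
  - exact: gt0_cvgMry.
  - apply/continuous_within_itvcyP; split.
      move=> x; rewrite in_itv/= andbT => x0.
      by apply: cvgM; [exact: powR_continuous_at|exact: gE].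
    apply: cvgM; last by apply: cvg_at_right_filter; exact: gE.
    have [->|qn0] := eqVneq q 0%R.
      by under eq_fun do rewrite powRr0; rewrite powRr0; exact: cvg_cst.
    by rewrite powR0//; apply: powR_cvg0; rewrite lt_neqAle eq_sym qn0.
  - by move=> x _; rewrite mulr_ge0 ?powR_ge0 ?expR_ge0.
move: H; rewrite -!integral_itv_obnd_cbnd; last 2 first.
  - apply/measurable_EFinP; apply: measurable_funM => //.
    have /measurable_EFinP mh := @measurable_half_moment q 1 setT.
    by apply: measurable_funTS; apply: (measurableT_comp mh); exact: mulrl_measurable.
  - exact: measurable_half_moment.
rewrite -/(half_moment q 1) => ->.
rewrite -ge0_integralZl//; last 3 first.
  - apply/measurable_EFinP; apply: measurable_funM => //.
    have /measurable_EFinP mh := @measurable_half_moment q 1 setT.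
    by apply: measurable_funTS; apply: (measurableT_comp mh); exact: mulrl_measurable.
  - by move=> x _; rewrite lee_fin !mulr_ge0 ?powR_ge0 ?expR_ge0// ltW.
  - by rewrite lee_fin powR_ge0.
apply: eq_integral => x; rewrite inE/= in_itv/= andbT => x0.
rewrite -EFinM; congr EFin; rewrite /G exprMn k2 mul1r powRM ?(ltW x0) ?(ltW k0)//.
rewrite (_ : k = s `^ (2^-1))%R; last by rewrite powR12_sqrt// ltW.
rewrite -powRrM.
transitivity (x `^ q * expR (- (s * x ^+ 2 / 2)) *
  (s `^ (- ((q + 1) / 2)) * s `^ (2^-1 * q) * s `^ 2^-1))%R; last by ring.
rewrite -!powRD ?(gt_eqF s0) ?implybT//.
by rewrite (_ : _ + _ + _ = 0)%R ?powRr0 ?mulr1//; field.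
Qed.

Lemma ge0_even_integral (f : R -> R) : measurable_fun setT f ->
  (forall x, 0 <= f x)%R -> (forall x, f (- x) = f x)%R ->
  \int[leb]_x (f x)%:E = 2%:E * \int[leb]_(x in `]0%R, +oo[) (f x)%:E.
Proof.
move=> mf f0 fe.
have mEf (D : set R) : measurable_fun D (fun x => (f x)%:E).
  by apply/measurable_EFinP/measurable_funTS.
rewrite -(setUv `]0%R, +oo[%classic) ge0_integral_setU//=; first last.
- exact/disj_setPCl.
- by move=> x _; rewrite lee_fin.
- by rewrite setUv; exact: mEf.
- exact: measurableC.
rewrite [in X in _ + X](_ : ~` _ = `]-oo, 0%R]%classic); last first.
  apply/seteqP; split=> x /=; rewrite !in_itv/= andbT; first by move=> /negP;
    rewrite leNgt.
  by rewrite leNgt => /negP.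
rewrite mule_natl mule2n; congr (_ + _).
rewrite [RHS]integral_itv_obnd_cbnd; last exact: mEf.
rewrite (@ge0_integration_by_substitution0 _ (fun x => (f x)%:E)) //.
by apply: eq_integral => x _; rewrite fe.
Qed.

Definition gauss_moment (q s : R) : R := (\int[leb]_x
  (`|x| `^ q * expR (- (s * x ^+ 2 / 2))))%R.

Lemma measurable_gauss_moment (q s : R) :
  measurable_fun setT (fun x : R => (`|x| `^ q * expR (- (s * x ^+ 2 / 2)))%R).
Proof.
apply: measurable_funM; last exact: measurable_gauss.
by apply: (measurableT_comp (measurable_powR _)).
Qed.

Lemma egauss_moment_half (q s : R) :
  \int[leb]_x (`|x| `^ q * expR (- (s * x ^+ 2 / 2)))%:E = 2%:E * half_moment q s.
Proof.
rewrite ge0_even_integral.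
- apply: (congr1 (fun z => 2%:E * z)).
  apply: eq_integral => x; rewrite inE/= in_itv/= andbT => x0.
  by rewrite gtr0_norm.
- exact: measurable_gauss_moment.
- by move=> x; rewrite mulr_ge0 ?powR_ge0 ?expR_ge0.
- by move=> x; rewrite normrN sqrrN.
Qed.

Lemma half_moment_fin (q s : R) : (0 <= q)%R -> (0 < s)%R ->
  half_moment q s \is a fin_num.
Proof.
move=> q0 s0; rewrite half_moment_scale// fin_numM// ge0_fin_numE ?half_moment_ge0//.
exact: half_moment_lty.
Qed.

Lemma gauss_moment_half (q s : R) : (0 <= q)%R -> (0 < s)%R ->
  (gauss_moment q s)%:E = 2%:E * half_moment q s.
Proof.
move=> q0 s0; rewrite /gauss_moment /Rintegral egauss_moment_half fineK//.
by rewrite fin_numM// half_moment_fin.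
Qed.

Lemma integrable_gauss_moment (q s : R) : (0 <= q)%R -> (0 < s)%R ->
  leb.-integrable setT (fun x => (`|x| `^ q * expR (- (s * x ^+ 2 / 2)))%:E).
Proof.
move=> q0 s0; apply/integrableP; split.
  by apply/measurable_EFinP; exact: measurable_gauss_moment.
under eq_integral do rewrite gee0_abs ?lee_fin ?mulr_ge0 ?powR_ge0 ?expR_ge0//.
by rewrite egauss_moment_half -gauss_moment_half// ltry.
Qed.

Local Close Scope ereal_scope.

Lemma gauss_momentD2 (q : R) : 0 <= q -> gauss_moment (q + 2) 1 =
  (q + 1) * gauss_moment q 1.
Proof.
move=> q0; apply: EFin_inj; rewrite EFinM !gauss_moment_half// ?addr_ge0//.
rewrite half_momentD2 ?muleA; last by rewrite (lt_le_trans _ q0)// ltrN10.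
by rewrite -!EFinM mulrC.
Qed.

Lemma gauss_moment_scale (q s : R) : 0 <= q -> 0 < s -> gauss_moment q s =
  s `^ (- ((q + 1) / 2)) * gauss_moment q 1.
Proof.
move=> q0 s0; apply: EFin_inj; rewrite EFinM !gauss_moment_half// half_moment_scale//.
by rewrite muleA -EFinM mulrC EFinM muleA.
Qed.

Lemma gauss_moment_gt0 (q : R) : 0 <= q -> 0 < gauss_moment q 1.
Proof.
by move=> q0; rewrite -lte_fin gauss_moment_half// mule_gt0// half_moment_gt0.
Qed.

End gaussian_moments.

(** * The normalised Bessel functions and the Dunkl kernel *)

Section bessel.
Variable R : realType.
Local Notation leb := (@lebesgue_measure R).
Implicit Types (mu t x y s : R) (n : nat).

Definition gamma_ratio mu n : R := Gamma (mu + 1) / Gamma (n%:R + mu + 1).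

(** The coefficients of j_mu as a power series in the square of its argument.
    *)
Definition bessel_coef mu n : R := (-1) ^+ n * gamma_ratio mu n / (n`!%:R * 4 ^+ n).

Definition bessel_series mu t : R := limn (pseries (bessel_coef mu) t).

Lemma gt0_natD_half mu n : - (1 / 2) <= mu -> 0 < n%:R + mu + 1.
Proof. by move=> hmu; have : 0 <= n%:R :> R by []; lra. Qed.

Lemma gamma_ratio0 mu : - (1 / 2) <= mu -> gamma_ratio mu 0 = 1.
Proof.
move=> hmu; rewrite /gamma_ratio add0r divff// gt_eqF// Gamma_gt0//.
by have := @gt0_natD_half mu 0 hmu; rewrite add0r.
Qed.

Lemma GammaS mu n : - (1 / 2) <= mu ->
  @Gamma R (n.+1%:R + mu + 1) = (n%:R + mu + 1) * Gamma (n%:R + mu + 1).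
Proof.
move=> hmu; rewrite (_ : n.+1%:R + mu + 1 = n%:R + mu + 1 + 1); last first.
  by rewrite -natr1; ring.
by rewrite GammaD1// gt0_natD_half.
Qed.

Lemma gamma_ratioS mu n : - (1 / 2) <= mu -> gamma_ratio mu n.+1 =
  gamma_ratio mu n / (n%:R + mu + 1).
Proof.
move=> hmu; rewrite /gamma_ratio GammaS//.
by rewrite invfM mulrA mulrAC.
Qed.

Lemma gamma_ratio_gt0 mu n : - (1 / 2) <= mu -> 0 < gamma_ratio mu n.
Proof.
move=> hmu; elim: n => [|n IH]; first by rewrite gamma_ratio0.
by rewrite gamma_ratioS// divr_gt0// gt0_natD_half.
Qed.

(** Each step divides by n + mu + 1, which is at least (n + 1)/2 because mu >=
    -1/2. *)
Lemma gamma_ratio_le mu n : - (1 / 2) <= mu -> gamma_ratio mu n <= 2 ^+ n / n`!%:R.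
Proof.
move=> hmu; elim: n => [|n IH]; first by rewrite gamma_ratio0// expr0 fact0 divr1.
rewrite gamma_ratioS// exprS factS natrM invfM.
rewrite [leRHS](_ : _ = (2 ^+ n / n`!%:R) * (2 / n.+1%:R)); last by ring.
apply: ler_pM => //; first exact/ltW/gamma_ratio_gt0.
  by rewrite invr_ge0 ltW// gt0_natD_half.
rewrite -[leRHS]invrK lef_pV2 ?posrE ?invr_gt0 ?divr_gt0 ?gt0_natD_half//.
rewrite invf_div ler_pdivrMr// -natr1; have : 0 <= n%:R :> R by [].
by lra.
Qed.

Lemma gamma_ratio_shift mu n : - (1 / 2) <= mu ->
  gamma_ratio (mu + 1) n = (mu + 1) * gamma_ratio mu n.+1.
Proof.
move=> hmu; rewrite /gamma_ratio GammaD1; last first.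
  by have := @gt0_natD_half mu 0 hmu; rewrite add0r.
rewrite mulrA (_ : n%:R + (mu + 1) + 1 = n.+1%:R + mu + 1)//.
by rewrite -natr1; ring.
Qed.

Lemma bessel_coef_norm mu n t : - (1 / 2) <= mu ->
  `|bessel_coef mu n * t ^+ n| <= exp_coeff (`|t| / 2) n / n`!%:R.
Proof.
move=> hmu; rewrite /bessel_coef /exp_coeff/=.
have := gamma_ratio_le n hmu; have := gamma_ratio_gt0 n hmu.
move: (gamma_ratio mu n) => g g0 gle.
rewrite !normrM normrX normrN1 expr1n mul1r.
rewrite normfV normrM !normrX (gtr0_norm g0) !normr_nat.
rewrite expr_div_n.
rewrite [leRHS](_ : _ = (2 ^+ n / n`!%:R) / (n`!%:R * 4 ^+ n) * `|t| ^+ n); last first.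
  rewrite (_ : 4 = 2 * 2 :> R); last by ring.
  by rewrite exprMn; field; rewrite ?expf_neq0 ?pnatr_eq0 -?lt0n ?fact_gt0.
rewrite ler_wpM2r// ler_wpM2r// invr_ge0 mulr_ge0.
Qed.

Lemma exp_coeff_le_expR (x : R) n : 0 <= x -> exp_coeff x n <= expR x.
Proof.
move=> x0; apply: (@le_trans _ _ (series (exp_coeff x) n.+1)).
  rewrite seriesEnat/= big_nat_recr//= lerDr sumr_ge0// => i _.
  by rewrite exp_coeff_ge0.
apply: nondecreasing_cvgn_le; last exact: is_cvg_series_exp_coeff.
by apply/nondecreasing_seqP => k; rewrite !seriesEnat/= big_nat_recr//= lerDl
  exp_coeff_ge0.
Qed.

Lemma series_exp_coeff_le (x : R) n : 0 <= x -> series (exp_coeff x) n <= expR x.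
Proof.
move=> x0; apply: nondecreasing_cvgn_le; last exact: is_cvg_series_exp_coeff.
by apply/nondecreasing_seqP => k; rewrite !seriesEnat/= big_nat_recr//= lerDl
  exp_coeff_ge0.
Qed.

Lemma cvg_bessel_series mu t : - (1 / 2) <= mu -> cvgn (pseries (bessel_coef mu) t).
Proof.
move=> hmu; apply: normed_cvg; apply: (@series_le_cvg _ _ (exp_coeff (`|t| / 2))).
- by move=> n; exact: normr_ge0.
- by move=> n; rewrite exp_coeff_ge0// divr_ge0.
- move=> n; apply: (le_trans (bessel_coef_norm _ _ hmu)).
  rewrite ler_pdivrMr ?ltr0n ?fact_gt0// ler_peMr ?ler1n ?fact_gt0//.
  by rewrite exp_coeff_ge0// divr_ge0.
- exact: is_cvg_series_exp_coeff.
Qed.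

(** Splitting |t|/2 as the product of 1/d and d |t|/2 bounds the n-th term by a
    product of two exponential terms. The rate d is arbitrarily small: this is
    what lets a Gaussian dominate all the partial sums at once. *)
Lemma bessel_series_partial_le mu t d n : - (1 / 2) <= mu -> 0 < d ->
  `|pseries (bessel_coef mu) t n| <= expR (d^-1) * expR (d * `|t| / 2).
Proof.
move=> hmu d0; rewrite /pseries seriesEnat/=.
apply: (le_trans (ler_norm_sum _ _ _)).
apply: (@le_trans _ _ (\sum_(0 <= k < n) expR (d^-1) * exp_coeff (d * `|t| / 2) k));
  last first.
  rewrite -mulr_sumr ler_wpM2l ?expR_ge0//.
  have := @series_exp_coeff_le (d * `|t| / 2) n; rewrite seriesEnat/=; apply.
  by rewrite divr_ge0// mulr_ge0// ltW.
apply: ler_sum => k _; apply: (le_trans (bessel_coef_norm _ _ hmu)).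
rewrite [leLHS](_ : _ = exp_coeff d^-1 k * exp_coeff (d * `|t| / 2) k); last first.
  rewrite /exp_coeff/= [in LHS](_ : `|t| / 2 = d^-1 * (d * `|t| / 2)); last first.
    by rewrite -mulrA mulKf// gt_eqF.
  by rewrite exprMn; ring.
rewrite ler_wpM2r ?exp_coeff_ge0 ?divr_ge0// ?mulr_ge0 ?exp_coeff_le_expR//
  ?invr_ge0// ltW//.
Qed.

(** The derivative of j_mu is, up to a factor, j_(mu+1). *)
Lemma bessel_coef_diffs mu : - (1 / 2) <= mu ->
  pseries_diffs (bessel_coef mu) = (- (4 * (mu + 1))^-1) *: bessel_coef (mu + 1).
Proof.
move=> hmu; apply/funext => n; rewrite /pseries_diffs /bessel_coef.
rewrite [RHS](_ : _ = - (4 * (mu + 1))^-1 * bessel_coef (mu + 1) n)// /bessel_coef.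
rewrite gamma_ratio_shift// exprS exprS factS natrM.
have : mu + 1 != 0 by rewrite gt_eqF//; lra.
by move=> mu0; field; rewrite mu0 nat1r expf_neq0 ?pnatr_eq0 -?lt0n ?fact_gt0.
Qed.

Lemma pseriesZ (c : R) (f : nat -> R) t : pseries (c *: f) t = c *: pseries f t.
Proof.
apply/funext => n; rewrite [RHS](_ : _ = c * pseries f t n)// /pseries /series/=
  mulr_sumr.
by apply: eq_bigr => i _; rewrite mulrA.
Qed.

Lemma cvg_pseriesZ (c : R) (f : nat -> R) t : cvgn (pseries f t) ->
  cvgn (pseries (c *: f) t).
Proof. by move=> cf; rewrite pseriesZ; exact: is_cvgZl_tmp. Qed.

Lemma pseries_diffsZ (c : R) (f : nat -> R) :
  pseries_diffs (c *: f) = c *: pseries_diffs f.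
Proof.
apply/funext => n; rewrite [RHS](_ : _ = c * pseries_diffs f n)// /pseries_diffs.
by rewrite [(c *: f) _](_ : _ = c * f n.+1)// mulrCA.
Qed.

Lemma lim_diffs mu t : - (1 / 2) <= mu ->
  limn (pseries (pseries_diffs (bessel_coef mu)) t) =
    - (4 * (mu + 1))^-1 * bessel_series (mu + 1) t.
Proof.
move=> hmu; rewrite bessel_coef_diffs// pseriesZ limZl_tmp//.
by apply: cvg_bessel_series; lra.
Qed.

Lemma is_derive_bessel_series mu t : - (1 / 2) <= mu ->
  is_derive t (1 : R) (bessel_series mu) (- (4 * (mu + 1))^-1 * bessel_series
    (mu + 1) t).
Proof.
move=> hmu; have hmu1 : - (1 / 2) <= mu + 1 by lra.
have hmu2 : - (1 / 2) <= mu + 1 + 1 by lra.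
rewrite -lim_diffs//.
apply: (@pseries_snd_diffs _ _ (`|t| + 1)).
- exact: cvg_bessel_series.
- by rewrite bessel_coef_diffs//; apply: cvg_pseriesZ; exact: cvg_bessel_series.
- rewrite bessel_coef_diffs// pseries_diffsZ; apply: cvg_pseriesZ.
  by rewrite bessel_coef_diffs//; apply: cvg_pseriesZ; exact: cvg_bessel_series.
- by rewrite [ltRHS]ger0_norm ?addr_ge0// ltrDl.
Qed.

Lemma continuous_bessel_series mu : - (1 / 2) <= mu -> continuous (bessel_series mu).
Proof.
move=> hmu t; apply/differentiable_continuous/derivable1_diffP.
exact: (ex_derive (is_derive := is_derive_bessel_series t hmu)).
Qed.

Lemma bessel_series0 mu : - (1 / 2) <= mu -> bessel_series mu 0 = 1.
Proof.
move=> hmu; apply/cvg_lim => //; rewrite -(cvg_shiftS).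
rewrite (_ : [sequence _]_n = cst 1); first exact: cvg_cst.
apply/funext => n; rewrite /pseries/= seriesEnat/= big_nat_recl//= big1 ?addr0.
  by rewrite expr0 mulr1 /bessel_coef gamma_ratio0// !expr0 fact0 !mulr1 divr1.
by move=> i _; rewrite expr0n mulr0.
Qed.

(** Compare coefficients: those of index mu + 1 are (mu + 1) / (n + mu + 1)
    times those of index mu. *)
Lemma bessel_series_rec mu t : - (1 / 2) <= mu ->
  bessel_series mu t = bessel_series (mu + 1) t
    + t / (mu + 1) * (- (4 * (mu + 1 + 1))^-1 * bessel_series (mu + 1 + 1) t).
Proof.
move=> hmu; have hmu1 : - (1 / 2) <= mu + 1 by lra.
have mu0 : mu + 1 != 0 by rewrite gt_eqF//; lra.
rewrite -lim_diffs//.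
have c1 : cvgn (pseries (bessel_coef (mu + 1)) t) by exact: cvg_bessel_series.
have c2 : cvgn (pseries (pseries_diffs (bessel_coef (mu + 1))) t).
  by rewrite bessel_coef_diffs//; apply: cvg_pseriesZ; apply: cvg_bessel_series; lra.
have /= c3 := pseries_diffs_equiv c2.
apply/cvg_lim => //.
have -> : pseries (bessel_coef mu) t = (fun n => pseries (bessel_coef (mu + 1)) t n +
   t / (mu + 1) * [series i%:R * bessel_coef (mu + 1) i * t ^+ i.-1]_i n).
  apply/funext => n; rewrite /pseries /series/= mulr_sumr -big_split/=.
  apply: eq_bigr => i _.
  rewrite [X in _ + X](_ : _ = i%:R / (mu + 1) * bessel_coef (mu + 1) i * t ^+ i);
    last first.
    by case: i => [|i]; rewrite ?mul0r ?mulr0//= [in RHS]exprS; ring.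
  rewrite -mulrDl; congr (_ * _).
  rewrite /bessel_coef gamma_ratio_shift// gamma_ratioS//.
  have i0 : i%:R + mu + 1 != 0 by rewrite gt_eqF// gt0_natD_half.
  by field; rewrite mu0 i0 expf_neq0 ?pnatr_eq0 -?lt0n ?fact_gt0.
by apply: cvgD => //; apply: cvgMr.
Qed.

Lemma is_derive_energy (A B : R -> R) (c x a b : R) :
  is_derive x (1 : R) A a -> is_derive x (1 : R) B b ->
  is_derive x (1 : R) (fun x => A x ^+ 2 + x * (B x * c) ^+ 2)
    (2 * A x * a + (B x * c) ^+ 2 + x * (2 * (B x * c) * (b * c))).
Proof.
move=> dA dB; apply: is_derive_eq.
by rewrite /GRing.scale/=; ring.
Qed.

(** By the recurrence, the derivative of the left side is (1 - 2 (mu + 1))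
    times a square, hence nonpositive exactly because mu >= -1/2; and the left
    side is 1 at t = 0. With t = x^2 this is the sum of the squares of the even
    and odd parts of the Dunkl kernel. *)
Lemma bessel_series_energy mu t : - (1 / 2) <= mu -> 0 <= t ->
  bessel_series mu t ^+ 2 + t * (bessel_series (mu + 1) t / (2 * (mu + 1))) ^+ 2 <= 1.
Proof.
move=> hmu t0; have hmu1 : - (1 / 2) <= mu + 1 by lra.
pose Q x := bessel_series mu x ^+ 2 + x *
  (bessel_series (mu + 1) x / (2 * (mu + 1))) ^+ 2.
have m0 : 0 < mu + 1 by lra.
pose dQ x := (bessel_series (mu + 1) x / (2 * (mu + 1))) ^+ 2 * (1 - 2 * (mu + 1)).
have isdQ x : is_derive x (1 : R) Q (dQ x).
  have d1 := is_derive_bessel_series x hmu.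
  have d2 := is_derive_bessel_series x hmu1.
  have E := bessel_series_rec x hmu.
  have := is_derive_energy (2 * (mu + 1))^-1 d1 d2.
  rewrite -[X in is_derive _ _ X]/Q (_ : _ + _ = dQ x)//.
  rewrite /dQ E.
  have m1 : mu + 1 != 0 by rewrite gt_eqF.
  have m2 : mu + 1 + 1 != 0 by rewrite gt_eqF// addr_gt0.
  move: (bessel_series (mu + 1) x) (bessel_series (mu + 1 + 1) x) m1 m2 => u v.
  by move: (mu + 1) => m m1 m2; field; rewrite m1 m2.
have [c _ Qc] : exists2 c, c \in `[0, t]%R & Q t - Q 0 = dQ c * (t - 0).
  apply: MVT_segment => //.
  apply/continuous_in_subspaceT => x _.
  apply/differentiable_continuous/derivable1_diffP.
  exact: (ex_derive (is_derive := isdQ x)).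
have -> : bessel_series mu t ^+ 2 + t * (bessel_series (mu + 1) t / (2 * (mu + 1)))
  ^+ 2 = Q 0 + dQ c * t.
  by move: Qc; rewrite subr0 => <-; rewrite [RHS]addrC subrK.
rewrite /Q mul0r addr0 bessel_series0// expr1n gerDl /dQ.
by rewrite mulr_le0_ge0// mulr_ge0_le0 ?sqr_ge0//; lra.
Qed.

Lemma bessel_jE mu x : - (1 / 2) <= mu -> bessel_j mu x = bessel_series mu (x ^+ 2).
Proof.
move=> hmu; have G0 : Gamma (mu + 1) != 0 :> R by rewrite gt_eqF// Gamma_gt0//; lra.
have E : pseries (bessel_coef mu) (x ^+ 2) = (Gamma (mu + 1)) *: (series (fun n =>
    (-1) ^+ n / (n`!%:R * Gamma (n%:R + mu + 1)) * (x / 2) ^+ (2 * n)) : nat -> R).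
  apply/funext => n; rewrite [RHS](_ : _ = Gamma (mu + 1) * series (fun n =>
    (-1) ^+ n / (n`!%:R * Gamma (n%:R + mu + 1)) * (x / 2) ^+ (2 * n)) n)//.
  rewrite /pseries /series/= mulr_sumr.
  apply: eq_bigr => i _; rewrite /bessel_coef /gamma_ratio [in RHS]exprM.
  rewrite (_ : (x / 2) ^+ 2 = x ^+ 2 / 4); last by field.
  rewrite [in RHS]expr_div_n.
  have : Gamma (i%:R + mu + 1) != 0 :> R by rewrite gt_eqF// Gamma_gt0 ?gt0_natD_half.
  move: (Gamma (mu + 1)) (Gamma (i%:R + mu + 1)) => u v v0.
  by field; rewrite v0 expf_neq0 ?pnatr_eq0 -?lt0n ?fact_gt0.
rewrite /bessel_j /bessel_series; have cJ : cvgn (pseries (bessel_coef mu) (x ^+ 2))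
  by exact: cvg_bessel_series.
rewrite E limZl_tmp//.
have : cvgn ((Gamma (mu + 1))^-1 *: pseries (bessel_coef mu) (x ^+ 2)) by exact:
  is_cvgZl_tmp.
rewrite E scalerA mulVf// scale1r; exact.
Qed.

(** The even part (false) and the odd part (true) of the Dunkl kernel: E_mu(u
    x) = kern false mu x + kern true mu x * u. *)
Definition kern (odd_part : bool) mu x : R :=
  if odd_part then x / (2 * (mu + 1)) * bessel_j (mu + 1) x else bessel_j mu x.

Lemma kern_energy mu x : - (1 / 2) <= mu ->
  kern false mu x ^+ 2 + kern true mu x ^+ 2 <= 1.
Proof.
move=> hmu; have hmu1 : - (1 / 2) <= mu + 1 by lra.
have := bessel_series_energy hmu (sqr_ge0 x).
rewrite /kern !bessel_jE//.
by rewrite [X in _ + X](_ : _ = (x / (2 * (mu + 1)) * bessel_series (mu + 1)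
  (x ^+ 2)) ^+ 2)//; ring.
Qed.

Lemma kern_le1 e mu x : - (1 / 2) <= mu -> `|kern e mu x| <= 1.
Proof.
move=> hmu; have := kern_energy x hmu => H.
rewrite -(@ler_pXn2r _ 2)// ?nnegrE// expr1n real_normK ?num_real//.
by case: e; apply: le_trans H; rewrite ?lerDl ?lerDr sqr_ge0.
Qed.

Lemma continuous_bessel_j mu : - (1 / 2) <= mu -> continuous (@bessel_j R mu).
Proof.
move=> hmu x; rewrite (_ : bessel_j mu = (fun x => bessel_series mu (x ^+ 2)));
  last first.
  by apply/funext => z; rewrite bessel_jE.
by apply: (@continuous_comp _ _ _ (fun x : R => x ^+ 2));
  [exact: exprn_continuous|exact: continuous_bessel_series].
Qed.

Lemma continuous_kern e mu : - (1 / 2) <= mu -> continuous (kern e mu).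
Proof.
move=> hmu x; have hmu1 : - (1 / 2) <= mu + 1 by lra.
case: e; last exact: continuous_bessel_j.
rewrite /kern; apply: cvgM; last exact: continuous_bessel_j.
by apply: cvgMl; exact: cvg_id.
Qed.

Lemma measurable_kern e mu : - (1 / 2) <= mu -> measurable_fun setT (kern e mu).
Proof. by move=> hmu; apply: continuous_measurable_fun; exact: continuous_kern. Qed.

Lemma kernN e mu x : kern e mu (- x) = (-1) ^+ e * kern e mu x.
Proof.
have jN (m : R) : bessel_j m (- x) = bessel_j m x.
  rewrite /bessel_j; congr (_ * _).
  rewrite (_ : (fun n => _) = (fun n => (-1) ^+ n / (n`!%:R * Gamma (n%:R + m + 1))
    * (x / 2) ^+ (2 * n)))//.
  by apply/funext => n; rewrite !exprM mulNr sqrrN.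
by case: e; rewrite /kern jN ?expr0 ?mul1r// expr1 !mulNr mul1r.
Qed.

End bessel.

(** * The one-variable transform of Gaussian test functions *)

Section gauss_transform.
Variable R : realType.
Local Notation leb := (@lebesgue_measure R).
Implicit Types (mu t x y s v : R) (n : nat) (e : bool).

Lemma absr_powD2n mu n v : - (1 / 2) <= mu ->
  `|v| `^ (2 * mu + 1) * (v ^+ 2) ^+ n = `|v| `^ (2 * (n%:R + mu) + 1).
Proof.
move=> hmu; case: n => [|n]; first by rewrite expr0 mulr1 add0r.
have n0 : 0 <= n%:R :> R by [].
rewrite -(real_normK (num_real v)) -exprM -powR_mulrn// -powRD.
  by rewrite natrM; congr (_ `^ _); ring.
by apply/implyP => /eqP; rewrite natrM -natr1; lra.
Qed.

Lemma gauss_moment_nat mu n : - (1 / 2) <= mu ->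
  gauss_moment (2 * (n%:R + mu) + 1) 1 = 2 ^+ n / gamma_ratio mu n * gauss_moment
    (2 * mu + 1) 1.
Proof.
move=> hmu; elim: n => [|n IH]; first by rewrite gamma_ratio0// add0r expr0 divr1 mul1r.
rewrite (_ : 2 * (n.+1%:R + mu) + 1 = (2 * (n%:R + mu) + 1) + 2); last first.
  by rewrite -natr1; ring.
have n0 : 0 <= n%:R :> R by [].
rewrite gauss_momentD2; last by lra.
rewrite IH gamma_ratioS// exprS.
have g0 := gamma_ratio_gt0 n hmu; have m0 := gt0_natD_half n hmu.
move: (gamma_ratio mu n) g0 => g g0.
by field; rewrite (gt_eqF g0) (gt_eqF m0).
Qed.

Definition weight1 mu v : R := `|v| `^ (2 * mu + 1).

Lemma weight1_ge0 mu v : 0 <= weight1 mu v. Proof. exact: powR_ge0. Qed.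

Lemma measurable_weight1 mu : measurable_fun setT (weight1 mu).
Proof. by apply: (measurableT_comp (measurable_powR _)). Qed.

Definition gauss s v : R := expR (- (s * v ^+ 2 / 2)).

Definition mgauss e s v : R := v ^+ e * gauss s v.

Lemma measurable_mgauss e s : measurable_fun setT (mgauss e s).
Proof.
by apply: measurable_funM; [exact: exprn_measurable|exact: measurable_gauss].
Qed.

Lemma le_half_powD1 mu : - (1 / 2) <= mu -> 0 <= 2 * mu + 1.
Proof. by move=> ?; lra. Qed.

Lemma Rintegrable_weight1_gauss mu s : - (1 / 2) <= mu -> 0 < s ->
  Rintegrable leb (fun v => weight1 mu v * gauss s v).
Proof.
by move=> hmu s0; apply: integrable_gauss_moment => //; exact: le_half_powD1.
Qed.

Lemma bessel_gauss_termE mu y s v i :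
  - (1 / 2) <= mu -> weight1 mu v * (bessel_coef mu i * ((y * v) ^+ 2) ^+ i * gauss
    s v) =
  bessel_coef mu i * y ^+ 2 ^+ i * (`|v| `^ (2 * (i%:R + mu) + 1) * gauss s v).
Proof.
by move=> hmu; rewrite -absr_powD2n// [(y * v) ^+ 2]exprMn exprMn /weight1; ring.
Qed.

Lemma bessel_gauss_term mu y s i : - (1 / 2) <= mu -> 0 < s ->
  bessel_coef mu i * y ^+ 2 ^+ i * gauss_moment (2 * (i%:R + mu) + 1) s =
  gauss_moment (2 * mu + 1) 1 * s `^ (- (mu + 1)) * exp_coeff (- (y ^+ 2 / (2 * s))) i.
Proof.
move=> hmu s0; have i0 : 0 <= i%:R :> R by [].
rewrite gauss_moment_scale//; last by lra.
rewrite (_ : - _ = - (mu + 1) + - i%:R); last by field.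
rewrite powRD; last by rewrite (gt_eqF s0) implybT.
rewrite powR_invn ?ltW// gauss_moment_nat// /bessel_coef /exp_coeff/=.
rewrite [in RHS]exprNn expr_div_n exprMn (_ : 4 = 2 * 2 :> R); last by ring.
rewrite [in LHS]exprMn [(2 * s) ^+ i]exprMn.
have := gamma_ratio_gt0 i hmu; move: (gamma_ratio mu i) (s `^ _) => g q g0.
by field; rewrite (gt_eqF g0) !expf_neq0 ?(gt_eqF s0)// pnatr_eq0 -lt0n fact_gt0.
Qed.

(** Integrate the series term by term: the moments of the Gaussian cancel the
    Gamma ratios and leave an exponential series. *)
Lemma integral_bessel_gauss mu y s : - (1 / 2) <= mu -> 0 < s ->
  \int[leb]_v (weight1 mu v * (bessel_j mu (y * v) * gauss s v)) =
  gauss_moment (2 * mu + 1) 1 * s `^ (- (mu + 1)) * expR (- (y ^+ 2 / (2 * s))).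
Proof.
move=> hmu s0.
pose f_ n v := weight1 mu v * (pseries (bessel_coef mu) ((y * v) ^+ 2) n * gauss s v).
(* d y^2 / 2 <= s / 4, so exp(d (y v)^2 / 2) costs at most half of the scale of
   gauss s *)
pose d := s / (2 * (y ^+ 2 + 1)).
have y20 : 0 <= y ^+ 2 by exact: sqr_ge0.
have d0 : 0 < d by rewrite divr_gt0// mulr_gt0// ltr_wpDl.
pose g v := expR d^-1 * (weight1 mu v * gauss (s / 2) v).
have f_E n v : f_ n v = \sum_(i <- iota 0 n) (bessel_coef mu i * y ^+ 2 ^+ i
    * (`|v| `^ (2 * (i%:R + mu) + 1) * gauss s v)).
  rewrite /f_ /pseries /series/= mulr_suml mulr_sumr /index_iota subn0.
  by apply: eq_bigr => i _; rewrite bessel_gauss_termE.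
have rterm i : Rintegrable leb (fun v => bessel_coef mu i * y ^+ 2 ^+ i
    * (`|v| `^ (2 * (i%:R + mu) + 1) * gauss s v)).
  apply/RintegrableZ/integrable_gauss_moment => //.
  by have : 0 <= i%:R :> R by []; lra.
have rf n : Rintegrable leb (f_ n).
  by rewrite (funext (f_E n)); exact: Rintegrable_sum.
have [|||||_ cf] := @Rdominated_convergence _ _ _ leb f_
    (fun v => weight1 mu v * (bessel_j mu (y * v) * gauss s v)) g.
- by move=> n; apply: Rintegrable_measurable; exact: rf.
- apply: measurable_funM; first exact: measurable_weight1.
  apply: measurable_funM; last exact: measurable_gauss.
  have cj : continuous (@bessel_j R mu) by exact: continuous_bessel_j.
  apply: (measurableT_comp (continuous_measurable_fun cj)).
  exact: mulrl_measurable.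
- move=> v; apply: cvgMr; apply: cvgMl; rewrite bessel_jE//.
  by apply: cvg_bessel_series.
- move=> n v; rewrite /f_ /g normrM ger0_norm ?weight1_ge0//.
  rewrite [leRHS]mulrCA ler_wpM2l ?weight1_ge0// normrM [X in _ * X]ger0_norm
    ?expR_ge0//.
  apply: (@le_trans _ _ (expR d^-1 * expR (d * `|(y * v) ^+ 2| / 2) * gauss s v)).
    by rewrite ler_wpM2r ?expR_ge0// bessel_series_partial_le.
  rewrite -mulrA ler_wpM2l ?expR_ge0// /gauss -expRD ler_expR.
  rewrite ger0_norm ?sqr_ge0// exprMn.
  have v20 : 0 <= v ^+ 2 by exact: sqr_ge0.
  rewrite [X in X - _](_ : _ = s / 4 * v ^+ 2 * (y ^+ 2 / (y ^+ 2 + 1))); last first.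
    by rewrite /d; field; rewrite gt_eqF// ltr_wpDl.
  have : s / 4 * v ^+ 2 * (y ^+ 2 / (y ^+ 2 + 1)) <= s / 4 * v ^+ 2 * 1.
    apply: ler_wpM2l; first by rewrite mulr_ge0// divr_ge0// ltW.
    by rewrite ler_pdivrMr ?ltr_wpDl// mul1r lerDl.
  by move: (s / 4 * v ^+ 2 * _) => z zv; lra.
- by apply: RintegrableZ; apply: Rintegrable_weight1_gauss => //; rewrite divr_gt0.
apply: (cvg_unique (@Rhausdorff R) cf).
have -> : (fun n => \int[leb]_x f_ n x) = (fun n => gauss_moment (2 * mu + 1) 1 *
    s `^ (- (mu + 1)) * series (exp_coeff (- (y ^+ 2 / (2 * s)))) n).
  apply/funext => n; under eq_Rintegral do rewrite f_E.
  rewrite Rintegral_sum// /series/= mulr_sumr /index_iota subn0.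
  apply: eq_bigr => i _; rewrite RintegralZl//; last first.
    by apply: integrable_gauss_moment => //; have : 0 <= i%:R :> R by []; lra.
  exact: bessel_gauss_term.
by apply: cvgMr; exact: is_cvg_series_exp_coeff.
Qed.

Lemma ge0_integral_refl (f : R -> \bar R) : measurable_fun setT f ->
  (forall x, 0 <= f x)%E -> (\int[leb]_x f (- x)%R = \int[leb]_x f x)%E.
Proof.
move=> mf f0.
have -> : (\int[leb]_x f (- x)%R)%E =
    (\int[leb]_(x in (-%R : R -> measurableTypeR R) @^-1` setT) (f \o -%R) x)%E.
  by rewrite preimage_setT.
rewrite -ge0_integral_pushforward//=.
by apply: eq_measure_integral => //= A mA _; exact: lebesgue_measureN.
Qed.

Lemma Rintegral_refl (f : R -> R) : measurable_fun setT f ->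
  \int[leb]_x f (- x) = \int[leb]_x f x.
Proof.
move=> /measurable_EFinP mf; congr fine.
rewrite integralE [RHS]integralE.
rewrite -(ge0_integral_refl (measurable_funepos mf))//.
rewrite -(ge0_integral_refl (measurable_funeneg mf))//.
by congr (_ - _)%E; apply: eq_integral => x _; rewrite ?funeposE ?funenegE.
Qed.

(** Invariance of Lebesgue measure under reflection. *)
Lemma Rintegral_odd (f : R -> R) : Rintegrable leb f ->
  (forall x, f (- x) = - f x) -> \int[leb]_x f x = 0.
Proof.
move=> rf fo; have := Rintegral_refl (Rintegrable_measurable rf).
under eq_Rintegral do rewrite fo -mulN1r.
by rewrite RintegralZl//; lra.
Qed.

Lemma weight1_absM (e : bool) mu v : - (1 / 2) <= mu ->
  weight1 mu v * `|v ^+ e| = `|v| `^ (2 * mu + 1 + e%:R).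
Proof.
move=> hmu; case: e => /=; last by rewrite expr0 normr1 mulr1 addr0.
rewrite expr1 -[X in _ * X]powRr1// -powRD//.
by apply/implyP => /eqP; lra.
Qed.

Lemma Rintegrable_weight1_mgauss e mu s : - (1 / 2) <= mu -> 0 < s ->
  Rintegrable leb (fun v => weight1 mu v * mgauss e s v).
Proof.
move=> hmu s0.
have rg : Rintegrable leb (fun v => `|v| `^ (2 * mu + 1 + e%:R) * gauss s v).
  apply: integrable_gauss_moment => //.
  by have : 0 <= e%:R :> R by []; lra.
apply: (le_Rintegrable _ _ rg).
- by apply: measurable_funM; [exact: measurable_weight1|exact: measurable_mgauss].
- move=> v; rewrite -weight1_absM// !normrM (ger0_norm (weight1_ge0 mu v)).
  by rewrite (ger0_norm (expR_ge0 _)) mulrA.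
Qed.

Definition mgauss_transform e mu y e' s : R :=
  \int[leb]_v (weight1 mu v * mgauss e' s v * kern e mu (y * v)).

Lemma measurable_kernM e mu y : - (1 / 2) <= mu ->
  measurable_fun setT (fun v => kern e mu (y * v)).
Proof.
move=> hmu; apply: (measurableT_comp (measurable_kern e hmu)).
exact: mulrl_measurable.
Qed.

Lemma Rintegrable_mgauss_transform e mu y e' s : - (1 / 2) <= mu -> 0 < s ->
  Rintegrable leb (fun v => weight1 mu v * mgauss e' s v * kern e mu (y * v)).
Proof.
move=> hmu s0; apply: (@Rintegrable_bounded _ _ _ _ 1);
  first exact: Rintegrable_weight1_mgauss.
- exact: measurable_kernM.
- by move=> v; exact: kern_le1.
Qed.

Lemma weight1N mu v : weight1 mu (- v) = weight1 mu v.
Proof. by rewrite /weight1 normrN. Qed.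

Lemma mgaussN e s v : mgauss e s (- v) = (-1) ^+ e * mgauss e s v.
Proof.
by case: e; rewrite /mgauss /gauss sqrrN ?expr0 ?expr1 ?mul1r// mulN1r mulNr.
Qed.

Lemma mgauss_transform_mixed e mu y e' s : - (1 / 2) <= mu -> 0 < s -> e != e' ->
  mgauss_transform e mu y e' s = 0.
Proof.
move=> hmu s0 ee'; apply: Rintegral_odd; first exact: Rintegrable_mgauss_transform.
move=> v; rewrite weight1N mgaussN mulrN kernN.
by case: e e' ee' => -[]//= _; rewrite expr0 expr1; ring.
Qed.

(** In the odd case the factor v^2 turns the weight of index mu into that of
    index mu + 1, which is also the index of the Bessel function in the odd
    kernel; so both parities reduce to [integral_bessel_gauss]. *)
Lemma mgauss_transform_diag e mu y s : - (1 / 2) <= mu -> 0 < s ->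
  mgauss_transform e mu y e s =
  gauss_moment (2 * mu + 1) 1 * s `^ (- (mu + 1 + e%:R)) * mgauss e s^-1 y.
Proof.
move=> hmu s0; have hmu1 : - (1 / 2) <= mu + 1 by lra.
have E : expR (- (y ^+ 2 / (2 * s))) = gauss s^-1 y.
  by rewrite /gauss; congr expR; field; rewrite gt_eqF.
case: e; last first.
  rewrite addr0 /mgauss expr0 mul1r -E -integral_bessel_gauss//.
  by apply: eq_Rintegral => v _; rewrite /mgauss expr0 mul1r -mulrA
    [gauss s v * _]mulrC.
have m0 : mu + 1 != 0 by rewrite gt_eqF//; lra.
transitivity (\int[leb]_v (y / (2 * (mu + 1)) *
    (weight1 (mu + 1) v * (bessel_j (mu + 1) (y * v) * gauss s v)))).
  apply: eq_Rintegral => v _; rewrite /weight1.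
  rewrite (_ : 2 * (mu + 1) + 1 = 2 * (1%:R + mu) + 1); last by ring.
  rewrite -absr_powD2n// expr1 /kern /mgauss expr1 /weight1.
  by move: (bessel_j _ _) (gauss _ _) (_ `^ _) => p q r; field.
rewrite RintegralZl//; last first.
  apply: (@eq_integrable _ _ _ leb setT measurableT
    (EFin \o (fun v => weight1 (mu + 1) v * mgauss false s v * kern false (mu + 1)
      (y * v)))).
    by move=> v _ /=; rewrite /mgauss expr0 mul1r -mulrA [gauss s v * _]mulrC.
  exact: Rintegrable_mgauss_transform.
rewrite integral_bessel_gauss// E.
rewrite (_ : 2 * (mu + 1) + 1 = 2 * mu + 1 + 2); last by ring.
rewrite gauss_momentD2; last by lra.
rewrite /mgauss expr1.
by move: (gauss_moment _ _) (gauss _ _) (_ `^ _) => p q r; field.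
Qed.

Definition gcoef e mu b s : R :=
  gauss_moment (2 * mu + 1) 1 * s `^ (- (mu + 1 + e%:R)) * b ^- e.

Lemma mgauss_transform_div e mu b e' s w : - (1 / 2) <= mu -> 0 < s -> b != 0 ->
  mgauss_transform e mu (w / b) e' s =
  (e == e')%:R * (gcoef e mu b s * mgauss e (s * b ^+ 2)^-1 w).
Proof.
move=> hmu s0 b0; have [<-|ee'] := eqVneq e e'; last first.
  by rewrite mgauss_transform_mixed// mul0r.
rewrite mul1r mgauss_transform_diag// /gcoef /mgauss /gauss.
have -> : s^-1 * (w / b) ^+ 2 / 2 = (s * b ^+ 2)^-1 * w ^+ 2 / 2.
  by field; rewrite b0 ?(gt_eqF s0).
rewrite expr_div_n; ring.
Qed.

(** The scale 1/(s b^2) is an involution, so transforming a test function twice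
    returns it multiplied by this constant. That it depends neither on the
    parity nor on s is the reason why the double transform is a multiple of the
    identity. *)
Lemma gcoef_dual e mu b s : - (1 / 2) <= mu -> 0 < s -> b != 0 ->
  gcoef e mu b s * gcoef e mu b (s * b ^+ 2)^-1 =
  gauss_moment (2 * mu + 1) 1 ^+ 2 * `|b| `^ (2 * (mu + 1)).
Proof.
move=> hmu s0 b0; rewrite /gcoef.
have b20 : 0 < b ^+ 2 by rewrite exprn_even_gt0.
set p := - (mu + 1 + e%:R).
have -> : (s * b ^+ 2)^-1 `^ p = s `^ (- p) * (b ^+ 2) `^ (- p).
  have sb : 0 < s * b ^+ 2 by rewrite mulr_gt0.
  rewrite (_ : (s * b ^+ 2)^-1 = (s * b ^+ 2) `^ (-1)); last by rewrite powR_inv1// ltW.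
  by rewrite -powRrM mulN1r powRM// ltW.
have E : s `^ p * s `^ (- p) = 1.
  by rewrite -powRD ?subrr ?powRr0// (gt_eqF s0) implybT.
have F : (b ^+ 2) `^ (- p) = `|b| `^ (2 * (mu + 1)) * (b ^+ e) ^+ 2.
  rewrite -(real_normK (num_real b)) -powR_mulrn// -powRrM.
  rewrite (_ : 2%:R * - p = 2 * (mu + 1) + (2 * e)%:R); last by rewrite /p natrM; ring.
  rewrite powRD; last by rewrite normr_eq0 b0 implybT.
  rewrite powR_mulrn// exprM real_normK ?num_real// -exprM mulnC exprM.
  by [].
rewrite F; have be0 : b ^+ e != 0 by rewrite expf_neq0.
transitivity (gauss_moment (2 * mu + 1) 1 ^+ 2 * (s `^ p * s `^ (- p)) *
  (`|b| `^ (2 * (mu + 1)))).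
  by move: (gauss_moment _ _) (s `^ p) (s `^ (- p)) (_ `^ _) => g u v z; field.
by rewrite E mulr1.
Qed.

End gauss_transform.

(** * Indicators as limits of Gaussians *)

Section threshold.
Variable R : realType.
Implicit Types u x z : R.

Lemma bernoulli_ineq x n : 0 <= x <= 1 -> 1 - n%:R * x <= (1 - x) ^+ n.
Proof.
move=> /andP[x0 x1]; elim: n => [|n IH]; first by rewrite mul0r subr0 expr0.
rewrite exprS; apply: (@le_trans _ _ ((1 - x) * (1 - n%:R * x))); last first.
  by rewrite ler_wpM2l// subr_ge0.
rewrite -natr1; have : 0 <= n%:R * x ^+ 2 by rewrite mulr_ge0// sqr_ge0.
rewrite expr2; lra.
Qed.

Lemma cvg_natr_exprn z : 0 <= z < 1 -> n%:R * z ^+ n @[n --> \oo] --> (0 : R).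
Proof.
(* n w^n is bounded by a geometric sum; the other factor w^n of n z^n tends to
   0 *)
move=> /andP[z0 z1]; pose w := Num.sqrt z.
have w0 : 0 <= w by exact: sqrtr_ge0.
have w1 : w < 1 by rewrite -sqrtr1 ltr_sqrt.
have wz : w ^+ 2 = z by rewrite sqr_sqrtr.
have wn n : n%:R * w ^+ n <= (1 - w)^-1.
  rewrite -[leRHS]mul1r ler_pdivlMr ?subr_gt0//.
  apply: (@le_trans _ _ ((\sum_(i < n) w ^+ i) * (1 - w))).
    rewrite ler_wpM2r ?subr_ge0 ?(ltW w1)// mulr_natl -[X in _ *+ X](card_ord n)
      -sumr_const.
    apply: ler_sum => i _; apply: ler_wiXn2l => //; first exact: ltW.
    exact: ltnW.
  by rewrite mulrC -opprB mulNr -subrX1 opprB gerBl exprn_ge0.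
apply: (@squeeze_cvgr _ _ _ _ (cst 0) (fun n => (1 - w)^-1 * w ^+ n)).
- apply: nearW => n; rewrite mulr_ge0 ?exprn_ge0//=.
  by rewrite -wz -exprM mulnC exprM expr2 mulrA ler_wpM2r ?exprn_ge0.
- exact: cvg_cst.
- rewrite -[X in _ --> X](mulr0 (1 - w)^-1); apply: cvgMr.
  by apply: cvg_expr; rewrite ger0_norm.
Qed.

(** Bernoulli: for u < 1/2 the defect is at most n (2 u)^n, which tends to 0.
    For u >= 1/2 the bound 1 - x <= exp(- x) gives at most exp(- n). *)
Lemma cvg_threshold u : 0 <= u <= 1 ->
  (1 - u ^+ n) ^+ (n * 2 ^ n)%N @[n --> \oo] --> ((u < 1 / 2)%R%:R : R).
Proof.
move=> /andP[u0 u1].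
have un n : 0 <= u ^+ n <= 1 by rewrite exprn_ge0// exprn_ile1.
have hu n : 0 <= 1 - u ^+ n <= 1.
  by have /andP[a b] := un n; rewrite subr_ge0 b gerBl a.
have [uh|uh] := ltP u (1 / 2).
- apply: (@squeeze_cvgr _ _ _ _ (fun n => 1 - n%:R * (2 * u) ^+ n) (cst 1)).
  + apply: nearW => n; rewrite /= exprn_ile1 ?(andP (hu n)).1 ?(andP (hu n)).2// andbT.
    apply: le_trans (bernoulli_ineq _ (un n)).
    by rewrite natrM natrX exprMn mulrA.
  + rewrite -[X in _ --> X]subr0; apply: cvgB; first exact: cvg_cst.
    by apply: cvg_natr_exprn; rewrite mulr_ge0//=; lra.
  + exact: cvg_cst.
- apply: (@squeeze_cvgr _ _ _ _ (cst 0) (fun n => n.+1%:R^-1)).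
  + apply: nearW => n; rewrite exprn_ge0 ?(andP (hu n)).1//=.
    have /andP[h0 h1] := hu n.
    have hn : (2^-1) ^+ n <= u ^+ n.
      by rewrite lerXn2r// ?nnegrE//; lra.
    apply: (@le_trans _ _ (expR (- (2^-1) ^+ n) ^+ (n * 2 ^ n))).
      rewrite lerXn2r// ?nnegrE ?expR_ge0//.
      by apply: le_trans (expR_ge1Dx _); rewrite lerD2l lerN2.
    rewrite -expRM_natl natrM natrX mulrN -mulrA -exprMn mulfV// expr1n mulr1.
    rewrite expRN lef_pV2 ?posrE ?expR_gt0// -nat1r.
    exact: expR_ge1Dx.
  + exact: cvg_cst.
  + exact: cvg_harmonic.
Qed.

Definition staircase (del : R) N y : R :=
  \sum_(k <- iota 0 N) del * (k.+1%:R * del < y)%R%:R.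

(** The staircase with N steps of height del follows y from below, within del,
    until it is exhausted at N del. *)
Lemma staircase_bounds del N y : 0 < del -> 0 <= y ->
  Num.min y (N.+1%:R * del) - del <= staircase del N y <= Num.min y (N%:R * del).
Proof.
move=> d0 y0; elim: N => [|N /andP[IH1 IH2]].
  rewrite /staircase big_nil mul1r mul0r subr_le0 ge_min lexx orbT/=.
  by rewrite le_min y0 lexx.
have -> : staircase del N.+1 y = staircase del N y + del * (N.+1%:R * del < y)%R%:R.
  by rewrite /staircase -[in LHS]addn1 iotaD big_cat/= big_seq1 add0n.
have E : N.+2%:R * del = N.+1%:R * del + del by rewrite -natr1 mulrDl mul1r.
have F : N.+1%:R * del = N%:R * del + del by rewrite -natr1 mulrDl mul1r.
move: IH1 IH2; rewrite E.
have [h|h] := ltP (N.+1%:R * del) y.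
  have h1 : Num.min y (N%:R * del) <= N%:R * del by rewrite ge_min lexx orbT.
  have h2 : Num.min y (N.+1%:R * del + del) <= N.+1%:R * del + del.
    by rewrite ge_min lexx orbT.
  by rewrite mulr1; lra.
have h1 : Num.min y (N%:R * del) <= y by rewrite ge_min lexx.
have h2 : Num.min y (N.+1%:R * del + del) <= y by rewrite ge_min lexx.
by rewrite mulr0 addr0; lra.
Qed.

Lemma staircase_ge0 del N y : 0 < del -> 0 <= staircase del N y.
Proof. by move=> d0; apply: sumr_ge0 => i _; rewrite mulr_ge0// ltW. Qed.

Lemma staircase_le del N y : 0 < del -> 0 <= y -> staircase del N y <= y.
Proof.
move=> d0 y0; have /andP[_] := staircase_bounds N d0 y0.
by move/le_trans; apply; rewrite ge_min lexx.
Qed.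

Lemma cvg_staircase y : 0 <= y ->
  staircase n.+1%:R^-1 (n.+1 * n.+1)%N y @[n --> \oo] --> y.
Proof.
move=> y0; apply: (@squeeze_cvgr _ _ _ _ (fun n => y - n.+1%:R^-1) (cst y)).
- have [k yk] : exists k, y <= k%:R.
    by exists (Num.truncn y).+1; rewrite ltW// truncnS_gt.
  exists k => // n /= kn; have d0 : 0 < n.+1%:R^-1 :> R by [].
  rewrite staircase_le// andbT.
  have /andP[H _] := staircase_bounds (n.+1 * n.+1) d0 y0.
  apply: le_trans H; rewrite lerB// le_min lexx/=.
  rewrite -natr1 natrM mulrDl mulfK// mul1r.
  rewrite (le_trans yk)// (@le_trans _ _ n.+1%:R)// ?ler_nat ?lerDl//.
  exact: leqW.
- by rewrite -[X in _ --> X]subr0; apply: cvgB; [exact: cvg_cst|exact: cvg_harmonic].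
- exact: cvg_cst.
Qed.

End threshold.

Section gaussian_bounds.
Variable R : realType.

Lemma gauss_le1 (s v : R) : 0 <= s -> 0 <= gauss s v <= 1.
Proof.
move=> s0; rewrite expR_ge0/= /gauss -expR0 ler_expR oppr_le0 divr_ge0//.
by rewrite mulr_ge0// sqr_ge0.
Qed.

Lemma abs_gauss_le (v : R) : `|v| * gauss 1 v <= 2.
Proof.
rewrite /gauss expRN mul1r ler_pdivrMr ?expR_gt0//.
apply: (@le_trans _ _ (2 * (1 + v ^+ 2 / 2))); last first.
  by rewrite ler_wpM2l// expR_ge1Dx.
rewrite -(real_normK (num_real v)); move: `|v| => z.
by have := sqr_ge0 (z - 1); rewrite expr2; nra.
Qed.

Lemma mgauss1_le (e : bool) (v : R) : `|mgauss e 1 v| <= 2.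
Proof.
rewrite /mgauss normrM (ger0_norm (expR_ge0 _)); case: e => /=.
  by rewrite expr1 abs_gauss_le.
rewrite expr0 normr1; have /andP[_ g1] := gauss_le1 v ler01.
by rewrite [leLHS]mul1r (le_trans g1)// ler1n.
Qed.

(** Rescaling v by sqrt(s) reduces to s = 1. *)
Lemma mgauss_bounded e (s : R) : 0 < s -> exists C, forall v : R, `|mgauss e s v| <= C.
Proof.
move=> s0; pose k := Num.sqrt s; have k0 : 0 < k by rewrite sqrtr_gt0.
have kk : k ^+ 2 = s by rewrite sqr_sqrtr// ltW.
exists (2 * k ^- e) => v.
have E : mgauss e 1 (k * v) = k ^+ e * mgauss e s v.
  by rewrite /mgauss /gauss [(k * v) ^+ 2]exprMn kk mul1r exprMn -[LHS]mulrA.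
have ke : 0 <= k ^+ e by rewrite exprn_ge0// ltW.
have := mgauss1_le e (k * v); rewrite E normrM (ger0_norm ke) => h.
by rewrite ler_pdivlMr ?exprn_gt0// mulrC.
Qed.

(** The weight under which indicators are reached. Its factor |v| is what
    allows the odd test functions, which vanish at 0, to separate the two
    half-lines. *)
Definition abs_gauss (v : R) : R := `|v| * gauss 1 v.

Lemma norm_abs_gauss_le v : `|abs_gauss v| <= 2.
Proof. by rewrite ger0_norm ?abs_gauss_le// mulr_ge0// expR_ge0. Qed.

Lemma measurable_abs_gauss : measurable_fun setT abs_gauss.
Proof.
by apply: measurable_funM; [exact: normr_measurable|exact: measurable_gauss].
Qed.

Lemma near_lt_harmonic (x : R) : 0 < x -> \forall n \near \oo, n.+1%:R^-1 < x.
Proof.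
move=> x0; have /cvgrPdist_lt/(_ x x0) := @cvg_harmonic R.
by apply: filterS => n /=; rewrite sub0r normrN ger0_norm.
Qed.

End gaussian_bounds.

(** * Functions annihilated by a family of test functions *)

Section pi_lambda.
Context d (T : measurableType d) d' (T' : measurableType d') (R : realType).
Variable m : {measure set T -> \bar R}.
Variables (H : T -> R) (X : T -> T').
Hypotheses (rH : Rintegrable m H) (mX : measurable_fun setT X).

Let Rintegrable_ind (A : set T') : measurable A ->
  Rintegrable m (fun x => H x * \1_A (X x)).
Proof.
move=> mA; apply: (@Rintegrable_bounded _ _ _ _ 1) => //.
  by apply: (measurableT_comp (measurable_indic _)).
by move=> x; rewrite indicE; case: (_ \in _); rewrite ?normr1 ?normr0.
Qed.

(** Dynkin's theorem: the sets A for which the integral vanishes form a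
    lambda-system, by dominated convergence for increasing unions. *)
Lemma integral_pi_system (G : set (set T')) :
  (@measurable _ T') = <<s G >> -> setI_closed G ->
  (forall A, G A -> \int[m]_x (H x * \1_A (X x)) = 0) ->
  \int[m]_x H x = 0 ->
  forall A, measurable A -> \int[m]_x (H x * \1_A (X x)) = 0.
Proof.
move=> mG GI HG HT A; rewrite mG.
pose E := [set A | measurable A /\ \int[m]_x (H x * \1_A (X x)) = 0].
suff : <<s G >> `<=` E by move=> /[apply] -[].
have mGG B : G B -> measurable B by rewrite mG; exact: sub_sigma_algebra.
apply: lambda_system_subset => //.
split => //.
- split; first exact: measurableT.
  by under eq_Rintegral do rewrite indicT mulr1.
- move=> B C CB [mB HB] [mC HC]; split; first exact: measurableD.
  transitivity (\int[m]_x (H x * \1_B (X x) - H x * \1_C (X x))).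
    apply: eq_Rintegral => x _; rewrite -mulrBr; congr (_ * _).
    rewrite !indicE in_setD; have [xC|] := boolP (X x \in C); last first.
      by rewrite andbT subr0.
    by rewrite andbF (_ : X x \in B) ?subrr// inE; apply: CB; rewrite -inE.
  by rewrite RintegralB ?HB ?HC ?subrr//; exact: Rintegrable_ind.
- move=> F ndF EF; have mF n : measurable (F n) by have [] := EF n.
  have mU : measurable (\bigcup_n F n) by exact: bigcupT_measurable.
  split => //.
  have [|||||_ cf] := @Rdominated_convergence _ _ _ m (fun n x => H x * \1_(F n) (X x))
    (fun x => H x * \1_(\bigcup_n F n) (X x)) (fun x => `|H x|).
  + by move=> n; apply: Rintegrable_measurable; exact: Rintegrable_ind.
  + by apply: Rintegrable_measurable; exact: Rintegrable_ind.
  + move=> x; apply: cvgMr.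
    have [[k _ Fk]|nF] := pselect ((\bigcup_n F n) (X x)).
      rewrite indicE mem_set; last by exists k.
      apply: cvg_near_cst; exists k => // n /= kn.
      by rewrite indicE mem_set//; move: (X x) Fk; apply/subsetPset/ndF.
    rewrite indicE memNset//; apply: cvg_near_cst; apply: nearW => n.
    by rewrite indicE memNset// => Fn; apply: nF; exists n.
  + move=> n x; rewrite normrM ler_piMr// indicE.
    by case: (_ \in _); rewrite ?normr1 ?normr0.
  + exact: Rintegrable_norm.
  apply: (cvg_unique (@Rhausdorff R) cf).
  have -> : (fun n => \int[m]_x (H x * \1_(F n) (X x))) = cst 0.
    by apply/funext => n; have [] := EF n.
  exact: cvg_cst.
- by move=> B GB; split; [exact: mGG|exact: HG].
Qed.

End pi_lambda.

Section annihilators.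
Context d (T : measurableType d) (R : realType).
Variable m : {measure set T -> \bar R}.
Variables (K : T -> R) (X : T -> R).
Hypotheses (rK : Rintegrable m K) (mX : measurable_fun setT X).

(** Bounded functions orthogonal to K after composition with X. They are closed
    under linear combinations and bounded pointwise limits, which is how one
    passes from Gaussians to indicators; X will be a coordinate of the plane.
    *)
Definition annihilated (phi : R -> R) :=
  [/\ measurable_fun setT phi, exists C, forall x, `|phi x| <= C &
      \int[m]_t (K t * phi (X t)) = 0].

Lemma annihilated_Rintegrable (phi : R -> R) (C : R) : measurable_fun setT phi ->
  (forall x, `|phi x| <= C) ->
  Rintegrable m (fun t => K t * phi (X t)).
Proof.
by move=> mp pC; apply: (Rintegrable_bounded (C := C)) => //; exact: measurableT_comp.
Qed.

Lemma annihilated_ext phi psi : phi =1 psi -> annihilated phi -> annihilated psi.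
Proof. by move=> /funext ->. Qed.

Lemma annihilated0 : annihilated (fun=> 0).
Proof.
split; [exact: measurable_cst|by exists 0 => x; rewrite normr0|].
under eq_Rintegral do rewrite mulr0.
by rewrite /Rintegral integral0.
Qed.

Lemma annihilatedD phi psi : annihilated phi -> annihilated psi ->
  annihilated (fun x => phi x + psi x).
Proof.
move=> [mp [C pC] p0] [mq [D qD] q0]; split.
- exact: measurable_funD.
- by exists (C + D) => x; rewrite (le_trans (ler_normD _ _))// lerD.
- under eq_Rintegral do rewrite mulrDr.
  rewrite RintegralD//; [|exact: annihilated_Rintegrable pC|exact:
    annihilated_Rintegrable qD].
  by rewrite p0 q0 addr0.
Qed.

Lemma annihilatedZ c phi : annihilated phi -> annihilated (fun x => c * phi x).
Proof.
move=> [mp [C pC] p0]; split.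
- exact: measurable_funM.
- by exists (`|c| * C) => x; rewrite normrM ler_wpM2l.
- under eq_Rintegral do rewrite mulrCA.
  by rewrite RintegralZl ?p0 ?mulr0//; exact: annihilated_Rintegrable pC.
Qed.

Lemma annihilatedB phi psi : annihilated phi -> annihilated psi ->
  annihilated (fun x => phi x - psi x).
Proof.
move=> hp hq; apply: (annihilated_ext _ (annihilatedD hp (annihilatedZ (-1) hq))).
by move=> x; rewrite mulN1r.
Qed.

Lemma annihilated_sum (I : Type) (s : seq I) (F : I -> R -> R) :
  (forall i, annihilated (F i)) -> annihilated (fun x => \sum_(i <- s) F i x).
Proof.
move=> hF; elim: s => [|i s IH].
  by apply: (annihilated_ext _ annihilated0) => x; rewrite big_nil.
by apply: (annihilated_ext _ (annihilatedD (hF i) IH)) => x; rewrite big_cons.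
Qed.

Lemma annihilated_lim (F : nat -> R -> R) phi C :
  (forall n, annihilated (F n)) -> (forall n x, `|F n x| <= C) ->
  (forall x, F n x @[n --> \oo] --> phi x) -> annihilated phi.
Proof.
move=> hF FC Fphi.
have mphi : measurable_fun setT phi.
  apply/measurable_EFinP; apply: (@emeasurable_fun_cvg _ _ _ setT
    (fun n x => (F n x)%:E)).
    by move=> n; apply/measurable_EFinP; have [] := hF n.
  by move=> x _; apply/cvg_EFin; [exact: nearW|exact: Fphi].
have phiC x : `|phi x| <= C.
  have cN : `|F n x| @[n --> \oo] --> `|phi x| by apply: cvg_norm; exact: Fphi.
  rewrite -(cvg_lim (@Rhausdorff R) cN); apply: limr_le.
    by apply/cvg_ex; exists `|phi x|.
  by apply: nearW => n; exact: FC.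
split => //; first by exists C.
have [|||||_ cf] := @Rdominated_convergence _ _ _ m (fun n t => K t * F n (X t))
    (fun t => K t * phi (X t)) (fun t => C * `|K t|).
- move=> n; apply: measurable_funM; first exact: Rintegrable_measurable rK.
  by have [mF _ _] := hF n; exact: measurableT_comp.
- apply: measurable_funM; first exact: Rintegrable_measurable rK.
  exact: measurableT_comp.
- by move=> t; apply: cvgMr; exact: Fphi.
- by move=> n t; rewrite normrM mulrC ler_wpM2r.
- exact/RintegrableZ/Rintegrable_norm.
apply: (cvg_unique (@Rhausdorff R) cf).
rewrite (_ : (fun n => _) = cst 0); first exact: cvg_cst.
by apply/funext => n; have [] := hF n.
Qed.

Hypothesis ann_mgauss : forall e s, 0 < s -> annihilated (mgauss e s).

(** The powers (1 - g^n)^(n 2^n) of [cvg_threshold], with g a Gaussian, expand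
    into a finite combination of Gaussians; their limit is the indicator of g <
    1/2, that is, of |v| > r for a suitable scale. *)
Lemma annihilated_threshold e r : 0 < r ->
  annihilated (fun v => mgauss e 1 v * (r < `|v|)%R%:R).
Proof.
(* the scale at which the Gaussian takes the value 1/2 at r *)
move=> r0; pose s := 2 * ln 2 / r ^+ 2.
have ln20 : 0 < ln 2 :> R by rewrite ln_gt0// ltr1n.
have s0 : 0 < s by rewrite divr_gt0 ?mulr_gt0// exprn_gt0.
have gr v : (gauss s v < 1 / 2) = (r < `|v|).
  have -> : 1 / 2 = expR (- ln 2) :> R by rewrite expRN lnK ?posrE// div1r.
  rewrite ltr_expR ltrN2 /s.
  rewrite (_ : 2 * ln 2 / r ^+ 2 * v ^+ 2 / 2 = ln 2 * (v / r) ^+ 2); last first.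
    by field; rewrite gt_eqF.
  rewrite -[X in X < _]mulr1 ltr_pM2l// -(real_normK (num_real (v / r))).
  rewrite -[X in X < _](expr1n _ 2%N) ltr_pXn2r// ?nnegrE//.
  by rewrite normrM normfV (gtr0_norm r0) ltr_pdivlMr// mul1r.
apply: (@annihilated_lim (fun n v => mgauss e 1 v * (1 - gauss s v ^+ n) ^+
  (n * 2 ^ n)) _ 2).
- move=> n; move: (n * 2 ^ n)%N => N.
  have := @annihilated_sum nat (iota 0 N.+1) (fun i v =>
    ((-1) ^+ i * 'C(N, i)%:R) * mgauss e (1 + (n * i)%:R * s) v).
  case=> [i|].
    by apply/annihilatedZ/ann_mgauss; rewrite ltr_wpDr// mulr_ge0// ltW.
  move=> m1 b1 i1; apply: annihilated_ext; last by split;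
    [exact: m1|exact: b1|exact: i1].
  move=> v; rewrite exprBn mulr_sumr -(big_mkord xpredT (fun i => mgauss e 1 v *
    ((-1) ^+ i * 1 ^+ (N - i) * (gauss s v ^+ n) ^+ i *+ 'C(N, i)))) /index_iota subn0.
  apply: eq_bigr => i _; rewrite expr1n mulr1 -mulr_natr -exprM.
  rewrite /mgauss [gauss (1 + _) v](_ : _ = gauss 1 v * gauss s v ^+ (n * i));
    last first.
    by rewrite /gauss -expRM_natl -expRD; congr expR; field.
  by ring.
- move=> n v; rewrite normrM -[leRHS]mulr1 ler_pM// ?mgauss1_le//.
  have /andP[g0 g1] := gauss_le1 v (ltW s0).
  have /andP[u0 u1] : 0 <= gauss s v ^+ n <= 1 by rewrite exprn_ge0// exprn_ile1.
  rewrite ger0_norm; last by rewrite exprn_ge0// subr_ge0.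
  by rewrite exprn_ile1// ?subr_ge0// gerBl.
- move=> v; apply: cvgMr; rewrite -gr; apply: cvg_threshold.
  exact: gauss_le1 (ltW s0).
Qed.

(** The even test functions come without the factor |v|; it is recovered as a
    limit of staircases, whose steps are the indicators of
    [annihilated_threshold]. *)
Lemma annihilated_abs r : 0 < r -> annihilated
  (fun v => `|v| * gauss 1 v * (r < `|v|)%R%:R).
Proof.
move=> r0.
apply: (@annihilated_lim (fun n v => gauss 1 v * (r < `|v|)%R%:R
   * staircase n.+1%:R^-1 (n.+1 * n.+1)%N `|v|) _ 2).
- move=> n; pose del : R := n.+1%:R^-1.
  have := @annihilated_sum nat (iota 0 (n.+1 * n.+1)) (fun k v =>
     del * (mgauss false 1 v * (Num.max r (k.+1%:R * del) < `|v|)%R%:R)).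
  case=> [k|]; first by apply/annihilatedZ/annihilated_threshold; rewrite lt_max r0.
  move=> m1 b1 i1; apply: annihilated_ext; last by split;
    [exact: m1|exact: b1|exact: i1].
  move=> v; rewrite /staircase mulr_sumr; apply: eq_bigr => k _.
  rewrite /mgauss expr0 mul1r gt_max.
  by case: (r < `|v|); case: (_ < `|v|); rewrite /= ?mulr1 ?mulr0 ?mul0r// mulrC.
- move=> n v; have d0 : 0 < n.+1%:R^-1 :> R by [].
  rewrite ger0_norm; last by rewrite mulr_ge0 ?mulr_ge0 ?expR_ge0 ?staircase_ge0.
  apply: (le_trans _ (abs_gauss_le v)); rewrite mulrC; apply: ler_pM.
  + exact: staircase_ge0.
  + by rewrite mulr_ge0 ?expR_ge0.
  + exact: staircase_le.
  + by rewrite ler_piMr ?expR_ge0//; case: (_ < _).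
- move=> v; rewrite -[X in _ --> X]mulrA [X in _ --> X]mulrC; apply: cvgMr.
  exact: cvg_staircase.
Qed.

Definition annihilated_set (A : set R) := annihilated (fun v => abs_gauss v * \1_A v).

Lemma annihilated_set_lim (A : nat -> set R) (B : set R) :
  (forall n, annihilated_set (A n)) ->
  (forall x, \forall n \near \oo, A n x <-> B x) -> annihilated_set B.
Proof.
move=> hA AB; apply: (@annihilated_lim (fun n v => abs_gauss v * \1_(A n) v) _ 2) => //.
- move=> n v; rewrite normrM -[leRHS]mulr1 ler_pM// ?norm_abs_gauss_le// indicE.
  by case: (_ \in _); rewrite ?normr1 ?normr0.
- move=> v; apply: cvgMr; apply: cvg_near_cst.
  by apply: filterS (AB v) => n ABn; rewrite !indicE; congr (_%:R); congr nat_of_bool;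
     apply/idP/idP; rewrite !inE => /ABn.
Qed.

(** Half the sum of the even and odd functions |v| and v, cut off at |v| > r;
    their difference gives the other half-line. *)
Lemma annihilated_set_gtr r : 0 < r -> annihilated_set [set v | r < v].
Proof.
move=> r0; have := annihilatedZ (2^-1) (annihilatedD (annihilated_abs r0)
  (annihilated_threshold true r0)).
apply: annihilated_ext => v; rewrite /mgauss /abs_gauss expr1 indicE.
have [h|h] := ltP r v.
  have v0 := lt_trans r0 h.
  by rewrite mem_set// gtr0_norm// h !mulr1; field.
rewrite memNset//=; last by rewrite ltNge h.
have [rv|rv] := ltP r `|v|; last by rewrite !mulr0 addr0 mulr0.
have v0 : v < 0.
  by rewrite ltNge; apply/negP => v0; move: rv; rewrite ger0_norm// ltNge h.
by rewrite ltr0_norm// !mulr1 mulNr addNr !mulr0.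
Qed.

Lemma annihilated_set_ltNr r : 0 < r -> annihilated_set [set v | v < - r].
Proof.
move=> r0; have := annihilatedZ (2^-1) (annihilatedB (annihilated_abs r0)
  (annihilated_threshold true r0)).
apply: annihilated_ext => v; rewrite /mgauss /abs_gauss expr1 indicE.
have [h|h] := ltP v (- r).
  have v0 : v < 0 by rewrite (lt_trans h)// oppr_lt0.
  rewrite mem_set// ltr0_norm// ltrNr h !mulr1.
  by field.
rewrite memNset//=; last by rewrite ltNge h.
have [rv|rv] := ltP r `|v|; last by rewrite !mulr0 subr0 mulr0.
have v0 : 0 <= v.
  rewrite leNgt; apply/negP => v0; move: rv; rewrite ltr0_norm// ltNge.
  by rewrite lerNl h.
by rewrite ger0_norm// !mulr1 subrr !mulr0.
Qed.

Lemma annihilated_set_gtr0 : annihilated_set [set v | 0 < v].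
Proof.
apply: (@annihilated_set_lim (fun n => [set v | n.+1%:R^-1 < v])).
  by move=> n; exact: annihilated_set_gtr.
move=> v; have [v0|v0] := ltP 0 v.
  by apply: filterS (near_lt_harmonic v0) => n /= nv; rewrite nv v0.
apply: nearW => n /=; split=> h; exfalso; move: v0; rewrite leNgt => /negP; apply=> //.
exact: lt_trans h.
Qed.

Lemma annihilated_set_ltr0 : annihilated_set [set v | v < 0].
Proof.
apply: (@annihilated_set_lim (fun n => [set v | v < - n.+1%:R^-1])).
  by move=> n; exact: annihilated_set_ltNr.
move=> v; have [v0|v0] := ltP v 0.
  have : 0 < - v by rewrite oppr_gt0.
  by move/near_lt_harmonic; apply: filterS => n /= nv; rewrite ltrNr nv v0.
apply: nearW => n /=; split=> h; exfalso; move: v0; rewrite leNgt => /negP; apply=> //.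
by apply: (lt_trans h); rewrite oppr_lt0.
Qed.

Lemma annihilated_set_setT : annihilated_set setT.
Proof.
apply: annihilated_ext (annihilatedD annihilated_set_gtr0 annihilated_set_ltr0) => v.
rewrite !indicE in_setT /abs_gauss /= mulr1.
have [v0|v0|->] := ltrgtP v 0; last by rewrite normr0 !mul0r addr0.
- by rewrite memNset/= ?mem_set ?mulr0 ?add0r ?mulr1//= ltNge ltW.
- by rewrite mem_set//= memNset/= ?mulr0 ?addr0 ?mulr1// ltNge ltW.
Qed.

Lemma annihilated_set_ray r : annihilated_set [set v | r < v].
Proof.
have [r0|r0|->] := ltrgtP r 0; [|exact: annihilated_set_gtr|exact:
  annihilated_set_gtr0].
have nr0 : 0 < - r by rewrite oppr_gt0.
(* closed rays, complements of half-lines already treated, increasing to the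
   open ray; n.+2 keeps their end points negative *)
apply: (@annihilated_set_lim (fun n => [set v | r * (1 - n.+2%:R^-1) <= v])).
  move=> n; have n1 : 0 < 1 - n.+2%:R^-1 :> R by rewrite subr_gt0 invf_lt1// ltr1n.
  have := annihilatedB annihilated_set_setT
    (@annihilated_set_ltNr (- r * (1 - n.+2%:R^-1)) (mulr_gt0 nr0 n1)).
  apply: annihilated_ext => v; rewrite -mulrBr; congr (_ * _).
  rewrite !indicE in_setT /= mulNr opprK.
  have [h|h] := leP (r * (1 - n.+2%:R^-1)) v.
    by rewrite memNset/= ?mem_set ?subr0//= ltNge h.
  by rewrite mem_set//= memNset/= ?subrr// leNgt h.
move=> v; have [rv|rv] := ltP r v.
  have vr0 : 0 < (v - r) / (- r) by rewrite divr_gt0// subr_gt0.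
  apply: filterS (near_lt_harmonic vr0) => n /= nv; split => // _.
  have n12 : n.+2%:R^-1 <= n.+1%:R^-1 :> R by rewrite lef_pV2 ?posrE// ler_nat.
  move: nv; rewrite ltr_pdivlMr// => nv.
  have : n.+2%:R^-1 * (- r) <= n.+1%:R^-1 * (- r) by rewrite ler_wpM2r// ltW.
  rewrite (_ : r * (1 - n.+2%:R^-1) = r + n.+2%:R^-1 * - r); last by ring.
  by move=> h; rewrite -lerBrDl (le_trans h)// ltW.
apply: nearW => n /=; split=> h; exfalso; last by move: h; rewrite ltNge rv.
have : 0 < n.+2%:R^-1 * (- r) by rewrite mulr_gt0.
rewrite (_ : n.+2%:R^-1 * - r = r * (1 - n.+2%:R^-1) - r); last by ring.
by rewrite subr_gt0 => h2; have := lt_le_trans h2 h; rewrite ltNge rv.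
Qed.

Lemma annihilated_set_all (A : set R) : measurable A -> annihilated_set A.
Proof.
move=> mA; have mq := @measurable_abs_gauss R.
have i0 : \int[m]_t (K t * abs_gauss (X t)) = 0.
  have [_ _] := annihilated_set_setT; by under eq_Rintegral do rewrite indicT mulr1.
split.
- by apply: measurable_funM => //; exact: measurable_indic.
- exists 2 => v; rewrite normrM -[leRHS]mulr1 ler_pM// ?norm_abs_gauss_le// indicE.
  by case: (_ \in _); rewrite ?normr1 ?normr0.
under eq_Rintegral do rewrite mulrA.
have rKq : Rintegrable m (fun t => K t * abs_gauss (X t)) by exact:
  (annihilated_Rintegrable mq (@norm_abs_gauss_le R)).
have P := integral_pi_system rKq mX (G := @RGenOInfty.G R).
apply: P => //.
- exact: RGenOInfty.measurableE.
- move=> _ _ [x ->] [y ->]; exists (Num.max x y).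
  by apply/seteqP; split=> z /=; rewrite !in_itv/= !andbT gt_max => /andP.
- move=> _ [x ->]; have [_ _] := annihilated_set_ray x.
  rewrite (_ : [set v | x < v] = `]x, +oo[%classic); last first.
    by apply/seteqP; split=> z /=; rewrite in_itv/= andbT.
  by under eq_Rintegral do rewrite mulrA.
Qed.

End annihilators.

(** * Gaussian test functions separate integrable functions *)

Section uniqueness.
Variable R : realType.
Local Notation leb2 := (leb2 R).

(** One variable at a time: with a test function fixed in the second variable,
    [annihilated_set_all] replaces the one in the first variable by the
    indicator of any Borel set A, and then the same is done in the second
    variable. The rectangles A x B are a pi-system generating the Borel sets of
    the plane. The weights |v| vanish on the axes, whence the restriction. *)
Lemma mgauss_separates (K : R * R -> R) : Rintegrable leb2 K ->
  (forall e1 e2 s1 s2, 0 < s1 -> 0 < s2 ->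
    \int[leb2]_z (K z * (mgauss e1 s1 z.1 * mgauss e2 s2 z.2)) = 0) ->
  {ae leb2, forall z : R * R, z.1 != 0 -> z.2 != 0 -> K z = 0}.
Proof.
move=> rK hK.
have mfst : measurable_fun setT (fst : R * R -> R) by exact: measurable_fst.
have msnd : measurable_fun setT (snd : R * R -> R) by exact: measurable_snd.
have mgauss_bd := @mgauss_bounded R.
have h2 e2 s2 A : 0 < s2 -> measurable A ->
    \int[leb2]_z (K z * mgauss e2 s2 z.2 * (abs_gauss z.1 * \1_A z.1)) = 0.
  move=> s20 mA; have [C hC] := mgauss_bd e2 s2 s20.
  have mg : measurable_fun setT (fun z : R * R => mgauss e2 s2 z.2).
    by apply: (measurableT_comp (measurable_mgauss e2 s2)).
  have rK2 : Rintegrable leb2 (fun z => K z * mgauss e2 s2 z.2) by exact: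
    (Rintegrable_bounded (C := C)).
  have hg e s : 0 < s -> annihilated leb2 (fun z => K z * mgauss e2 s2 z.2) fst
    (mgauss e s).
    move=> s0; split; [exact: measurable_mgauss|exact: mgauss_bd|].
    rewrite -[RHS](hK e e2 s s2 s0 s20); apply: eq_Rintegral => z _.
    by rewrite -mulrA [mgauss e2 _ _ * _]mulrC.
  by have [_ _] := annihilated_set_all rK2 mfst hg mA.
have h3 A B : measurable A -> measurable B ->
    \int[leb2]_z (K z * (abs_gauss z.1 * \1_A z.1) * (abs_gauss z.2 * \1_B z.2)) = 0.
  move=> mA mB.
  have mqA : measurable_fun setT (fun z : R * R => abs_gauss z.1 * \1_A z.1).
    by apply: measurable_funM; apply: (measurableT_comp _ mfst) => //;
      exact: measurable_abs_gauss.
  have rK2 : Rintegrable leb2 (fun z => K z * (abs_gauss z.1 * \1_A z.1)).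
    apply: (Rintegrable_bounded (C := 2)) => // z.
    rewrite normrM -[leRHS]mulr1 ler_pM// ?norm_abs_gauss_le// indicE.
    by case: (_ \in _); rewrite ?normr1 ?normr0.
  have hg e s : 0 < s -> annihilated leb2
    (fun z => K z * (abs_gauss z.1 * \1_A z.1)) snd (mgauss e s).
    move=> s0; split; [exact: measurable_mgauss|exact: mgauss_bd|].
    rewrite -[RHS](h2 e s A s0 mA); apply: eq_Rintegral => z _.
    by rewrite mulrAC.
  by have [_ _] := annihilated_set_all rK2 msnd hg mB.
pose H z := K z * (abs_gauss z.1 * abs_gauss z.2).
have mq := @measurable_abs_gauss R.
have rH : Rintegrable leb2 H.
  apply: (Rintegrable_bounded (C := 2 * 2)) => //.
    by apply: measurable_funM; apply: (measurableT_comp mq).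
  by move=> z; rewrite normrM ler_pM// norm_abs_gauss_le.
have H0 A : measurable A -> \int[leb2]_z (H z * \1_A z) = 0.
  move=> mA.
  apply: (@integral_pi_system _ _ _ _ _ leb2 H id rH (@measurable_id _ _ _)
     [set A `*` B | A in measurable & B in measurable]) => //.
  - exact: measurable_prod_measurableType.
  - move=> _ _ [A1 mA1 [B1 mB1 <-]] [A2 mA2 [B2 mB2 <-]].
    rewrite -setXI; exists (A1 `&` A2); first exact: measurableI.
    by exists (B1 `&` B2) => //; exact: measurableI.
  - move=> _ [A1 mA1 [B1 mB1 <-]]; rewrite -[RHS](h3 A1 B1 mA1 mB1).
    apply: eq_Rintegral => z _; rewrite /H !indicE in_setX.
    by case: (_ \in A1); case: (_ \in B1) => /=; ring.
  - rewrite -[RHS](h3 setT setT measurableT measurableT).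
    by apply: eq_Rintegral => z _; rewrite /H !indicE !in_setT !mulr1 mulrA.
have aeH : ae_eq leb2 setT (EFin \o H) (cst 0%E).
  apply: integral_ae_eq => // E _ mE.
  rewrite integral0 integral_mkcond.
  rewrite (_ : \int[_]_x _ = \int[leb2]_x (H x * \1_E x)%:E)%E; last first.
    by apply: eq_integral => z _; rewrite patchE indicE; case: ifPn;
      rewrite ?mulr1 ?mulr0.
  rewrite -[LHS]fineK.
    by have := H0 E mE; rewrite /Rintegral => ->.
  apply: integrable_fin_num => //.
  apply: (Rintegrable_bounded (C := 1) rH) => //.
  by move=> z; rewrite indicE; case: (_ \in _); rewrite ?normr1 ?normr0.
apply: filterS aeH => z /= /(_ I) [] + z1 z2.
rewrite /H => /eqP; rewrite !mulf_eq0 !normr_eq0 (negbTE z1) (negbTE z2)/=.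
by rewrite !(gt_eqF (expR_gt0 _)) !orbF => /eqP.
Qed.

End uniqueness.

(** * The scalar transforms in two variables *)

Section real_kernel_transform.
Variable R : realType.
Local Notation leb := (@lebesgue_measure R).
Local Notation leb2 := (prodm leb leb).
Variables (mu : R) (b : R * R).
Hypotheses (hmu : - (1 / 2) <= mu) (hb1 : b.1 != 0) (hb2 : b.2 != 0).
Implicit Types (e : bool * bool) (s v w : R * R) (g : R * R -> R).

Local Notation W := (dunkl_weight mu).

Definition wintegrable g := Rintegrable leb2 (fun v => W v * g v).

Definition kern2 e w v : R :=
  kern e.1 mu (w.1 / b.1 * v.1) * kern e.2 mu (w.2 / b.2 * v.2).

Definition mgauss2 e s v : R := mgauss e.1 s.1 v.1 * mgauss e.2 s.2 v.2.

Definition real_transform e g w : R := \int[leb2]_v (W v * (kern2 e w v * g v)).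

Lemma weight_ge0 v : 0 <= W v.
Proof. by rewrite mulr_ge0// powR_ge0. Qed.

Lemma measurable_fun_fst (f : R -> R) : measurable_fun setT f ->
  measurable_fun setT (fun v : R * R => f v.1).
Proof. by move=> mf; apply: (measurableT_comp mf); exact: measurable_fst. Qed.

Lemma measurable_fun_snd (f : R -> R) : measurable_fun setT f ->
  measurable_fun setT (fun v : R * R => f v.2).
Proof. by move=> mf; apply: (measurableT_comp mf); exact: measurable_snd. Qed.

Lemma measurable_weight : measurable_fun setT W.
Proof.
by apply: measurable_funM;
  [apply: (measurable_fun_fst (measurable_weight1 mu))
  |apply: (measurable_fun_snd (measurable_weight1 mu))].
Qed.

Lemma measurable_mgauss2 e s : measurable_fun setT (mgauss2 e s).
Proof.
by apply: measurable_funM;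
  [apply: (measurable_fun_fst (measurable_mgauss _ _))
  |apply: (measurable_fun_snd (measurable_mgauss _ _))].
Qed.

Lemma kern2_le1 e w v : `|kern2 e w v| <= 1.
Proof. by rewrite normrM -[leRHS]mulr1 ler_pM// kern_le1. Qed.

Lemma kern2_sym e w v : kern2 e w v = kern2 e v w.
Proof. by rewrite /kern2; congr (kern _ _ _ * kern _ _ _); ring. Qed.

Lemma measurable_kern2_prod e :
  measurable_fun setT (fun z : (R * R) * (R * R) => kern2 e z.1 z.2).
Proof.
apply: measurable_funM; apply: (measurableT_comp (measurable_kern _ hmu)).
- apply: measurable_funM.
    apply: measurable_funM => //.
    by apply: (measurableT_comp measurable_fst); exact: measurable_fst.
  by apply: (measurableT_comp measurable_fst); exact: measurable_snd.
- apply: measurable_funM.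
    apply: measurable_funM => //.
    by apply: (measurableT_comp measurable_snd); exact: measurable_fst.
  by apply: (measurableT_comp measurable_snd); exact: measurable_snd.
Qed.

Lemma measurable_kern2 e w : measurable_fun setT (kern2 e w).
Proof.
apply: measurable_funM.
  exact: (measurable_fun_fst (measurable_kernM e.1 (w.1 / b.1) hmu)).
exact: (measurable_fun_snd (measurable_kernM e.2 (w.2 / b.2) hmu)).
Qed.

Lemma wintegrable_mgauss2 e s : 0 < s.1 -> 0 < s.2 -> wintegrable (mgauss2 e s).
Proof.
move=> s1 s2; apply: eq_integrable (Rintegrable_prod
  (Rintegrable_weight1_mgauss e.1 hmu s1) (Rintegrable_weight1_mgauss e.2 hmu s2))
  => //.
move=> v _ /=; congr EFin; rewrite /mgauss2 /dunkl_weight /weight1.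
by move: (mgauss _ _ _) (mgauss _ _ _) (_ `^ _) (_ `^ _) => x y z t; ring.
Qed.

Lemma wintegrable_bounded (C : R) g (k : R * R -> R) : wintegrable g ->
  measurable_fun setT k ->
  (forall v, `|k v| <= C) -> wintegrable (fun v => k v * g v).
Proof.
move=> rg mk kC; apply: eq_integrable (Rintegrable_bounded rg mk kC) => //.
by move=> v _ /=; congr EFin; rewrite -mulrA [g v * _]mulrC.
Qed.

Lemma wintegrable_kern2 e w g : wintegrable g ->
  wintegrable (fun v => kern2 e w v * g v).
Proof.
move=> rg; apply: (wintegrable_bounded (C := 1)) => //; first exact: measurable_kern2.
by move=> v; exact: kern2_le1.
Qed.

Lemma real_transform_bounded e g : wintegrable g ->
  exists C, forall w, `|real_transform e g w| <= C.
Proof.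
move=> rg; exists (\int[leb2]_v `|W v * g v|) => w.
have rk := wintegrable_kern2 e w rg.
apply: (le_trans (le_normr_Rintegral measurableT rk)).
apply: le_Rintegral => //.
- exact: (Rintegrable_norm rk).
- exact: (Rintegrable_norm rg).
- move=> v _; rewrite [leLHS]normrM [leRHS]normrM ler_wpM2l//.
  by rewrite normrM ler_piMl// kern2_le1.
Qed.

Lemma Rintegrable_kern2_prod e (f g : R * R -> R) : Rintegrable leb2 f ->
  Rintegrable leb2 g ->
  Rintegrable (leb2 \x leb2)%E (fun z => f z.1 * g z.2 * kern2 e z.1 z.2).
Proof.
move=> rf rg; apply: (Rintegrable_bounded (C := 1)).
- exact: Rintegrable_prod.
- exact: measurable_kern2_prod.
- by move=> z; exact: kern2_le1.
Qed.

Lemma Rintegrable_kern2 e w (g : R * R -> R) c : Rintegrable leb2 g ->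
  Rintegrable leb2 (fun v => c * g v * kern2 e w v).
Proof.
move=> rg; apply: (Rintegrable_bounded (C := 1)) => //.
- exact: RintegrableZ.
- exact: measurable_kern2.
- by move=> z; exact: kern2_le1.
Qed.

Lemma Rintegrable_kern2' e w (g : R * R -> R) c : Rintegrable leb2 g ->
  Rintegrable leb2 (fun v => g v * c * kern2 e v w).
Proof.
move=> rg; apply: eq_integrable (Rintegrable_kern2 e w c rg) => // v _ /=.
by rewrite kern2_sym [c * _]mulrC.
Qed.

(** As a function of both w and v the integrand need not be integrable, since
    nothing forces decay in w. A Gaussian factor in w repairs this, and is
    divided out after Fubini. *)
Lemma measurable_real_transform e g : wintegrable g ->
  measurable_fun setT (real_transform e g).
Proof.
move=> rg; pose G w : R := gauss 1 w.1 * gauss 1 w.2.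
have rG : Rintegrable leb2 G.
  have r1 : Rintegrable leb (gauss (1 : R)).
    (* for mu = -1/2 the weight is 1 *)
    apply: eq_integrable (@Rintegrable_weight1_gauss R (- (1 / 2)) 1 _ _) => //.
    move=> v _ /=; rewrite /weight1 (_ : 2 * - (1 / 2) + 1 = 0); last by field.
    by rewrite powRr0 mul1r.
  exact: Rintegrable_prod.
have mGT : measurable_fun setT (fun w => \int[leb2]_v
  (G w * (W v * g v) * kern2 e w v)).
  apply: (@measurable_Rfubini _ _ _ _ _ leb2 leb2
    (fun z => G z.1 * (W z.2 * g z.2) * kern2 e z.1 z.2)).
    exact: (Rintegrable_kern2_prod e rG rg).
  by move=> w; exact: (@Rintegrable_kern2 e w (fun v => W v * g v) (G w) rg).
have E w : real_transform e g w = (expR (w.1 ^+ 2 / 2) * expR (w.2 ^+ 2 / 2))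
    * \int[leb2]_v (G w * (W v * g v) * kern2 e w v).
  have -> : \int[leb2]_v (G w * (W v * g v) * kern2 e w v) = G w * real_transform e g w.
    rewrite /real_transform -RintegralZl//; last exact: wintegrable_kern2.
    by apply: eq_Rintegral => v _; ring.
  rewrite /G /gauss !mul1r !expRN.
  have h1 := expR_gt0 (w.1 ^+ 2 / 2); have h2 := expR_gt0 (w.2 ^+ 2 / 2).
  move: (expR _) (expR _) h1 h2 => x y x0 y0.
  by field; rewrite (gt_eqF x0) (gt_eqF y0).
rewrite (funext E); apply: measurable_funM => //.
apply: measurable_funM.
  apply: (measurable_fun_fst (f := fun x => expR (x ^+ 2 / 2))).
  by apply: measurableT_comp => //; apply: measurable_funM.
apply: (measurable_fun_snd (f := fun x => expR (x ^+ 2 / 2))).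
by apply: measurableT_comp => //; apply: measurable_funM.
Qed.

(** Fubini, together with the symmetry of the kernel in w and v. *)
Lemma real_transform_dual e e' s g : 0 < s.1 -> 0 < s.2 -> wintegrable g ->
  \int[leb2]_w (W w * (mgauss2 e' s w * real_transform e g w)) =
  \int[leb2]_v (W v * (mgauss_transform e.1 mu (v.1 / b.1) e'.1 s.1
     * mgauss_transform e.2 mu (v.2 / b.2) e'.2 s.2 * g v)).
Proof.
move=> s1 s2 rg; have rG := wintegrable_mgauss2 e' s1 s2.
transitivity (\int[leb2]_w \int[leb2]_v (W w * mgauss2 e' s w * (W v * g v) * kern2
  e w v)).
  apply: eq_Rintegral => w _; rewrite mulrA -RintegralZl//;
    last exact: wintegrable_kern2.
  by apply: eq_Rintegral => v _; ring.
rewrite (@Rfubini _ _ _ _ _ leb2 leb2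
  (fun z => W z.1 * mgauss2 e' s z.1 * (W z.2 * g z.2) * kern2 e z.1 z.2)).
- apply: eq_Rintegral => v _ /=.
  transitivity (\int[leb2]_w (W v * g v *
    ((weight1 mu w.1 * mgauss e'.1 s.1 w.1 * kern e.1 mu (v.1 / b.1 * w.1)) *
     (weight1 mu w.2 * mgauss e'.2 s.2 w.2 * kern e.2 mu (v.2 / b.2 * w.2))))).
    apply: eq_Rintegral => w _; rewrite kern2_sym /kern2 /mgauss2 /dunkl_weight
      -/(weight1 mu w.1) -/(weight1 mu w.2).
    move: (weight1 _ _) (weight1 _ _) (mgauss _ _ _) (mgauss _ _ _) (kern _ _ _)
      (kern _ _ _) (_ `^ _) (_ `^ _) (g v).
    by move=> x1 x2 x3 x4 x5 x6 x7 x8 x9; ring.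
  have r1 := Rintegrable_mgauss_transform e.1 (v.1 / b.1) e'.1 hmu s1.
  have r2 := Rintegrable_mgauss_transform e.2 (v.2 / b.2) e'.2 hmu s2.
  rewrite RintegralZl//; last exact: (Rintegrable_prod r1 r2).
  rewrite (Rintegral_prod r1 r2) -/(mgauss_transform e.1 mu (v.1 / b.1) e'.1 s.1).
  rewrite -/(mgauss_transform e.2 mu (v.2 / b.2) e'.2 s.2).
  by rewrite -mulrA; congr (_ * _); exact: mulrC.
- exact: (Rintegrable_kern2_prod e rG rg).
- by move=> w; exact: (@Rintegrable_kern2 e w (fun v => W v * g v)
  (W w * mgauss2 e' s w) rg).
- by move=> v; exact: (@Rintegrable_kern2' e v (fun w => W w * mgauss2 e' s w)
  (W v * g v) rG).
Qed.

(** The scale of the transform of a Gaussian of scale s, in each variable. *)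
Definition dual_scale s : R * R := ((s.1 * b.1 ^+ 2)^-1, (s.2 * b.2 ^+ 2)^-1).

Definition gcoef2 e s : R := gcoef e.1 mu b.1 s.1 * gcoef e.2 mu b.2 s.2.

Lemma dual_scale_gt0 s : 0 < s.1 -> 0 < s.2 ->
  0 < (dual_scale s).1 /\ 0 < (dual_scale s).2.
Proof. by move=> s1 s2; split; rewrite invr_gt0 mulr_gt0// exprn_even_gt0. Qed.

Lemma dual_scaleK s : 0 < s.1 -> 0 < s.2 -> dual_scale (dual_scale s) = s.
Proof.
move=> s1 s2; rewrite /dual_scale/= [RHS]surjective_pairing.
by congr pair; field; rewrite ?hb1 ?hb2 ?(gt_eqF s1) ?(gt_eqF s2).
Qed.

Lemma real_transform_mgauss2 e e' s g : 0 < s.1 -> 0 < s.2 -> wintegrable g ->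
  \int[leb2]_w (W w * (mgauss2 e' s w * real_transform e g w)) =
  (e == e')%:R * (gcoef2 e s * \int[leb2]_v (W v * (mgauss2 e (dual_scale s) v * g v))).
Proof.
move=> s1 s2 rg; rewrite real_transform_dual//.
have [d1 d2] := dual_scale_gt0 s1 s2.
have rgg : wintegrable (fun v => mgauss2 e (dual_scale s) v * g v).
  have [C1 hC1] := mgauss_bounded e.1 d1; have [C2 hC2] := mgauss_bounded e.2 d2.
  apply: (wintegrable_bounded (C := C1 * C2)) => //; first exact: measurable_mgauss2.
  by move=> v; rewrite normrM ler_pM.
rewrite mulrA -RintegralZl//; apply: eq_Rintegral => v _.
rewrite !mgauss_transform_div// /mgauss2 /gcoef2 /dual_scale/=.
have -> : (e == e')%:R = (e.1 == e'.1)%:R * (e.2 == e'.2)%:R :> R.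
  by case: e {rgg} => e1 e2; case: e' => e1' e2'; rewrite -natrM mulnb.
by ring.
Qed.

(** The value of [gcoef_dual], over both variables. *)
Definition kappa : R :=
  (gauss_moment (2 * mu + 1) 1 ^+ 2 * `|b.1| `^ (2 * (mu + 1))) *
  (gauss_moment (2 * mu + 1) 1 ^+ 2 * `|b.2| `^ (2 * (mu + 1))).

Lemma gcoef2_dual e s : 0 < s.1 -> 0 < s.2 -> gcoef2 e s * gcoef2 e (dual_scale s) =
  kappa.
Proof. by move=> s1 s2; rewrite /gcoef2 mulrACA !gcoef_dual. Qed.

Lemma axes_null : {ae leb2, forall v : R * R, v.1 != 0 /\ v.2 != 0}.
Proof.
have m1 : measurable ([set (0 : R)] `*` [set: R]) by exact: measurableX.
have m2 : measurable ([set: R] `*` [set (0 : R)]) by exact: measurableX.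
have n1 : leb2.-negligible ([set (0 : R)] `*` [set: R]).
  apply/negligibleP => //.
  change ((leb \x leb)%E ([set 0] `*` [set: R]) = 0%E).
  by rewrite product_measure1E// [X in (X * _)%E]lebesgue_measure_set1 mul0e.
have n2 : leb2.-negligible ([set: R] `*` [set (0 : R)]).
  apply/negligibleP => //.
  change ((leb \x leb)%E ([set: R] `*` [set 0]) = 0%E).
  by rewrite product_measure1E// [X in (_ * X)%E]lebesgue_measure_set1 mule0.
apply: negligibleS (negligibleU n1 n2) => v /=.
have [v1|v1] := eqVneq v.1 0; first by left; split.
have [v2|v2] := eqVneq v.2 0; first by right; split.
by case.
Qed.

(** The function g itself need not be integrable (in the application one part
    of it is only bounded), so [mgauss_separates] is applied to g times a
    Gaussian; shifting the scales by 1 absorbs that factor in the test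
    functions. *)
Lemma wintegrable_mgauss2_separates g : measurable_fun setT g ->
  (forall e s, 0 < s.1 -> 0 < s.2 -> wintegrable (fun v => mgauss2 e s v * g v)) ->
  (forall e s, 0 < s.1 -> 0 < s.2 ->
    \int[leb2]_v (W v * (mgauss2 e s v * g v)) = 0) ->
  {ae leb2, forall v : R * R, g v = 0}.
Proof.
move=> mg rg g0; pose K v := W v * (mgauss2 (false, false) (1, 1) v * g v).
have rK : Rintegrable leb2 K by exact: (rg (false, false) (1, 1)).
have hK (e1 e2 : bool) (s1 s2 : R) : 0 < s1 -> 0 < s2 ->
    \int[leb2]_z (K z * (mgauss e1 s1 z.1 * mgauss e2 s2 z.2)) = 0.
  move=> s10 s20.
  rewrite -[RHS](g0 (e1, e2) (1 + s1, 1 + s2) (addr_gt0 ltr01 s10)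
    (addr_gt0 ltr01 s20)).
  apply: eq_Rintegral => z _; rewrite /K /mgauss2 /=.
  have E (e : bool) (s x : R) : 0 < s -> mgauss e (1 + s) x =
    gauss 1 x * mgauss e s x :> R.
    by move=> s0; rewrite /mgauss [RHS]mulrCA /gauss -expRD; congr (_ * expR _); field.
  rewrite !E// {1}/mgauss expr0 mul1r {1}/mgauss expr0 mul1r.
  by ring.
have := mgauss_separates rK hK; have := axes_null.
apply: (@filterS2 _ _ (ae_filter_ringOfSetsType leb2)) => v [v1 v2] /(_ v1 v2) /eqP.
rewrite /K /mgauss2 /mgauss !expr0 !mul1r !mulf_eq0 !(gt_eqF (expR_gt0 _)).
rewrite /dunkl_weight !powR_eq0 !normr_eq0 (negbTE v1) (negbTE v2) /=.
by move/eqP.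
Qed.

End real_kernel_transform.

(** * Quaternion phases and kernels *)

Section quaternion_algebra.
Variable R : realType.
Implicit Types (p q u : quat R) (s t : R).

(** Two-sided multiplication by constants is real-linear, so it is determined
    by the images of 1, i, j, k. This reduces integrals of quaternion products
    to real integrals. *)
Lemma sandwichE p r q : p * q * r = q0 q *: (p * r) + q1 q *: (p * qi R * r)
  + q2 q *: (p * qj R * r) + q3 q *: (p * qk R * r).
Proof.
have {1}-> : q = q0 q *: 1 + q1 q *: qi R + q2 q *: qj R + q3 q *: qk R.
  by case: q => a b c d; congr Quat => /=; ring.
by rewrite !mulrDr !mulrDl -!scalerAr -!scalerAl mulr1.
Qed.

Lemma qi2 : qi R * qi R = - 1.
Proof. by congr Quat => /=; ring. Qed.

Lemma qj2 : qj R * qj R = - 1.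
Proof. by congr Quat => /=; ring. Qed.

Lemma qconjM p q : qconj (p * q) = qconj q * qconj p.
Proof. by congr Quat => /=; ring. Qed.

Lemma qconjZ t q : qconj (t *: q) = t *: qconj q.
Proof. by congr Quat => /=; ring. Qed.

Lemma qconjD p q : qconj (p + q) = qconj p + qconj q.
Proof. by congr Quat => /=; ring. Qed.

Lemma qconj1 : qconj 1 = 1 :> quat R.
Proof. by congr Quat => /=; rewrite oppr0. Qed.

Lemma qconj_qi : qconj (qi R) = - qi R.
Proof. by congr Quat => /=; rewrite oppr0. Qed.

Lemma qconj_qj : qconj (qj R) = - qj R.
Proof. by congr Quat => /=; rewrite oppr0. Qed.

(** R + R u is commutative, although the quaternions are not. *)
Lemma comm_span u (a b c d : R) :
  (a *: 1 + b *: u) * (c *: 1 + d *: u) = (c *: 1 + d *: u) * (a *: 1 + b *: u).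
Proof.
rewrite !mulrDl !mulrDr -!scalerAl -!scalerAr !mul1r !mulr1 !scalerA.
by rewrite (mulrC a c) (mulrC a d) (mulrC b c) (mulrC b d) addrACA.
Qed.

Section unit_phase.
Variable u : quat R.
Hypothesis u2 : u * u = - 1.

Lemma qcisD s t : qcis u (s + t) = qcis u s * qcis u t.
Proof.
rewrite /qcis cosD sinD !mulrDl !mulrDr -!scalerAl -!scalerAr !mul1r !mulr1 !scalerA u2.
rewrite scalerN scalerBl scalerDl [X in _ = _ + X]addrC addrACA.
by rewrite -!addrA; congr (_ + _); rewrite addrCA [RHS]addrCA; congr (_ + _);
  exact: addrC.
Qed.

Lemma qcis0 : qcis u 0 = 1.
Proof. by rewrite /qcis cos0 sin0 scale1r scale0r addr0. Qed.

Lemma qcisNK t : qcis u (- t) * qcis u t = 1.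
Proof. by rewrite -qcisD addNr qcis0. Qed.

Lemma qcisKN t : qcis u t * qcis u (- t) = 1.
Proof. by rewrite -qcisD subrr qcis0. Qed.

Lemma qpow_inv (b s : R) : b != 0 -> (qpow u b s)^-1 =
  `|b| `^ (- s) *: qcis u (- (Num.sg b * s * pi / 2)).
Proof.
move=> b0; set z := (RHS).
have yz : qpow u b s * z = 1.
  rewrite /qpow /z -scalerAl -scalerAr scalerA qcisKN -powRD ?normr_eq0 ?b0 ?implybT//.
  by rewrite subrr powRr0 scale1r.
have uy : qpow u b s \is a GRing.unit.
  change (qpow u b s != 0); apply/eqP => y0; move: yz; rewrite y0 mul0r.
  by move/esym/eqP; rewrite oner_eq0.
by rewrite -[LHS]mulr1 -yz mulKr.
Qed.

End unit_phase.

Lemma qconj_qcis u t : qconj u = - u -> qconj (qcis u t) = qcis u (- t).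
Proof.
by move=> cu; rewrite /qcis qconjD !qconjZ qconj1 cu cosN sinN scalerN scaleNr.
Qed.

(** The value E_mu(sg u y), for a sign sg, summed over parities so that
    products with kernels on both sides expand by distributivity. *)
Definition kernQ (sg : R) u mu y : quat R :=
  \sum_(e : bool) (sg ^+ e * kern e mu y) *: u ^+ e.

Lemma kernQ_span sg u mu y :
  kernQ sg u mu y = (kern false mu y) *: 1 + (sg * kern true mu y) *: u.
Proof. by rewrite /kernQ big_bool/= expr1 !expr0 mul1r expr1 addrC. Qed.

Lemma kernQ_comm sg u mu y t : kernQ sg u mu y * qcis u t = qcis u t * kernQ sg u mu y.
Proof. by rewrite kernQ_span /qcis comm_span. Qed.

Lemma kernQ_opp sg u mu y : kernQ sg u mu (- y) = kernQ (- sg) u mu y.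
Proof.
by rewrite !kernQ_span !kernN/= ?expr0 ?expr1 ?mul1r ?mulN1r ?mulrN ?mulNr.
Qed.

Lemma dunklE_kernQ mu u x y : dunklE mu u x y = kernQ 1 u mu (x * y).
Proof. by rewrite kernQ_span mul1r. Qed.

Lemma qconj_kernQ sg u mu y : qconj u = - u -> qconj (kernQ sg u mu y) =
  kernQ (- sg) u mu y.
Proof.
by move=> cu; rewrite !kernQ_span qconjD !qconjZ qconj1 cu scalerN mulNr scaleNr.
Qed.

End quaternion_algebra.

(** * Quaternion-valued integrals *)

Section quaternion_integral.
Variable R : realType.
Local Notation leb := (@lebesgue_measure R).
Local Notation leb2 := (prodm leb leb).
Variable mu : R.
Implicit Types (f h : R * R -> quat R) (k : R * R -> R) (p r : quat R).

Local Notation W := (dunkl_weight mu).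

Definition qintegrable f : Prop :=
  [/\ wintegrable mu (fun v => q0 (f v)), wintegrable mu (fun v => q1 (f v)),
      wintegrable mu (fun v => q2 (f v)) & wintegrable mu (fun v => q3 (f v))].

Lemma wintegrableD (g g' : R * R -> R) : wintegrable mu g -> wintegrable mu g' ->
  wintegrable mu (fun v => g v + g' v).
Proof.
move=> rg rg'; apply: eq_integrable (RintegrableD rg rg') => // v _ /=.
by rewrite mulrDr.
Qed.

Lemma wintegrableZ (c : R) (g : R * R -> R) : wintegrable mu g ->
  wintegrable mu (fun v => c * g v).
Proof.
move=> rg; apply: eq_integrable (RintegrableZ c rg) => // v _ /=.
by rewrite mulrCA.
Qed.

Lemma wintegrable0 : wintegrable mu (fun=> 0).
Proof.
apply: eq_integrable (@Rintegrable0 _ _ _ leb2) => // v _ /=.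
by rewrite mulr0.
Qed.

Lemma qintegrableD f h : qintegrable f -> qintegrable h ->
  qintegrable (fun v => f v + h v).
Proof. by move=> [f0 f1 f2 f3] [h0 h1 h2 h3]; split => /=; exact: wintegrableD. Qed.

Lemma qintegrable0 : qintegrable (fun=> 0).
Proof. by split; exact: wintegrable0. Qed.

Lemma qintegrable_sum (I : Type) (s : seq I) (F : I -> R * R -> quat R) :
  (forall i, qintegrable (F i)) -> qintegrable (fun v => \sum_(i <- s) F i v).
Proof.
move=> rF; elim: s => [|i s IH].
  by under eq_fun do rewrite big_nil; exact: qintegrable0.
by under eq_fun do rewrite big_cons; exact: qintegrableD.
Qed.

Lemma qintegrable_bounded (C : R) f k : qintegrable f -> measurable_fun setT k ->
  (forall v, `|k v| <= C) -> qintegrable (fun v => k v *: f v).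
Proof.
by move=> [f0 f1 f2 f3] mk kC; split => /=; exact: (wintegrable_bounded (C := C)).
Qed.

Lemma qintegrable_real (g : R * R -> R) p : wintegrable mu g ->
  qintegrable (fun v => g v *: p).
Proof.
move=> rg; have H (c : R) : wintegrable mu (fun v => g v * c).
  apply: eq_integrable (wintegrableZ c rg) => // v _ /=; congr (_ * _)%:E.
  exact: mulrC.
by split => /=; exact: H.
Qed.

Lemma qintegrable_sandwich p r f : qintegrable f -> qintegrable (fun v => p * f v * r).
Proof.
move=> [f0 f1 f2 f3]; under eq_fun do rewrite sandwichE.
by do !apply: qintegrableD; exact: qintegrable_real.
Qed.

Lemma qintD f h : qintegrable f -> qintegrable h ->
  qint mu (fun v => f v + h v) = qint mu f + qint mu h.
Proof.
have H (g g' : R * R -> R) : wintegrable mu g -> wintegrable mu g' ->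
    \int[leb2]_v (W v * (g v + g' v)) = \int[leb2]_v (W v * g v) + \int[leb2]_v
      (W v * g' v).
  move=> rg rg'; rewrite -RintegralD//.
  by apply: eq_Rintegral => v _; rewrite mulrDr.
by move=> [f0 f1 f2 f3] [h0 h1 h2 h3]; congr Quat; exact: H.
Qed.

Lemma qint0 : qint mu (fun=> 0) = 0.
Proof.
have H : \int[leb2]_v (W v * 0) = 0.
  by under eq_Rintegral do rewrite mulr0; rewrite /Rintegral integral0.
by congr Quat; exact: H.
Qed.

Lemma qint_sum (I : Type) (s : seq I) (F : I -> R * R -> quat R) :
  (forall i, qintegrable (F i)) ->
  qint mu (fun v => \sum_(i <- s) F i v) = \sum_(i <- s) qint mu (F i).
Proof.
move=> rF; elim: s => [|i s IH].
  by under eq_fun do rewrite big_nil; rewrite big_nil qint0.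
under eq_fun do rewrite big_cons; rewrite big_cons -IH qintD//.
exact: qintegrable_sum.
Qed.

Lemma qint_real (g : R * R -> R) p : wintegrable mu g ->
  qint mu (fun v => g v *: p) = (\int[leb2]_v (W v * g v)) *: p.
Proof.
move=> rg; have H (c : R) :
    \int[leb2]_v (W v * (g v * c)) = (\int[leb2]_v (W v * g v)) * c.
  rewrite -RintegralZr//.
  by apply: eq_Rintegral => v _; rewrite mulrA.
by congr Quat; exact: H.
Qed.

Lemma qint_sandwich p r f : qintegrable f ->
  qint mu (fun v => p * f v * r) = p * qint mu f * r.
Proof.
move=> [f0 f1 f2 f3]; rewrite [RHS]sandwichE.
under eq_fun do rewrite sandwichE.
by rewrite !qintD ?qint_real//; do ?apply: qintegrableD; exact: qintegrable_real.
Qed.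

Lemma qintZ (c : R) f : qintegrable f -> qint mu (fun v => c *: f v) = c *: qint mu f.
Proof.
move=> rf; rewrite -[f in RHS]/(fun v => f v).
have := qint_sandwich c%:A 1 rf; rewrite mulr1 -scalerAl mul1r => <-.
by congr qint; apply/funext => v; rewrite mulr1 -scalerAl mul1r.
Qed.

Lemma qborelD f h : qborel f -> qborel h -> qborel (fun v => f v + h v).
Proof.
by move=> [f0 f1 f2 f3] [h0 h1 h2 h3]; split => /=; exact: measurable_funD.
Qed.

Lemma qborel_cst p : qborel (fun=> p).
Proof. by split; exact: measurable_cst. Qed.

Lemma qborelZ k f : measurable_fun setT k -> qborel f -> qborel (fun v => k v *: f v).
Proof. by move=> mk [f0 f1 f2 f3]; split => /=; exact: measurable_funM. Qed.

Lemma qborel_sandwich p r f : qborel f -> qborel (fun v => p * f v * r).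
Proof.
move=> [f0 f1 f2 f3]; under eq_fun do rewrite sandwichE.
by do !apply: qborelD; apply: qborelZ => //; exact: qborel_cst.
Qed.

Lemma qborel_sum (I : Type) (s : seq I) (F : I -> R * R -> quat R) :
  (forall i, qborel (F i)) -> qborel (fun v => \sum_(i <- s) F i v).
Proof.
move=> rF; elim: s => [|i s IH].
  by under eq_fun do rewrite big_nil; exact: qborel_cst.
by under eq_fun do rewrite big_cons; exact: qborelD.
Qed.

(** Multiplication by phases is a combination of constant multiplications with
    bounded real coefficients, whence its effect on integrability and
    measurability. *)
Lemma phaseE (u q u' : quat R) (s t : R) : qcis u s * q * qcis u' t =
  (cos s * cos t) *: (1 * q * 1) + (cos s * sin t) *: (1 * q * u') +
  ((sin s * cos t) *: (u * q * 1) + (sin s * sin t) *: (u * q * u')).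
Proof.
rewrite /qcis !mulrDl !mulrDr -!scalerAl -!scalerAr !scalerA.
by [].
Qed.

Lemma measurable_mul_comp (F G : R -> R) (s t : R * R -> R) :
  continuous F -> continuous G -> measurable_fun setT s -> measurable_fun setT t ->
  measurable_fun setT (fun v => F (s v) * G (t v)).
Proof.
move=> cF cG ms mt; apply: measurable_funM.
  by apply: measurableT_comp => //; exact: continuous_measurable_fun.
by apply: measurableT_comp => //; exact: continuous_measurable_fun.
Qed.

Lemma qintegrable_phase u u' (s t : R * R -> R) f : measurable_fun setT s ->
  measurable_fun setT t -> qintegrable f ->
  qintegrable (fun v => qcis u (s v) * f v * qcis u' (t v)).
Proof.
move=> ms mt rf; under eq_fun do rewrite phaseE.
have B (x y : R) : `|x| <= 1 -> `|y| <= 1 -> `|x * y| <= 1.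
  by move=> x1 y1; rewrite normrM mulr_ile1.
have cs x : `|cos x : R| <= 1 by rewrite ler_norml cos_geN1 cos_le1.
have sn x : `|sin x : R| <= 1 by rewrite ler_norml sin_geN1 sin_le1.
do !apply: qintegrableD; apply: (qintegrable_bounded (C := 1));
  first [exact: qintegrable_sandwich|by move=> v;
    exact: B|apply: measurable_mul_comp => //;
    first [exact: continuous_cos|exact: continuous_sin]].
Qed.

Lemma qborel_phase u u' (s t : R * R -> R) f : measurable_fun setT s ->
  measurable_fun setT t -> qborel f ->
  qborel (fun v => qcis u (s v) * f v * qcis u' (t v)).
Proof.
move=> ms mt rf; under eq_fun do rewrite phaseE.
do !apply: qborelD; apply: qborelZ;
  first [exact: qborel_sandwich|apply: measurable_mul_comp => //;
    first [exact: continuous_cos|exact: continuous_sin]].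
Qed.

Lemma qnorm_comp (q : quat R) : [/\ `|q0 q| <= qnorm q, `|q1 q| <= qnorm q,
  `|q2 q| <= qnorm q & `|q3 q| <= qnorm q].
Proof.
rewrite /qnorm q0_mul_conj.
have := (sqr_ge0 (q0 q), sqr_ge0 (q1 q), sqr_ge0 (q2 q), sqr_ge0 (q3 q)).
move=> [[[h0 h1] h2] h3].
by split; rewrite -sqrtr_sqr ler_wsqrtr//; lra.
Qed.

Lemma measurable_qnorm f : qborel f -> measurable_fun setT (fun v => qnorm (f v)).
Proof.
move=> [f0 f1 f2 f3]; apply: measurableT_comp => //.
  by apply: continuous_measurable_fun; exact: sqrt_continuous.
under eq_fun do rewrite q0_mul_conj.
by do ![exact: measurable_funX|apply: measurable_funD].
Qed.

Lemma L1_qintegrable f : qborel f ->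
  (\int[leb2]_v (W v * qnorm (f v))%:E < +oo)%E -> qintegrable f.
Proof.
move=> mf If; have mW := measurable_weight mu.
have W0 := weight_ge0 mu.
have rn : Rintegrable leb2 (fun v => W v * qnorm (f v)).
  apply/integrableP; split.
    apply/measurable_EFinP; apply: measurable_funM => //.
    exact: measurable_qnorm.
  move: If; congr (_ < _)%E; apply: eq_integral => v _ /=.
  by rewrite ger0_norm// mulr_ge0// sqrtr_ge0.
case: mf => f0 f1 f2 f3.
have H (g : R * R -> R) : measurable_fun setT g -> (forall v, `|g v| <= qnorm (f v)) ->
    wintegrable mu g.
  move=> mg gf; apply: le_Rintegrable rn; first exact: measurable_funM.
  by move=> v; rewrite normrM (ger0_norm (W0 v)) ler_wpM2l.
by split; apply: H => // v; have [] := qnorm_comp (f v).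
Qed.

Lemma qint_ae f h : {ae leb2, forall v, f v = h v} -> qint mu f = qint mu h.
Proof.
by move=> fh; congr Quat; apply: Rintegral_ae;
  apply: (filterS (F := almost_everywhere leb2)) fh => v ->.
Qed.

End quaternion_integral.

(** * Inversion of the transform without phases *)

Section quaternion_transform.
Variable R : realType.
Local Notation leb := (@lebesgue_measure R).
Local Notation leb2 := (prodm leb leb).
Variables (mu : R) (b : R * R).
Hypotheses (hmu : - (1 / 2) <= mu) (hb1 : b.1 != 0) (hb2 : b.2 != 0).
Implicit Types (e : bool * bool) (s v w : R * R) (h : R * R -> quat R) (sg : R).

Local Notation W := (dunkl_weight mu).

Definition real_transformQ e h w : quat R := qint mu (fun v => kern2 mu b e w v *: h v).

(** The transform stripped of constants and phases: the direct one for sg = -1,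
    the inverse one for sg = 1. *)
Definition kernel_transform sg h w : quat R := qint mu (fun v =>
  kernQ sg (qi R) mu (w.1 / b.1 * v.1) * h v * kernQ sg (qj R) mu (w.2 / b.2 * v.2)).

Definition pairing e s h : quat R := qint mu (fun v => mgauss2 e s v *: h v).

Lemma kern_sandwichE sg h w v :
  kernQ sg (qi R) mu (w.1 / b.1 * v.1) * h v * kernQ sg (qj R) mu (w.2 / b.2 * v.2) =
  \sum_(e : bool * bool) (sg ^+ e.1 * sg ^+ e.2) *:
    (qi R ^+ e.1 * (kern2 mu b e w v *: h v) * qj R ^+ e.2).
Proof.
rewrite /kernQ !mulr_suml -(pair_bigA _ (fun e1 e2 : bool => (sg ^+ e1 * sg ^+ e2) *:
    (qi R ^+ e1 * (kern2 mu b (e1, e2) w v *: h v) * qj R ^+ e2)))/=.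
apply: eq_bigr => e1 _; rewrite mulr_sumr; apply: eq_bigr => e2 _.
rewrite -!scalerAl -!scalerAr -!scalerAl !scalerA; congr (_ *: _).
by rewrite /kern2 mulrACA.
Qed.

Lemma qintegrable_kern2 e h w : qintegrable mu h ->
  qintegrable mu (fun v => kern2 mu b e w v *: h v).
Proof.
move=> rh; apply: (qintegrable_bounded (C := 1)) => //; first exact: measurable_kern2.
by move=> v; exact: kern2_le1.
Qed.

Lemma qintegrableZ (c : R) h : qintegrable mu h -> qintegrable mu (fun v => c *: h v).
Proof. by move=> rh; apply: (qintegrable_bounded (C := `|c|)). Qed.

Lemma qintegrable_kern_sandwich sg h w : qintegrable mu h -> qintegrable mu (fun v =>
  kernQ sg (qi R) mu (w.1 / b.1 * v.1) * h v * kernQ sg (qj R) mu (w.2 / b.2 * v.2)).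
Proof.
move=> rh; under eq_fun do rewrite kern_sandwichE.
by apply: qintegrable_sum => e; apply: qintegrableZ; apply: qintegrable_sandwich;
  exact: qintegrable_kern2.
Qed.

Lemma kernel_transform_sum sg h w : qintegrable mu h -> kernel_transform sg h w =
  \sum_(e : bool * bool) (sg ^+ e.1 * sg ^+ e.2) *:
    (qi R ^+ e.1 * real_transformQ e h w * qj R ^+ e.2).
Proof.
move=> rh; rewrite /kernel_transform; under eq_fun do rewrite kern_sandwichE.
rewrite qint_sum.
  apply: eq_bigr => e _; rewrite qintZ.
    by rewrite qint_sandwich//; exact: qintegrable_kern2.
  by apply: qintegrable_sandwich; exact: qintegrable_kern2.
by move=> e; apply: qintegrableZ; apply: qintegrable_sandwich; exact: qintegrable_kern2.
Qed.

Lemma kernel_transformZ sg (k : R) h w : qintegrable mu h ->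
  kernel_transform sg (fun v => k *: h v) w = k *: kernel_transform sg h w.
Proof.
move=> rh; rewrite /kernel_transform -qintZ; last exact: qintegrable_kern_sandwich.
by congr qint; apply/funext => v; rewrite -scalerAr -scalerAl.
Qed.

Lemma qborel_real_transformQ e h : qintegrable mu h -> qborel (real_transformQ e h).
Proof.
by move=> [r0 r1 r2 r3]; split;
  [exact: (measurable_real_transform b hmu e r0)|exact:
    (measurable_real_transform b hmu e r1)
  |exact: (measurable_real_transform b hmu e r2)|exact:
    (measurable_real_transform b hmu e r3)].
Qed.

Lemma qborel_kernel_transform sg h : qintegrable mu h -> qborel (kernel_transform sg h).
Proof.
move=> rh; rewrite (_ : kernel_transform sg h = fun w =>
  \sum_(e : bool * bool) (sg ^+ e.1 * sg ^+ e.2) *: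
    (qi R ^+ e.1 * real_transformQ e h w * qj R ^+ e.2)); last by apply/funext => w;
      exact: kernel_transform_sum.
apply: qborel_sum => e; apply: qborelZ => //; apply: qborel_sandwich.
exact: qborel_real_transformQ.
Qed.

Lemma qintegrable_mgauss2_real_transformQ e e' s h : 0 < s.1 -> 0 < s.2 ->
  qintegrable mu h ->
  qintegrable mu (fun w => mgauss2 e s w *: real_transformQ e' h w).
Proof.
move=> s1 s2 rh; have rg := wintegrable_mgauss2 hmu e s1 s2.
have H (g : R * R -> R) : wintegrable mu g ->
    wintegrable mu (fun w => mgauss2 e s w * real_transform mu b e' g w).
  move=> wg; have [C hC] := real_transform_bounded b hmu e' wg.
  have := wintegrable_bounded rg (measurable_real_transform b hmu e' wg) hC.
  by apply: eq_integrable => // v _ /=; rewrite [real_transform _ _ _ _ _ * _]mulrC.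
by case: rh => r0 r1 r2 r3; split; exact: H.
Qed.

Lemma qintegrable_mgauss2 e s h : 0 < s.1 -> 0 < s.2 -> qintegrable mu h ->
  qintegrable mu (fun w => mgauss2 e s w *: h w).
Proof.
move=> s1 s2 rh.
have [C1 hC1] := mgauss_bounded e.1 s1; have [C2 hC2] := mgauss_bounded e.2 s2.
apply: (qintegrable_bounded (C := C1 * C2)) => //; first exact: measurable_mgauss2.
by move=> v; rewrite normrM ler_pM.
Qed.

Lemma mgauss2_kernel_transformE e s sg h : qintegrable mu h ->
  (fun w => mgauss2 e s w *: kernel_transform sg h w) =
  (fun w => \sum_(e' : bool * bool) (sg ^+ e'.1 * sg ^+ e'.2) *:
    (qi R ^+ e'.1 * (mgauss2 e s w *: real_transformQ e' h w) * qj R ^+ e'.2)).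
Proof.
move=> rh; apply/funext => w; rewrite kernel_transform_sum// scaler_sumr;
  apply: eq_bigr => e' _.
by rewrite -!scalerAr -!scalerAl !scalerA mulrC.
Qed.

Lemma qintegrable_mgauss2_kernel_transform e s sg h : 0 < s.1 -> 0 < s.2 ->
  qintegrable mu h ->
  qintegrable mu (fun w => mgauss2 e s w *: kernel_transform sg h w).
Proof.
move=> s1 s2 rh; rewrite mgauss2_kernel_transformE//.
by apply: qintegrable_sum => e'; apply: qintegrableZ; apply: qintegrable_sandwich;
  exact: qintegrable_mgauss2_real_transformQ.
Qed.

Lemma pairing_real_transformQ e e' s h : 0 < s.1 -> 0 < s.2 -> qintegrable mu h ->
  pairing e s (real_transformQ e' h) = (e' == e)%:R *:
    (gcoef2 mu b e' s *: pairing e' (dual_scale b s) h).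
Proof.
move=> s1 s2 [r0 r1 r2 r3]; congr Quat => /=.
- exact: (real_transform_mgauss2 hmu hb1 hb2 e' e s1 s2 r0).
- exact: (real_transform_mgauss2 hmu hb1 hb2 e' e s1 s2 r1).
- exact: (real_transform_mgauss2 hmu hb1 hb2 e' e s1 s2 r2).
- exact: (real_transform_mgauss2 hmu hb1 hb2 e' e s1 s2 r3).
Qed.

(** Of the four scalar transforms only the one of the parity e of the test
    function survives. *)
Lemma pairing_kernel_transform e s sg h : 0 < s.1 -> 0 < s.2 -> qintegrable mu h ->
  pairing e s (kernel_transform sg h) = (sg ^+ e.1 * sg ^+ e.2 * gcoef2 mu b e s) *:
    (qi R ^+ e.1 * pairing e (dual_scale b s) h * qj R ^+ e.2).
Proof.
move=> s1 s2 rh; rewrite /pairing mgauss2_kernel_transformE// qint_sum; last first.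
  by move=> e'; apply: qintegrableZ; apply: qintegrable_sandwich;
    exact: qintegrable_mgauss2_real_transformQ.
have E e' : qint mu (fun w => (sg ^+ e'.1 * sg ^+ e'.2) *:
    (qi R ^+ e'.1 * (mgauss2 e s w *: real_transformQ e' h w) * qj R ^+ e'.2)) =
    (sg ^+ e'.1 * sg ^+ e'.2) *: (qi R ^+ e'.1 * ((e' == e)%:R *:
    (gcoef2 mu b e' s *: pairing e' (dual_scale b s) h)) * qj R ^+ e'.2).
  rewrite -(pairing_real_transformQ e e' s1 s2 rh) qintZ ?qint_sandwich//.
    exact: qintegrable_mgauss2_real_transformQ.
  by apply: qintegrable_sandwich; exact: qintegrable_mgauss2_real_transformQ.
rewrite (bigD1 e)//= E eqxx scale1r big1 ?addr0.
  by rewrite -scalerAr -scalerAl scalerA.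
by move=> e' /negbTE ee'; rewrite E ee' scale0r mulr0 mul0r scaler0.
Qed.

(** The two passes contribute i^2 = -1 for an odd first parity and j^2 = -1 for
    an odd second one; the opposite signs sg of the two passes compensate them.
    *)
Lemma pairing_kernel_transform2 e s h : 0 < s.1 -> 0 < s.2 -> qintegrable mu h ->
  qintegrable mu (kernel_transform (-1) h) ->
  pairing e s (kernel_transform 1 (kernel_transform (-1) h)) =
    kappa mu b *: pairing e s h.
Proof.
move=> s1 s2 rh rV; have [d1 d2] := dual_scale_gt0 hb1 hb2 s1 s2.
rewrite pairing_kernel_transform// pairing_kernel_transform// dual_scaleK// !expr1n
  !mul1r.
rewrite -scalerAr -scalerAl scalerA mulrCA gcoef2_dual//.
move: (kappa mu b) (pairing e s h) => K P; rewrite -!mulrA -exprD !mulrA -exprD.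
case: e => [[] []]; rewrite /= ?expr0 ?expr1 ?addn0 ?addn1 ?expr2 ?qi2 ?qj2.
- by rewrite !mulN1r !mulrN1 !opprK mul1r.
- by rewrite !mulr1 !mulN1r scaleNr scalerN opprK.
- by rewrite !mul1r mulrN1 mulN1r scaleNr scalerN opprK.
- by rewrite !mulr1 !mul1r.
Qed.

(** The difference of the two sides is Borel and has zero pairings, so each
    component vanishes almost everywhere. *)
Lemma kernel_transform_inversion h : qborel h -> qintegrable mu h ->
  qintegrable mu (kernel_transform (-1) h) ->
  {ae leb2, forall v, kernel_transform 1 (kernel_transform (-1) h) v =
    kappa mu b *: h v}.
Proof.
move=> mh rh rV; pose D v := kernel_transform 1 (kernel_transform (-1) h) v +
  (- kappa mu b) *: h v.
have mD : qborel D.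
  by apply: qborelD; [exact: qborel_kernel_transform|apply: qborelZ].
have DE e s : (fun v => mgauss2 e s v *: D v) =
  (fun v => mgauss2 e s v *: kernel_transform 1 (kernel_transform (-1) h) v +
    (- kappa mu b) *: (mgauss2 e s v *: h v)).
  by apply/funext => v; rewrite /D scalerDr !scalerA [mgauss2 e s v * _]mulrC.
have rD e s : 0 < s.1 -> 0 < s.2 -> qintegrable mu (fun v => mgauss2 e s v *: D v).
  move=> s1 s2; rewrite DE; apply: qintegrableD;
    first exact: qintegrable_mgauss2_kernel_transform.
  by apply: qintegrableZ; exact: qintegrable_mgauss2.
have D0 e s : 0 < s.1 -> 0 < s.2 -> pairing e s D = 0.
  move=> s1 s2; rewrite /pairing DE qintD; last 2 first.
  - exact: qintegrable_mgauss2_kernel_transform.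
  - by apply: qintegrableZ; exact: qintegrable_mgauss2.
  rewrite qintZ; last exact: qintegrable_mgauss2.
  by rewrite -/(pairing e s (kernel_transform 1 (kernel_transform (-1) h)))
    pairing_kernel_transform2// scaleNr subrr.
case: mD => m0 m1 m2 m3.
have a0 : {ae leb2, forall v, q0 (D v) = 0}.
  apply: (@wintegrable_mgauss2_separates R mu _ m0) => e s s1 s2;
    first by case: (rD e s s1 s2).
  exact: (congr1 (@q0 R) (D0 e s s1 s2)).
have a1 : {ae leb2, forall v, q1 (D v) = 0}.
  apply: (@wintegrable_mgauss2_separates R mu _ m1) => e s s1 s2;
    first by case: (rD e s s1 s2).
  exact: (congr1 (@q1 R) (D0 e s s1 s2)).
have a2 : {ae leb2, forall v, q2 (D v) = 0}.
  apply: (@wintegrable_mgauss2_separates R mu _ m2) => e s s1 s2;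
    first by case: (rD e s s1 s2).
  exact: (congr1 (@q2 R) (D0 e s s1 s2)).
have a3 : {ae leb2, forall v, q3 (D v) = 0}.
  apply: (@wintegrable_mgauss2_separates R mu _ m3) => e s s1 s2;
    first by case: (rD e s s1 s2).
  exact: (congr1 (@q3 R) (D0 e s s1 s2)).
have F := ae_filter_ringOfSetsType leb2.
have a01 := @filterI _ _ F _ _ a0 a1; have a23 := @filterI _ _ F _ _ a2 a3.
apply: (@filterS2 _ _ F _ _ _ _ a01 a23) => v [h0 h1] [h2 h3].
have : D v = 0 by case: (D v) h0 h1 h2 h3 => /= ? ? ? ? -> -> -> ->.
by rewrite /D scaleNr => /eqP; rewrite subr_eq0 => /eqP.
Qed.

End quaternion_transform.

(** * Phases of the quadratic-phase kernel *)

Section kernel_factorisation.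
Variable R : realType.
Variables (mu : R) (u : quat R).
Hypotheses (u2 : u * u = - 1) (cu : qconj u = - u).
Implicit Types (a b c d e w v : R).

Definition outer_phase b c e w : R :=
  - (Num.sg b * (mu + 1) * pi / 2) - (c * w ^+ 2 + e * w).

Definition inner_phase a d v : R := - (a * v ^+ 2 + d * v).

(** The modulus of (u b)^(-(mu + 1)). *)
Definition modulus b : R := `|b| `^ (- (mu + 1)).

(** All factors of the kernel lie in R + R u and commute. This order suits a
    kernel multiplying f on the left; [PsiE_rev] is the one for the right. *)
Lemma PsiE a b c d e w v : b != 0 -> Psi mu u a b c d e w v =
  modulus b *: (qcis u (outer_phase b c e w) * kernQ (-1) u mu (w / b * v)
                * qcis u (inner_phase a d v)).
Proof.
move=> b0; rewrite /Psi dunklE_kernQ !mulNr kernQ_opp qpow_inv// -scalerAr -scalerAl.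
congr (_ *: _); rewrite -kernQ_comm -!mulrA -!qcisD//; congr (_ * qcis u _).
by rewrite /outer_phase /inner_phase; ring.
Qed.

Lemma PsiE_rev a b c d e w v : b != 0 -> Psi mu u a b c d e w v =
  modulus b *: (qcis u (inner_phase a d v) * kernQ (-1) u mu (w / b * v)
                * qcis u (outer_phase b c e w)).
Proof.
move=> b0; rewrite PsiE//; congr (_ *: _).
by rewrite -!kernQ_comm -!mulrA -!qcisD// [inner_phase _ _ _ + _]addrC.
Qed.

Lemma qconj_PsiE a b c d e w v : b != 0 -> qconj (Psi mu u a b c d e w v) =
  modulus b *: (qcis u (- inner_phase a d v) * kernQ 1 u mu (v / b * w)
                * qcis u (- outer_phase b c e w)).
Proof.
move=> b0; rewrite PsiE// qconjZ !qconjM !qconj_qcis// qconj_kernQ// (opprK (1 : R))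
  mulrA.
by rewrite (_ : w / b * v = v / b * w); last by rewrite mulrAC [RHS]mulrAC (mulrC w).
Qed.

(** Conjugation negates both phases and the sign in E_mu; so do the change of
    (a, b, c, d, e) into (-c, -b, -a, -e, -d) and the exchange of w and v.
    Hence the two inversion formulas are the same. *)
Lemma qconj_Psi a b c d e w v : b != 0 ->
  qconj (Psi mu u a b c d e w v) = Psi mu u (- c) (- b) (- a) (- e) (- d) v w.
Proof.
move=> b0; rewrite qconj_PsiE// PsiE_rev ?oppr_eq0// /modulus normrN; congr (_ *: _).
rewrite invrN mulrN mulNr kernQ_opp (opprK (1 : R)).
rewrite -!kernQ_comm -!mulrA -!qcisD//; congr (_ * qcis u _).
by rewrite /outer_phase /inner_phase sgrN; ring.
Qed.

End kernel_factorisation.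

(** * Inversion of the quadratic-phase transform *)

Section inversion.
Variable R : realType.
Local Notation leb := (@lebesgue_measure R).
Local Notation leb2 := (prodm leb leb).
Variables (mu : R) (a b c d e : R * R).
Hypotheses (hmu : - (1 / 2) <= mu) (hb1 : b.1 != 0) (hb2 : b.2 != 0).
Implicit Types (f g h : R * R -> quat R) (v w : R * R).

Local Notation W := (dunkl_weight mu).
Local Notation F := (QQPDT mu a b c d e).

(** The function f with the phases of the kernels in the variable v absorbed.
    *)
Definition twist g v : quat R :=
  qcis (qi R) (inner_phase a.1 d.1 v.1) * g v * qcis (qj R) (inner_phase a.2 d.2 v.2).

Definition untwist g v : quat R :=
  qcis (qi R) (- inner_phase a.1 d.1 v.1) * g v * qcis (qj R)
    (- inner_phase a.2 d.2 v.2).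

Definition outer_twist g w : quat R :=
  qcis (qi R) (outer_phase mu b.1 c.1 e.1 w.1) * g w
  * qcis (qj R) (outer_phase mu b.2 c.2 e.2 w.2).

Definition outer_untwist g w : quat R :=
  qcis (qi R) (- outer_phase mu b.1 c.1 e.1 w.1) * g w
  * qcis (qj R) (- outer_phase mu b.2 c.2 e.2 w.2).

Definition norm_const : R := dunkl_c mu ^+ 2 * (modulus mu b.1 * modulus mu b.2).

Lemma qcis_sandwichK (s t : R) (q : quat R) :
  qcis (qi R) (- s) * (qcis (qi R) s * q * qcis (qj R) t) * qcis (qj R) (- t) = q.
Proof.
rewrite -!mulrA (qcisKN (qj2 R)) mulr1 mulrA (qcisNK (qi2 R)).
exact: mul1r.
Qed.

Lemma twistK g v : untwist (twist g) v = g v.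
Proof. exact: qcis_sandwichK. Qed.

Lemma outer_twistK g w : outer_untwist (outer_twist g) w = g w.
Proof. exact: qcis_sandwichK. Qed.

Lemma measurable_inner_phase (x y : R) : measurable_fun setT (inner_phase x y).
Proof.
apply: measurableT_comp => //; apply: measurable_funD; apply: measurable_funM => //.
Qed.

Lemma measurable_outer_phase (x y z : R) : measurable_fun setT (outer_phase mu x y z).
Proof.
apply: measurable_funB => //; apply: measurable_funD; apply: measurable_funM => //.
Qed.

Lemma QQPDT_kernel_transform g w : qintegrable mu (twist g) ->
  F g w = norm_const *: outer_twist (kernel_transform mu b (-1) (twist g)) w.
Proof.
move=> rh; rewrite /QQPDT /norm_const /outer_twist -scalerA; congr (_ *: _).
rewrite /kernel_transform -qint_sandwich; last exact: qintegrable_kern_sandwich.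
rewrite -qintZ; last by apply: qintegrable_sandwich; exact: qintegrable_kern_sandwich.
congr qint; apply/funext => v.
rewrite (PsiE mu (qi2 R))// (PsiE_rev mu (qj2 R))// /twist.
by rewrite -!scalerAl -!scalerAr scalerA !mulrA.
Qed.

Lemma conj_QQPDT_kernel_transform h v : qintegrable mu h ->
  dunkl_c mu ^+ 2 *: qint mu (fun w =>
      qconj (Psi mu (qi R) a.1 b.1 c.1 d.1 e.1 w.1 v.1)
      * outer_twist h w
      * qconj (Psi mu (qj R) a.2 b.2 c.2 d.2 e.2 w.2 v.2)) =
  norm_const *: untwist (kernel_transform mu b 1 h) v.
Proof.
move=> rh; rewrite /norm_const /untwist -scalerA; congr (_ *: _).
rewrite /kernel_transform -qint_sandwich; last exact: qintegrable_kern_sandwich.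
rewrite -qintZ; last by apply: qintegrable_sandwich; exact: qintegrable_kern_sandwich.
congr qint; apply/funext => w.
rewrite (qconj_PsiE _ (qi2 R) (qconj_qi R))//.
rewrite [qconj (Psi _ (qj R) _ _ _ _ _ _ _)](_ : _ = modulus mu b.2 *:
  (qcis (qj R) (- outer_phase mu b.2 c.2 e.2 w.2) * kernQ 1 (qj R) mu (v.2 / b.2 * w.2)
   * qcis (qj R) (- inner_phase a.2 d.2 v.2))); last first.
  rewrite (qconj_PsiE _ (qj2 R) (qconj_qj R))//; congr (_ *: _).
  by rewrite -!kernQ_comm -!mulrA -!(qcisD (qj2 R)) [- outer_phase _ _ _ _ _ + _]addrC.
rewrite -!scalerAl -!scalerAr scalerA; congr (_ *: _).
rewrite -[in RHS](outer_twistK h w) /outer_untwist.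
by rewrite !mulrA.
Qed.

Lemma norm_const_kappa : norm_const ^+ 2 * kappa mu b = 1.
Proof.
have m0 := le_half_powD1 hmu.
have g0 : 0 < gauss_moment (2 * mu + 1) 1 :> R by rewrite gauss_moment_gt0.
rewrite /norm_const /kappa /modulus.
have -> : dunkl_c mu = (gauss_moment (2 * mu + 1) 1)^-1.
  rewrite /dunkl_c /gauss_moment; congr (_^-1); apply: eq_Rintegral => x _.
  by rewrite mulrC mul1r mulNr.
have H (x : R) : `|x| `^ (2 * (mu + 1)) = (`|x| `^ (mu + 1)) ^+ 2.
  by rewrite mulrC powRrM powR_mulrn// powR_ge0.
rewrite !H !powRN.
have p1 : 0 < `|b.1| `^ (mu + 1) by rewrite powR_gt0// normr_gt0.
have p2 : 0 < `|b.2| `^ (mu + 1) by rewrite powR_gt0// normr_gt0.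
move: (gauss_moment _ _) (_ `^ _) (_ `^ _) g0 p1 p2 => x y z x0 y0 z0.
by field; rewrite !gt_eqF.
Qed.

(** Since the phases are invertible, the integrability of the transform of g
    gives that of the phase-free transform of the twisted function, which is
    what the phase-free inversion requires. *)
Lemma borel_inversion g : qborel g -> qintegrable mu g ->
  (\int[leb2]_w (W w * qnorm (F g w))%:E < +oo)%E ->
  {ae leb2, forall v,
    dunkl_c mu ^+ 2 *: qint mu (fun w =>
      qconj (Psi mu (qi R) a.1 b.1 c.1 d.1 e.1 w.1 v.1) * F g w
      * qconj (Psi mu (qj R) a.2 b.2 c.2 d.2 e.2 w.2 v.2)) = g v}.
Proof.
move=> mg rg iF.
have mi1 := measurable_fun_fst (measurable_inner_phase a.1 d.1).
have mi2 := measurable_fun_snd (measurable_inner_phase a.2 d.2).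
have mo1 := measurable_fun_fst (measurable_outer_phase b.1 c.1 e.1).
have mo2 := measurable_fun_snd (measurable_outer_phase b.2 c.2 e.2).
have rh : qintegrable mu (twist g) by exact: qintegrable_phase.
have mh : qborel (twist g) by exact: qborel_phase.
have FE : F g = (fun w => norm_const *: outer_twist
  (kernel_transform mu b (-1) (twist g)) w).
  by apply/funext => w; exact: QQPDT_kernel_transform.
have N0 : norm_const != 0.
  by apply/eqP => N0; have /eqP := norm_const_kappa;
    rewrite N0 expr0n mul0r eq_sym oner_eq0.
have mV : qborel (kernel_transform mu b (-1) (twist g)) by exact:
  qborel_kernel_transform.
have mF : qborel (F g).
  by rewrite FE; apply: qborelZ => //; exact: qborel_phase.
have rF : qintegrable mu (F g) by exact: L1_qintegrable.
have rV : qintegrable mu (kernel_transform mu b (-1) (twist g)).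
  rewrite (_ : kernel_transform mu b (-1) (twist g) = fun w =>
    norm_const^-1 *: outer_untwist (F g) w).
    apply: qintegrableZ; apply: qintegrable_phase => //; exact: measurableT_comp.
  apply/funext => w; rewrite FE /outer_untwist -scalerAr -scalerAl scalerA mulVf//
    scale1r.
  by rewrite -[LHS]outer_twistK.
have := kernel_transform_inversion hmu hb1 hb2 mh rh rV.
apply: (@filterS _ _ (ae_filter_ringOfSetsType leb2)) => v Vv.
have -> : (fun w => qconj (Psi mu (qi R) a.1 b.1 c.1 d.1 e.1 w.1 v.1) * F g w
      * qconj (Psi mu (qj R) a.2 b.2 c.2 d.2 e.2 w.2 v.2)) =
    (fun w => qconj (Psi mu (qi R) a.1 b.1 c.1 d.1 e.1 w.1 v.1)
      * outer_twist (fun w => norm_const *: kernel_transform mu b (-1) (twist g) w) w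
      * qconj (Psi mu (qj R) a.2 b.2 c.2 d.2 e.2 w.2 v.2)).
  apply/funext => w; rewrite FE; congr (_ * _ * _).
  by rewrite /outer_twist -scalerAr -scalerAl.
rewrite conj_QQPDT_kernel_transform; last exact: qintegrableZ.
have -> : untwist (kernel_transform mu b 1
  (fun w => norm_const *: kernel_transform mu b (-1) (twist g) w)) v =
    norm_const *: (kappa mu b *: g v).
  rewrite -[in RHS](twistK g v) /untwist scalerA.
  by rewrite kernel_transformZ// Vv scalerA -scalerAr -scalerAl.
by rewrite !scalerA -expr2 norm_const_kappa scale1r.
Qed.

End inversion.

Theorem theorem3p2 (R : realType) (mu : R) (a b c d e : R * R)
    (f : R * R -> quat R)
    (hmu : - (1 / 2) <= mu) (hb1 : b.1 != 0) (hb2 : b.2 != 0)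
    (hf : L1 mu f) (hDf : L1 mu (QQPDT mu a b c d e f)) :
  {ae leb2 R, forall v : R * R,
    QQPDT mu (- c) (- b) (- a) (- e) (- d) (QQPDT mu a b c d e f) v = f v}
  /\
  {ae leb2 R, forall v : R * R,
    dunkl_c mu ^+ 2 *: qint mu (fun w =>
      qconj (Psi mu (qi R) a.1 b.1 c.1 d.1 e.1 w.1 v.1)
      * QQPDT mu a b c d e f w
      * qconj (Psi mu (qj R) a.2 b.2 c.2 d.2 e.2 w.2 v.2)) = f v}.
Proof.
set m := prodm (@lebesgue_measure R) (@lebesgue_measure R).
set F := QQPDT mu a b c d e.
suff second : {ae m, forall v : R * R,
    dunkl_c mu ^+ 2 *: qint mu (fun w =>
      qconj (Psi mu (qi R) a.1 b.1 c.1 d.1 e.1 w.1 v.1) * F f w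
      * qconj (Psi mu (qj R) a.2 b.2 c.2 d.2 e.2 w.2 v.2)) = f v}.
  split; last exact: second.
  apply: (@filterS _ _ (ae_filter_ringOfSetsType m)) second => v <-.
  rewrite /QQPDT; congr (_ *: qint _ _); apply/funext => w.
  by rewrite (qconj_Psi _ (qi2 R) (qconj_qi R))// (qconj_Psi _ (qj2 R) (qconj_qj R)).
(* the transform and the L^1 norm depend only on the almost everywhere class of
   f, so f is exchanged for a Borel representative g *)
case: hf => -[g mg fg] If; case: hDf => _ IF.
have {}fg : {ae m, forall v, f v = g v} by exact: fg.
have Ig : (\int[m]_v (dunkl_weight mu v * qnorm (g v))%:E < +oo)%E.
  have <- := @integral_ae _ _ _ m (fun v => (dunkl_weight mu v * qnorm (f v))%:E).
    exact: If.
  by apply: (@filterS _ _ (ae_filter_ringOfSetsType m)) fg => v ->.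
have Fg : F f = F g.
  apply/funext => w; rewrite /F /QQPDT; congr (_ *: _); apply: qint_ae.
  by apply: (@filterS _ _ (ae_filter_ringOfSetsType m)) fg => v ->.
rewrite -/F Fg in IF.
have := borel_inversion hmu hb1 hb2 mg (L1_qintegrable mg Ig) IF.
rewrite Fg; apply: (@filterS2 _ _ (ae_filter_ringOfSetsType m) _ _ _ _ fg).
by move=> v -> ->.
Qed.
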